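(* Let $m\ge1$ be an integer and $x>0$ real. For $0<q<1$ let $\psi_q^{(m)}(x)=\frac{d^m}{dx^m}\psi_q(x)$ be the q-polygamma function, where $\psi_q(x)=\frac{d}{dx}\log\Gamma_q(x)$. Then, as $q\to1^-$ with $m,x$ fixed, one has the asymptotic expansion $$\psi_q^{(m)}(x)\sim\psi^{(m)}(x)-\sum_{k=0}^\infty\frac{\zeta(1-m-k)}{k!}B_k(x)(\log q)^{m+k},$$ meaning that for every integer $N\ge0$ the difference between $\psi_q^{(m)}(x)$ and the right-hand side with the sum truncated to $0\le k\le N$ is $O(|\log q|^{m+N+1})$ as $q\to1^-$.
   Context: $\Gamma_q(x)=(1-q)^{1-x}\prod_{n=0}^\infty\frac{1-q^{n+1}}{1-q^{n+x}}$ is Jackson's q-gamma function; equivalently $\psi_q^{(m)}(x)=(\log q)^{m+1}\sum_{k=1}^\infty\frac{k^mq^{kx}}{1-q^k}$ for $m\ge1$. $\psi^{(m)}$ is the $m$-th derivative of the digamma function $\psi=\Gamma'/\Gamma$. $B_k(x)$ are the Bernoulli polynomials, $\frac{te^{xt}}{e^t-1}=\sum_{n\ge0}\frac{B_n(x)}{n!}t^n$; $\zeta$ is the Riemann zeta function (analytically continued). *)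

(* Defs.v *)
From Stdlib Require Import Reals ClassicalEpsilon.
From Coquelicot Require Import Coquelicot.

Open Scope R_scope.

(* Gamma function (Euler's integral, for x > 0) and polygamma functions *)

Definition Gamma (x : R) : R :=
  RInt_gen (fun t => Rpower t (x - 1) * exp (- t))
    (at_right 0) (Rbar_locally p_infty).

Definition digamma (x : R) : R := Derive Gamma x / Gamma x.

Definition polygamma (m : nat) (x : R) : R := Derive_n digamma m x.

(* Jackson's q-analogues, for 0 < q < 1 and x > 0; the infinite product is the
   limit of the partial products over 0 <= n <= M. *)

Definition q_Gamma (q x : R) : R :=
  Rpower (1 - q) (1 - x) *
  real (Lim_seq (fun M =>
    prod_f_R0 (fun n => (1 - q ^ (n + 1)) / (1 - Rpower q (INR n + x))) M)).

Definition q_digamma (q x : R) : R := Derive (fun y => ln (q_Gamma q y)) x.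

Definition q_polygamma (m : nat) (q x : R) : R := Derive_n (q_digamma q) m x.

(* Bernoulli polynomials: B_n(x) is n! times the coefficient of t^n in the
   Taylor series at 0 of t e^{xt} / (e^t - 1), whose removable singularity at
   t = 0 is filled with the value 1. *)

Definition bernoulli_gen (x t : R) : R :=
  if Req_EM_T t 0 then 1 else t * exp (x * t) / (exp t - 1).

Definition bernoulli (n : nat) (x : R) : R := Derive_n (bernoulli_gen x) n 0.

(* Riemann zeta function *)

(* n^{-s} = exp (- s log n) for n >= 1 and complex s *)
Definition nat_Cpow_opp (n : nat) (s : C) : C :=
  (Rpower (INR n) (- Re s) * cos (Im s * ln (INR n)),
   - (Rpower (INR n) (- Re s) * sin (Im s * ln (INR n)))).

Definition C_analytic_at (f : C -> C) (z0 : C) : Prop :=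
  exists (a : nat -> C) (r : R), 0 < r /\
    forall z : C, Cmod (z - z0)%C < r ->
      @is_pseries C_AbsRing C_NormedModule a (z - z0)%C (f z).

(* f is analytic on C minus {1} and is given by the Dirichlet series
   sum_{n >= 1} n^{-s} for Re s > 1; by the identity theorem this determines f
   everywhere except at s = 1. *)
Definition is_Riemann_zeta (f : C -> C) : Prop :=
  (forall s : C, s <> RtoC 1 -> C_analytic_at f s) /\
  (forall s : C, 1 < Re s ->
     @is_series C_AbsRing C_NormedModule
       (fun n => nat_Cpow_opp (S n) s) (f s)).

(* The value at the pole s = 1 is unspecified. *)
Definition Riemann_zeta : C -> C :=
  epsilon (inhabits (fun _ : C => RtoC 0)) is_Riemann_zeta.

(* zeta at a real argument, where it takes real values *)
Definition zeta (s : R) : R := Re (Riemann_zeta (RtoC s)).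

Definition is_bigO (F : (R -> Prop) -> Prop) (f g : R -> R) : Prop :=
  exists K : R, F (fun t => Rabs (f t) <= K * Rabs (g t)).

(* Main.v *)
Require Import Defs.
From Stdlib Require Import Reals Factorial Lra Lia Psatz.
From Stdlib Require Import FunctionalExtensionality ClassicalEpsilon.
From Coquelicot Require Import Coquelicot.
Open Scope R_scope.

(** Put e = - ln q and b(u) = 1/(e^u - 1). Differentiating the logarithm of the
product for Gamma_q term by term gives
  psi_q^(m)(x) = - e^(m+1) sum_(n >= 0) b^(m)(e (n + x)),
while psi^(m)(x) = - sum_(n >= 0) (d/du)^m (1/u) at u = n + x. The function
g(u) = 1/u - b(u) extends smoothly to u = 0, so in the difference the poles
cancel ([q_polygamma_minus_polygamma]):
  psi_q^(m)(x) - psi^(m)(x) = e^m sum_(n >= 0) e F'(e (n + x)),  F = g^(m-1).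
This is a Riemann sum of step e for the integral of F', with F and all its
derivatives vanishing at infinity. The Euler-Maclaurin formula at the left end
point ([euler_maclaurin]) expands it as - sum_k B_k(x)/k! e^k F^(k)(0). Finally
u g(u) = 1 - u b(u) generates the Bernoulli numbers, and the values of zeta at
the non-positive integers are Bernoulli numbers too, so that
g^(n-1)(0) = (-1)^n zeta(1 - n) ([Derive_n_bose_reg_0_zeta]); this is the claimed
expansion, since (-e)^(m+k) = (ln q)^(m+k).

The Euler-Maclaurin formula is obtained by telescoping. The operator
sum_k B_k(x)/k! e^k D^k is formally e D exp(x e D) / (exp(e D) - 1), so its
differences with step e reproduce e D exp(x e D), that is e F'(. + e x). Truncating
both sides by Taylor's formula leaves an error of order e^(K+1)/(1+u)^2, and these
errors sum to O(e^K).

The series for psi^(m) comes from Gauss's limit for Gamma, which follows from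
Euler's integral, the functional equation and the inequality
Gamma(s + a) <= s^a Gamma(s) for 0 <= a <= 1 ([Gamma_shift_le]).

For zeta, let h(s) = (s - 1) sum_(n >= 2) n^(-s). Expanding n^(1-s) - (n+1)^(1-s)
by the binomial series and summing over n >= 2 gives, for Re s > 1,
  sum_(i >= 0) binom(1-s, i)/(i+1) h(s + i) = 2^(1-s)
([numer_dirichlet_functional]). Solved for h(s), the identity only involves h to
the right of s, and it extends h from a half-plane to the one shifted by 1 to the
left, hence to the whole plane; zeta(s) = 1 + h(s)/(s - 1). Starting at n = 2 makes
the terms decay like 2^(-i). Analyticity is carried by power series with a weighted
l^1 bound on the coefficients ([majorized]), which are stable under the operations
needed without Cauchy's theory. At s = 1 - n the sum is finite and coincides with
the recurrence of B_n(2) ([numer_nonpos]). As zeta is only characterized as some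
continuation of the Dirichlet series, the value is transported to it by the
identity theorem, along a segment from 2 + i that avoids the pole
([is_Riemann_zeta_unique_real]). *)

(** * Dominated convergence for real series *)

Lemma is_lim_seq_inv_INR : is_lim_seq (fun n => / INR n) 0.
Proof.
  replace (Finite 0) with (Rbar_inv p_infty) by reflexivity.
  apply is_lim_seq_inv; [apply is_lim_seq_INR | discriminate].
Qed.

Lemma is_lim_seq_inv_INR_S : is_lim_seq (fun n => / INR (S n)) 0.
Proof. exact (proj1 (is_lim_seq_incr_1 (fun n => / INR n) 0) is_lim_seq_inv_INR). Qed.

Lemma ball_R (x e y : R) : ball x e y -> Rabs (y - x) < e.
Proof. trivial. Qed.

Lemma ball_R_intro (x e y : R) : Rabs (y - x) < e -> ball x e y.
Proof. trivial. Qed.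

Lemma INR_S_pos (n : nat) : 0 < INR (S n).
Proof. apply lt_0_INR, Nat.lt_0_succ. Qed.

Lemma Rinv_nonneg (a : R) : 0 < a -> 0 <= / a.
Proof. intros H. now apply Rlt_le, Rinv_0_lt_compat. Qed.

Lemma ex_series_Rmult_l (c : R) (a : nat -> R) : ex_series a -> ex_series (fun n => c * a n).
Proof. exact (@ex_series_scal R_AbsRing R_NormedModule c a). Qed.

Lemma ex_series_Rabs_le (a b : nat -> R) :
  (forall n, Rabs (a n) <= b n) -> ex_series b -> ex_series a.
Proof.
  intros H Hb. apply (@ex_series_le R_AbsRing R_CompleteNormedModule a b); auto.
Qed.

Lemma Rabs_Series_le (a b : nat -> R) :
  (forall n, Rabs (a n) <= b n) -> ex_series b -> Rabs (Series a) <= Series b.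
Proof.
  intros H Hb.
  eapply Rle_trans.
  - apply Series_Rabs. apply ex_series_Rabs_le with b; auto.
    intros n; rewrite Rabs_Rabsolu; auto.
  - apply Series_le; auto. intros n; split; auto using Rabs_pos.
Qed.

Lemma sum_Sn_R (a : nat -> R) (n : nat) : sum_n a (S n) = sum_n a n + a (S n).
Proof. exact (sum_Sn a n). Qed.

Lemma sum_n_term_le (a : nat -> R) (k N : nat) : (forall n, 0 <= a n) -> (k <= N)%nat -> a k <= sum_n a N.
Proof.
  intros Ha H. induction H as [|N H IH].
  - destruct k. rewrite sum_O; lra. rewrite sum_Sn_R.
    enough (0 <= sum_n a k) by lra. induction k as [|k IH]. now rewrite sum_O. rewrite sum_Sn_R. specialize (Ha (S k)). lra.
  - rewrite sum_Sn_R. specialize (Ha (S N)). lra.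
Qed.

Lemma sum_n_le_Series (a : nat -> R) (N : nat) :
  (forall n, 0 <= a n) -> ex_series a -> sum_n a N <= Series a.
Proof.
  intros Ha He.
  assert (Hs := Series_correct _ He).
  apply (is_lim_seq_incr_compare (sum_n a) (Series a)).
  - exact Hs.
  - intros n. rewrite sum_Sn_R. specialize (Ha (S n)). lra.
Qed.

Lemma ex_series_bounded (a : nat -> R) (B : R) :
  (forall n, 0 <= a n) -> (forall N, sum_n a N <= B) ->
  ex_series a /\ Series a <= B.
Proof.
  intros Ha HB.
  assert (Hex : ex_finite_lim_seq (sum_n a)).
  { apply ex_finite_lim_seq_incr with B; auto.
    intros n. rewrite sum_Sn_R. specialize (Ha (S n)). lra. }
  destruct Hex as [l Hl].
  split.
  - exists l. exact Hl.
  - rewrite (is_series_unique a l Hl).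
    assert (H := is_lim_seq_le (sum_n a) (fun _ => B) l B HB Hl (is_lim_seq_const B)).
    exact H.
Qed.

Lemma is_series_tail_small (b : nat -> R) (eps : R) :
  0 < eps -> ex_series b ->
  exists N, Rabs (Series (fun k => b (S N + k)%nat)) < eps.
Proof.
  intros He Hb.
  assert (Hs := Series_correct _ Hb).
  destruct (proj1 (filterlim_locally _ _) Hs (mkposreal eps He)) as [N HN].
  exists N. specialize (HN N (le_n _)).
  apply ball_R in HN.
  rewrite (Series_incr_n b (S N)) in HN; [|lia|exact Hb].
  rewrite sum_n_Reals in HN. simpl Init.Nat.pred in HN.
  replace (Series (fun k : nat => b (S N + k)%nat)) with
   (- (sum_f_R0 b N - (sum_f_R0 b N + Series (fun k : nat => b (S N + k)%nat)))) by ring.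
  rewrite Rabs_Ropp. exact HN.
Qed.

Lemma filterlim_sum_n {T : Type} (F : (T -> Prop) -> Prop) {FF : Filter F}
  (v : nat -> T -> R) (l : nat -> R) (N : nat) :
  (forall n, filterlim (v n) F (locally (l n))) ->
  filterlim (fun t => sum_n (fun n => v n t) N) F (locally (sum_n l N)).
Proof.
  intros H. induction N as [|N IH].
  - rewrite sum_O. apply filterlim_ext with (v 0%nat); auto.
    intros t; rewrite sum_O; auto.
  - rewrite sum_Sn.
    apply filterlim_ext with (fun t => plus (sum_n (fun n => v n t) N) (v (S N) t)).
    + intros t; rewrite sum_Sn; auto.
    + eapply filterlim_comp_2; [exact IH | exact (H (S N)) | ].
      apply (@filterlim_plus R_AbsRing R_NormedModule).
Qed.

(** Tannery's theorem: cut the series where the tail of b is small. It is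
    stated for an arbitrary filter because it serves both for partial sums
    (n tending to infinity) and for difference quotients (h tending to 0). *)
Lemma Series_dominated {T : Type} (F : (T -> Prop) -> Prop) {FF : ProperFilter F}
  (v : nat -> T -> R) (l b : nat -> R) :
  ex_series b ->
  F (fun t => forall n, Rabs (v n t) <= b n) ->
  (forall n, filterlim (v n) F (locally (l n))) ->
  ex_series l /\
  filterlim (fun t => Series (fun n => v n t)) F (locally (Series l)).
Proof.
  intros Hb Hdom Hlim.
  assert (Hl : forall n, Rabs (l n) <= b n).
  { intros n. apply le_epsilon. intros e He.
    assert (H1 := proj1 (filterlim_locally _ _) (Hlim n) (mkposreal e He)).
    destruct (filter_ex _ (filter_and _ _ Hdom H1)) as [t [Ht1 Ht2]].
    specialize (Ht1 n). apply ball_R in Ht2. simpl in Ht2.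
    replace (l n) with (v n t - (v n t - l n)) by ring.
    eapply Rle_trans; [apply Rabs_triang|]. rewrite Rabs_Ropp. lra. }
  assert (Hexl : ex_series l) by (apply ex_series_Rabs_le with b; auto).
  split; auto.
  apply filterlim_locally. intros eps.
  assert (He3 : 0 < eps / 3) by (destruct eps; simpl; lra).
  destruct (is_series_tail_small b (eps / 3) He3 Hb) as [N HN].
  assert (H1 := proj1 (filterlim_locally _ _) (filterlim_sum_n F v l N Hlim) (mkposreal _ He3)).
  generalize (filter_and _ _ Hdom H1). apply filter_imp.
  intros t [Ht1 Ht2].
  apply ball_R_intro. apply ball_R in Ht2.
  assert (Hbt : ex_series (fun k => b (S N + k)%nat)) by (apply (ex_series_incr_n b (S N)); auto).
  rewrite (Series_incr_n l (S N)); [|lia|auto].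
  rewrite (Series_incr_n (fun n => v n t) (S N)); [|lia|apply ex_series_Rabs_le with b; auto].
  rewrite <- !sum_n_Reals. simpl Init.Nat.pred.
  assert (T1 : Rabs (Series (fun k => v (S N + k)%nat t)) <= Series (fun k => b (S N + k)%nat))
    by (apply Rabs_Series_le; auto).
  assert (T2 : Rabs (Series (fun k => l (S N + k)%nat)) <= Series (fun k => b (S N + k)%nat))
    by (apply Rabs_Series_le; auto).
  clear Hdom Hlim Hl H1 Ht1. simpl in *. revert Ht2 HN T1 T2.
  generalize (Series (fun k => v (S (N + k)) t)) (Series (fun k => l (S (N + k))))
    (Series (fun k => b (S (N + k)))) (sum_n (fun n => v n t) N) (sum_n l N).
  destruct eps as [eps Heps]; simpl in *.
  intros a1 a2 a3 a4 a5.
  unfold Rabs; repeat destruct Rcase_abs; lra.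
Qed.

Lemma Series_sum_n (u : nat -> nat -> R) (K : nat) : (forall k, ex_series (fun i => u i k)) ->
  Series (fun i => sum_n (u i) K) = sum_n (fun k => Series (fun i => u i k)) K /\
  ex_series (fun i => sum_n (u i) K).
Proof.
  intros Hu. induction K as [|K [IH1 IH2]].
  - rewrite sum_O. split. apply Series_ext; intros; now rewrite sum_O.
    eapply ex_series_ext; [|apply (Hu 0%nat)]. intros; now rewrite sum_O.
  - rewrite sum_Sn_R, <- IH1. split.
    + rewrite <- Series_plus; auto. apply Series_ext; intros; now rewrite sum_Sn_R.
    + eapply ex_series_ext; [|apply (@ex_series_plus R_AbsRing R_NormedModule _ _ IH2 (Hu (S K)))].
      intros; now rewrite sum_Sn.
Qed.

(** Dominated convergence applied to the partial sums of the rows. *)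
Lemma Series_swap (u : nat -> nat -> R) (B : nat -> R) :
  ex_series B ->
  (forall i K, sum_n (fun k => Rabs (u i k)) K <= B i) ->
  is_series (fun k => Series (fun i => u i k)) (Series (fun i => Series (u i))).
Proof.
  intros HB Hu.
  assert (Hrow : forall i, ex_series (fun k => Rabs (u i k))).
  { intros i. apply (ex_series_bounded _ (B i)); auto using Rabs_pos. }
  assert (Hent : forall i k, Rabs (u i k) <= B i).
  { intros i k. eapply Rle_trans; [|apply (Hu i k)].
    apply (sum_n_term_le (fun k => Rabs (u i k))); auto using Rabs_pos. }
  assert (Hcol : forall k, ex_series (fun i => u i k)).
  { intros k. apply ex_series_Rabs_le with B; auto. }
  destruct (Series_dominated eventually (fun i K => sum_n (u i) K) (fun i => Series (u i)) B HB) as [_ H].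
  - exists 0%nat. intros K _ i. eapply Rle_trans; [|apply (Hu i K)].
    apply (norm_sum_n_m (u i) 0 K).
  - intros i. apply (Series_correct (u i)). apply ex_series_Rabs; auto.
  - eapply filterlim_ext; [|exact H]. intros K; simpl. now apply Series_sum_n.
Qed.

(** By the mean value theorem the bound on the derivatives dominates the
    difference quotients, so the limit may be taken termwise. *)
Lemma is_derive_Series (f f' : nat -> R -> R) (b : nat -> R) (x d : R) :
  0 < d -> ex_series b ->
  (forall n y, Rabs (y - x) < d -> is_derive (f n) y (f' n y)) ->
  (forall n y, Rabs (y - x) < d -> Rabs (f' n y) <= b n) ->
  (forall y, Rabs (y - x) < d -> ex_series (fun n => f n y)) ->
  is_derive (fun y => Series (fun n => f n y)) x (Series (fun n => f' n x)).
Proof.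
  intros Hd Hb Hder Hdom Hex.
  assert (Hx : Rabs (x - x) < d) by (rewrite Rminus_diag, Rabs_R0; auto).
  assert (PF : ProperFilter (locally' 0)) by exact (Rbar_locally'_filter 0).
  destruct (Series_dominated (locally' 0)
     (fun n h => (f n (x + h) - f n x) / h) (fun n => f' n x) b Hb) as [_ H].
  - exists (mkposreal d Hd). intros h Hh Hh0 n.
    apply ball_R in Hh. rewrite Rminus_0_r in Hh. simpl in Hh.
    destruct (MVT_gen (f n) x (x + h) (f' n)) as [c [Hc1 Hc2]].
    + intros y Hy. apply Hder.
      unfold Rmin, Rmax in Hy; destruct Rle_dec; apply Rabs_def1; apply Rabs_def2 in Hh; lra.
    + intros y Hy. apply continuity_pt_filterlim.
      apply (ex_derive_continuous (f n)). exists (f' n y). apply Hder.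
      unfold Rmin, Rmax in Hy; destruct Rle_dec; apply Rabs_def1; apply Rabs_def2 in Hh; lra.
    + rewrite Hc2. replace (f' n c * (x + h - x) / h) with (f' n c) by (field; auto).
      apply Hdom. unfold Rmin, Rmax in Hc1; destruct Rle_dec; apply Rabs_def1; apply Rabs_def2 in Hh; lra.
  - intros n. assert (H := Hder n x Hx). apply is_derive_Reals in H.
    apply filterlim_locally. intros eps.
    destruct (H eps (cond_pos eps)) as [dl Hdl].
    exists dl. intros h Hh Hh0.
    apply ball_R_intro. apply ball_R in Hh. rewrite Rminus_0_r in Hh. exact (Hdl h Hh0 Hh).
  - apply is_derive_Reals. intros eps Heps.
    destruct (proj1 (filterlim_locally _ _) H (mkposreal eps Heps)) as [dl Hdl].
    exists (mkposreal (Rmin dl d) (Rmin_pos _ _ (cond_pos dl) Hd)). intros h Hh0 Hh. simpl in Hh.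
    assert (Hh1 : Rabs h < dl) by (eapply Rlt_le_trans; [exact Hh|apply Rmin_l]).
    assert (Hh2 : Rabs h < d) by (eapply Rlt_le_trans; [exact Hh|apply Rmin_r]).
    assert (H2 : ball 0 dl h).
    { apply ball_R_intro. now rewrite Rminus_0_r. }
    specialize (Hdl h H2 Hh0). apply ball_R in Hdl.
    rewrite <- Series_minus.
    + unfold Rdiv. rewrite <- Series_scal_r. exact Hdl.
    + apply Hex. replace (x + h - x) with h by ring. auto.
    + apply Hex. auto.
Qed.

(** * Smooth functions *)

Definition smooth (f : R -> R) : Prop := forall n x, ex_derive (Derive_n f n) x.

(** Differentiability to a finite order, by recursion on the function rather
    than on its iterated derivatives: products and inverses are then handled by
    induction on the order, without any formula for higher derivatives. *)
Fixpoint iter_derivable (n : nat) (f : R -> R) : Prop :=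
  match n with
  | O => True
  | S n => (forall x, ex_derive f x) /\ iter_derivable n (Derive f)
  end.

Lemma Derive_n_S (f : R -> R) (n : nat) : Derive_n f (S n) = Derive_n (Derive f) n.
Proof.
  apply functional_extensionality; intros x.
  rewrite (Derive_n_comp f n 1). now rewrite Nat.add_1_r.
Qed.

Lemma smooth_iter_derivable (f : R -> R) : smooth f <-> forall n, iter_derivable n f.
Proof.
  split.
  - intros H n. revert f H. induction n as [|n IH]; intros f H; simpl; auto. split.
    + apply (H 0%nat).
    + apply IH. intros k x. rewrite <- Derive_n_S. apply H.
  - intros H n. revert f H. induction n as [|n IH]; intros f H x.
    + apply (H 1%nat).
    + rewrite Derive_n_S. apply IH. intros k. apply (H (S k)).
Qed.

Lemma iter_derivable_pred (n : nat) : forall f, iter_derivable (S n) f -> iter_derivable n f.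
Proof.
  induction n as [|n IH]; intros f H; simpl; auto.
  destruct H as [H1 H2]. split; auto.
Qed.

Lemma iter_derivable_plus (n : nat) : forall f g, iter_derivable n f -> iter_derivable n g -> iter_derivable n (fun x => f x + g x).
Proof.
  induction n as [|n IH]; intros f g Hf Hg; simpl; auto.
  destruct Hf as [Hf1 Hf2], Hg as [Hg1 Hg2]. split.
  - intros x. apply (@ex_derive_plus R_AbsRing R_NormedModule); auto.
  - replace (Derive (fun x => f x + g x)) with (fun x => Derive f x + Derive g x); auto.
    apply functional_extensionality; intros x. symmetry; apply Derive_plus; auto.
Qed.

Lemma iter_derivable_mult (n : nat) : forall f g, iter_derivable n f -> iter_derivable n g -> iter_derivable n (fun x => f x * g x).
Proof.
  induction n as [|n IH]; intros f g Hf Hg; auto.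
  pose proof (iter_derivable_pred _ _ Hf) as Hf0. pose proof (iter_derivable_pred _ _ Hg) as Hg0.
  destruct Hf as [Hf1 Hf2], Hg as [Hg1 Hg2]. split.
  - intros x. apply (ex_derive_mult f g); auto.
  - replace (Derive (fun x => f x * g x)) with (fun x => Derive f x * g x + f x * Derive g x).
    + apply iter_derivable_plus; auto.
    + apply functional_extensionality; intros x. symmetry; apply Derive_mult; auto.
Qed.

Lemma iter_derivable_const (n : nat) : forall c : R, iter_derivable n (fun _ => c).
Proof.
  induction n as [|n IH]; intros c; [exact I|]. split.
  - intros x. apply ex_derive_const.
  - replace (Derive (fun _ : R => c)) with (fun _ : R => 0); auto.
    apply functional_extensionality; intros; now rewrite Derive_const.
Qed.

Lemma iter_derivable_inv (n : nat) : forall f, (forall x, f x <> 0) -> iter_derivable n f -> iter_derivable n (fun x => / f x).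
Proof.
  induction n as [|n IH]; intros f Hnz Hf; auto.
  pose proof (iter_derivable_pred _ _ Hf) as Hf0.
  destruct Hf as [Hf1 Hf2]. split.
  - intros x. apply ex_derive_inv; auto.
  - replace (Derive (fun x => / f x)) with
      (fun x => (Derive f x * ((fun y => / f y) x * (fun y => / f y) x)) * (fun y => -1) x).
    + repeat apply iter_derivable_mult; auto.
      apply iter_derivable_const.
    + apply functional_extensionality; intros x. rewrite Derive_inv; auto. simpl. field. auto.
Qed.

Lemma smooth_mult (f g : R -> R) : smooth f -> smooth g -> smooth (fun x => f x * g x).
Proof. rewrite !smooth_iter_derivable. intros; apply iter_derivable_mult; auto. Qed.

Lemma smooth_inv (f : R -> R) : (forall x, f x <> 0) -> smooth f -> smooth (fun x => / f x).
Proof. rewrite !smooth_iter_derivable. intros; apply iter_derivable_inv; auto. Qed.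

Lemma smooth_Derive_n (f : R -> R) (k : nat) : smooth f -> smooth (Derive_n f k).
Proof.
  intros H n x.
  apply ex_derive_ext with (Derive_n f (n + k)); auto.
  intros t; now rewrite Derive_n_comp.
Qed.

Lemma smooth_is_derive (f : R -> R) (n : nat) (x : R) :
  smooth f -> is_derive (Derive_n f n) x (Derive_n f (S n) x).
Proof. intros H. simpl. apply Derive_correct. apply H. Qed.

Lemma is_derive_sum_n (f : nat -> R -> R) (f' : nat -> R) (x : R) (n : nat) :
  (forall k, (k <= n)%nat -> is_derive (f k) x (f' k)) ->
  is_derive (fun y => sum_n (fun k => f k y) n) x (sum_n f' n).
Proof.
  induction n as [|n IH]; intros H.
  - rewrite sum_O. apply is_derive_ext with (f 0%nat). intros; now rewrite sum_O. auto.
  - rewrite sum_Sn. apply is_derive_ext with (fun y => plus (sum_n (fun k => f k y) n) (f (S n) y)).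
    intros; now rewrite sum_Sn.
    apply (@is_derive_plus R_AbsRing R_NormedModule); auto.
Qed.

Lemma sum_n_incr_1 (a : nat -> R) (n : nat) :
  sum_n a (S n) = a 0%nat + sum_n (fun k => a (S k)) n.
Proof.
  induction n as [|n IH].
  - now rewrite sum_Sn, !sum_O.
  - rewrite sum_Sn, IH, sum_Sn. unfold plus; simpl. ring.
Qed.

Lemma sum_n_ext_R (a b : nat -> R) (n : nat) :
  (forall k, (k <= n)%nat -> a k = b k) -> sum_n a n = sum_n b n.
Proof. exact (sum_n_ext_loc a b n). Qed.

Lemma sum_n_scal_l (c : R) (a : nat -> R) (n : nat) :
  sum_n (fun k => c * a k) n = c * sum_n a n.
Proof. exact (@sum_n_mult_l R_AbsRing c a n). Qed.

Lemma sum_n_plus_R (a b : nat -> R) (n : nat) :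
  sum_n (fun k => a k + b k) n = sum_n a n + sum_n b n.
Proof. exact (sum_n_plus a b n). Qed.

Lemma is_derive_Rdiv_const (f : R -> R) (x l c : R) :
  is_derive f x l -> is_derive (fun y => f y / c) x (l / c).
Proof.
  intros H. unfold Rdiv. rewrite (Rmult_comm l).
  apply is_derive_ext with (fun y => / c * f y). intros; apply Rmult_comm.
  apply is_derive_scal; auto.
Qed.

(** Leibniz formula, in terms of the Taylor coefficients f^(n)(x)/n!, which
    turn it into a Cauchy product; the inductive step splits n + 1 as
    i + (n + 1 - i). *)
Lemma Derive_n_mult (f g : R -> R) (n : nat) (x : R) :
  smooth f -> smooth g ->
  Derive_n (fun y => f y * g y) n x =
  INR (fact n) * sum_n (fun i => Derive_n f i x / INR (fact i) *
                       (Derive_n g (n - i) x / INR (fact (n - i)))) n.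
Proof.
  intros Hf Hg. revert x. induction n as [|n IH]; intros x.
  - rewrite sum_O. simpl. field.
  - simpl Derive_n.
    set (a := fun i => Derive_n f i x / INR (fact i)).
    set (b := fun i => Derive_n g i x / INR (fact i)).
    rewrite (Derive_ext _ _ x IH).
    assert (H : is_derive (fun y => INR (fact n) * sum_n (fun i => Derive_n f i y / INR (fact i) *
                       (Derive_n g (n - i) y / INR (fact (n - i)))) n) x
       (INR (fact n) * sum_n (fun k => INR (S k) * a (S k) * b (n - k)%nat
                                   + a k * (INR (S (n - k)) * b (S (n - k)))) n)).
    { apply (is_derive_scal _ x (INR (fact n))). apply is_derive_sum_n.
      intros k Hk. apply (is_derive_mult (fun y => Derive_n f k y / INR (fact k))
           (fun y => Derive_n g (n - k) y / INR (fact (n - k))) x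
           (INR (S k) * a (S k)) (INR (S (n - k)) * b (S (n - k)))).
        - replace (INR (S k) * a (S k)) with (Derive_n f (S k) x / INR (fact k)).
          apply is_derive_Rdiv_const, smooth_is_derive; auto.
          unfold a. rewrite fact_simpl, mult_INR. field. split; [apply INR_fact_neq_0|apply not_0_INR; lia].
        - replace (INR (S (n - k)) * b (S (n - k))) with (Derive_n g (S (n-k)) x / INR (fact (n-k))).
          apply is_derive_Rdiv_const, smooth_is_derive; auto.
          unfold b. rewrite fact_simpl, mult_INR. field. split; [apply INR_fact_neq_0|apply not_0_INR; lia].
        - intros; apply Rmult_comm. }
    eapply eq_trans; [exact (is_derive_unique _ _ _ H)|].
    change (fact (S n)) with (S n * fact n)%nat. rewrite mult_INR.
    rewrite (Rmult_comm (INR (S n))), Rmult_assoc. f_equal.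
    change (fun i : nat => Derive_n f i x / INR (fact i) * (Derive_n g (S n - i) x / INR (fact (S n - i))))
      with (fun i => a i * b (S n - i)%nat).
    rewrite <- sum_n_scal_l.
    transitivity (sum_n (fun i => INR i * a i * b (S n - i)%nat) (S n) +
                  sum_n (fun i => INR (S n - i) * a i * b (S n - i)%nat) (S n)).
    + rewrite sum_n_incr_1. rewrite (sum_Sn (fun i => INR (S n - i) * a i * b (S n - i)%nat)).
      rewrite Nat.sub_diag. unfold plus; simpl (INR 0).
      replace (0 * a 0%nat * b (S n - 0)%nat) with 0 by ring.
      rewrite Rmult_0_l, Rmult_0_l, Rplus_0_l. simpl plus. rewrite Rplus_0_r.
      rewrite <- sum_n_plus_R. apply sum_n_ext_R; intros k Hk.
      replace (S n - k)%nat with (S (n - k)) by lia. fold (b (n-k)%nat) (a k).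
      change (S n - S k)%nat with (n - k)%nat. ring.
    + rewrite <- sum_n_plus_R. apply sum_n_ext_R; intros k Hk.
      transitivity (INR (S n) * (a k * b (S n - k)%nat)); [|reflexivity].
      rewrite minus_INR by auto. ring.
Qed.

(** * Bernoulli polynomials *)

(** The entire function (e^t - sum_(i < j) t^i/i!) / t^j. In particular
    [exp_tail 1] is (e^t - 1)/t without its removable singularity. *)
Definition exp_tail (j : nat) : R -> R := PSeries (fun n => / INR (fact (n + j))).

Lemma CV_radius_exp_tail (j : nat) : CV_radius (fun n => / INR (fact (n + j))) = p_infty.
Proof.
  apply CV_radius_infinite_DAlembert.
  - intros n. apply Rinv_neq_0_compat, INR_fact_neq_0.
  - apply is_lim_seq_ext with (fun n => / INR (n + S j)).
    + intros n. replace (S n + j)%nat with (S (n + j)) by lia.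
      replace (n + S j)%nat with (S (n + j)) by lia.
      rewrite fact_simpl, mult_INR.
      assert (H1 := INR_fact_lt_0 (n + j)).
      assert (H2 := INR_S_pos (n + j)).
      rewrite Rabs_pos_eq. field. lra.
      apply Rlt_le. repeat (apply Rdiv_lt_0_compat || apply Rinv_0_lt_compat || apply Rmult_lt_0_compat); auto.
    + apply (is_lim_seq_incr_n (fun n => / INR n) (S j)). exact is_lim_seq_inv_INR.
Qed.

Lemma exp_tail_0 (t : R) : exp_tail 0 t = exp t.
Proof.
  unfold exp_tail. rewrite exp_Reals. apply Series_ext. intros n. now rewrite Nat.add_0_r.
Qed.

Lemma exp_tail_rec (j : nat) (t : R) : exp_tail j t = / INR (fact j) + t * exp_tail (S j) t.
Proof.
  unfold exp_tail. rewrite PSeries_decr_1.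
  - f_equal. f_equal. apply Series_ext. intros n. unfold PS_decr_1.
    now replace (S n + j)%nat with (n + S j)%nat by lia.
  - apply CV_radius_inside. rewrite CV_radius_exp_tail. exact I.
Qed.

Lemma smooth_exp_tail (j : nat) : smooth (exp_tail j).
Proof.
  intros n x. apply (ex_derive_n_PSeries (S n)). rewrite CV_radius_exp_tail. exact I.
Qed.

Lemma Derive_n_exp_tail (j n : nat) : Derive_n (exp_tail j) n 0 = INR (fact n) / INR (fact (n + j)).
Proof.
  unfold exp_tail. rewrite Derive_n_coef. unfold Rdiv; apply Rmult_comm.
  rewrite CV_radius_exp_tail. exact I.
Qed.

Lemma exp_tail_at_0 (j : nat) : exp_tail j 0 = / INR (fact j).
Proof. rewrite exp_tail_rec. ring. Qed.

Lemma exp_tail_1 (t : R) : t <> 0 -> exp_tail 1 t = (exp t - 1) / t.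
Proof. intros H. rewrite <- exp_tail_0, (exp_tail_rec 0). simpl. field. auto. Qed.

Lemma exp_minus_1_neq_0 (t : R) : t <> 0 -> exp t - 1 <> 0.
Proof.
  intros H H1. apply H. apply exp_inv. rewrite exp_0. lra.
Qed.

Lemma exp_tail_1_neq_0 (t : R) : exp_tail 1 t <> 0.
Proof.
  destruct (Req_dec t 0) as [->|H].
  - rewrite exp_tail_at_0. simpl. lra.
  - rewrite exp_tail_1; auto. apply Rmult_integral_contrapositive. split.
    apply exp_minus_1_neq_0; auto. apply Rinv_neq_0_compat; auto.
Qed.

Lemma bernoulli_gen_exp_tail (x t : R) : bernoulli_gen x t = exp (x * t) * / exp_tail 1 t.
Proof.
  unfold bernoulli_gen. destruct Req_EM_T as [->|H].
  - rewrite exp_tail_at_0, Rmult_0_r, exp_0. simpl. field.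
  - rewrite exp_tail_1 by auto. field. split; auto. now apply exp_minus_1_neq_0.
Qed.

Lemma Derive_n_exp_scal (x : R) (n : nat) (t : R) :
  Derive_n (fun t => exp (x * t)) n t = x ^ n * exp (x * t).
Proof.
  revert t. induction n as [|n IH]; intros t.
  - simpl. ring.
  - simpl. rewrite (Derive_ext _ _ t IH). apply is_derive_unique. auto_derive; auto. simpl. ring.
Qed.

Lemma smooth_exp_scal (x : R) : smooth (fun t => exp (x * t)).
Proof.
  intros n t. apply ex_derive_ext with (fun t => x ^ n * exp (x * t)).
  intros; now rewrite Derive_n_exp_scal. auto_derive; auto.
Qed.

Lemma smooth_bernoulli_gen (x : R) : smooth (bernoulli_gen x).
Proof.
  replace (bernoulli_gen x) with (fun t => exp (x * t) * / exp_tail 1 t).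
  - apply (smooth_mult (fun t => exp (x * t)) (fun t => / exp_tail 1 t)). apply smooth_exp_scal.
    apply smooth_inv. apply exp_tail_1_neq_0. apply smooth_exp_tail.
  - apply functional_extensionality; intros; now rewrite bernoulli_gen_exp_tail.
Qed.

(** Compare Taylor coefficients at 0 in B(t) (e^t - 1)/t = e^(xt), where B is
    the generating function of the Bernoulli polynomials at x. *)
Lemma bernoulli_recurrence (x : R) (n : nat) :
  sum_n (fun k => bernoulli k x / INR (fact k) * / INR (fact (S n - k))) n = x ^ n / INR (fact n).
Proof.
  assert (H : Derive_n (fun t => bernoulli_gen x t * exp_tail 1 t) n 0 = x ^ n).
  { rewrite (Derive_n_ext _ (fun t => exp (x * t))).
    - rewrite Derive_n_exp_scal, Rmult_0_r, exp_0. ring.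
    - intros t. rewrite bernoulli_gen_exp_tail. field. apply exp_tail_1_neq_0. }
  rewrite Derive_n_mult in H by (auto using smooth_bernoulli_gen, smooth_exp_tail).
  assert (D : forall a b : R, a <> 0 -> b = a * b / a) by (intros; field; auto).
  rewrite <- H. eapply eq_trans; [|apply D, INR_fact_neq_0].
  apply sum_n_ext_R; intros k Hk. unfold bernoulli. f_equal.
  rewrite Derive_n_exp_tail. replace (n - k + 1)%nat with (S n - k)%nat by lia.
  field. split; apply INR_fact_neq_0.
Qed.

(** * The function 1/(e^u - 1) and its regular part *)

Definition bose (u : R) : R := / (exp u - 1).

(** The function 1/u - 1/(e^u - 1), written as a quotient of entire functions
    so that its value and derivatives at 0 make sense. *)
Definition bose_reg (u : R) : R := exp_tail 2 u * / exp_tail 1 u.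

Lemma smooth_bose_reg : smooth bose_reg.
Proof.
  apply (smooth_mult (exp_tail 2) (fun t => / exp_tail 1 t)). apply smooth_exp_tail.
  apply smooth_inv. apply exp_tail_1_neq_0. apply smooth_exp_tail.
Qed.

Lemma bose_reg_eq (u : R) : u <> 0 -> bose_reg u = / u - bose u.
Proof.
  intros H. unfold bose_reg, bose. assert (H1 := exp_tail_rec 1 u). assert (H2 := exp_tail_1_neq_0 u).
  assert (H3 := exp_minus_1_neq_0 u H).
  replace (exp_tail 2 u) with ((exp_tail 1 u - 1) / u) by (rewrite H1; simpl; field; auto).
  rewrite exp_tail_1 by auto. field. auto.
Qed.

Lemma Derive_n_id_mult (f : R -> R) (n : nat) (u : R) : smooth f ->
  Derive_n (fun u => u * f u) n u = u * Derive_n f n u + INR n * Derive_n f (pred n) u.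
Proof.
  intros Hf. revert u. induction n as [|n IH]; intros u.
  - simpl. ring.
  - simpl Derive_n. rewrite (Derive_ext _ _ u IH). apply is_derive_unique.
    destruct n as [|n].
    + replace (1 * _) with (1 * f u) by reflexivity. simpl.
      replace (u * Derive (fun x => f x) u + 1 * f u) with ((1 * f u + u * Derive f u) + 0) by (simpl; ring_simplify; f_equal; now rewrite (Derive_ext (fun x => f x) f)).
      apply (@is_derive_plus R_AbsRing R_NormedModule).
      apply (is_derive_mult (fun u => u) f). apply (@is_derive_id R_AbsRing).
      apply Derive_correct. apply (Hf 0%nat). intros; apply Rmult_comm.
      apply is_derive_ext with (fun _ => 0). intros; simpl; ring. apply (@is_derive_const R_AbsRing R_NormedModule).
    + simpl pred.
      replace (u * Derive (Derive_n f (S n)) u + INR (S (S n)) * Derive_n f (S n) u) with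
       ((1 * Derive_n f (S n) u + u * Derive_n f (S (S n)) u) + INR (S n) * Derive_n f (S n) u).
      2:{ rewrite (S_INR (S n)). simpl. ring. }
      apply (@is_derive_plus R_AbsRing R_NormedModule).
      apply (is_derive_mult (fun u => u) (Derive_n f (S n))). apply (@is_derive_id R_AbsRing).
      apply smooth_is_derive; auto. intros; apply Rmult_comm.
      apply is_derive_scal. apply smooth_is_derive; auto.
Qed.

(** With g = [bose_reg] and B the generating function of the B_n(2), one has
    u (g(u) + e^(-u)) = 1 - B(-u); differentiate n + 1 times at 0. The argument 2
    is the one that occurs in the continuation of zeta. *)
Lemma Derive_n_bose_reg_0 (n : nat) :
  INR (S n) * Derive_n bose_reg n 0 = (-1) ^ S n * (INR (S n) - bernoulli (S n) 2).
Proof.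
  assert (Hs : smooth (fun u => exp (-1 * u))) by apply smooth_exp_scal.
  assert (Hsum : forall k u, Derive_n (fun u => bose_reg u + exp (-1 * u)) k u = Derive_n bose_reg k u + Derive_n (fun u => exp (-1 * u)) k u).
  { intros k u. apply Derive_n_plus; apply filter_forall; intros y [|j] _; simpl; auto.
    apply smooth_bose_reg. }
  assert (Hsm : smooth (fun u => bose_reg u + exp (-1 * u))).
  { intros k u. apply ex_derive_ext with (fun u => Derive_n bose_reg k u + Derive_n (fun u => exp (-1 * u)) k u).
    intros; now rewrite Hsum. apply (@ex_derive_plus R_AbsRing R_NormedModule). apply smooth_bose_reg. apply Hs. }
  assert (H : Derive_n (fun u => u * (bose_reg u + exp (-1 * u))) (S n) 0
     = Derive_n (fun u => 1 + - bernoulli_gen 2 (- u)) (S n) 0).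
  { apply Derive_n_ext. intros u. destruct (Req_dec u 0) as [->|Hu].
    - unfold bernoulli_gen. destruct Req_EM_T; lra.
    - rewrite bose_reg_eq by auto. unfold bose, bernoulli_gen. destruct Req_EM_T; [lra|].
      assert (H3 := exp_minus_1_neq_0 u Hu). assert (H4 := exp_pos u).
      replace (2 * - u) with (-u + -u) by ring. rewrite exp_plus.
      replace (-1 * u) with (- u) by ring. rewrite exp_Ropp. field. lra. }
  rewrite Derive_n_id_mult, Rmult_0_l in H by auto. simpl pred in H.
  rewrite Hsum, Derive_n_exp_scal, Rmult_0_r, exp_0, Rmult_1_r in H.
  rewrite Derive_n_plus in H.
  2:{ apply filter_forall; intros y k _. apply ex_derive_n_const. }
  2:{ apply filter_forall; intros y k _. apply ex_derive_n_opp. apply ex_derive_n_comp_opp.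
      apply filter_forall; intros z [|i] _; simpl; auto. apply smooth_bernoulli_gen. }
  rewrite Derive_n_const, Derive_n_opp, Derive_n_comp_opp, Ropp_0 in H.
  2:{ apply filter_forall; intros z [|i] _; simpl; auto. apply smooth_bernoulli_gen. }
  unfold bernoulli.
  transitivity ((0 + INR (S n) * (Derive_n bose_reg n 0 + (-1) ^ n)) - INR (S n) * (-1) ^ n). ring.
  rewrite H, <- tech_pow_Rmult. ring.
Qed.

(** Polynomials without constant term in b = 1/(e^u - 1). This class is closed
    under differentiation, because b' = - b - b^2, and its members inherit the
    decay of b; so every derivative of b decays as well. *)
Inductive bose_poly : (R -> R) -> Prop :=
| bose_poly_bose : bose_poly bose
| bose_poly_scal c f : bose_poly f -> bose_poly (fun u => c * f u)
| bose_poly_plus f g : bose_poly f -> bose_poly g -> bose_poly (fun u => f u + g u)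
| bose_poly_mult f g : bose_poly f -> bose_poly g -> bose_poly (fun u => f u * g u).

Lemma exp_gt_1 (u : R) : 0 < u -> 1 < exp u.
Proof. intros H. rewrite <- exp_0. now apply exp_increasing. Qed.

Lemma is_derive_bose (u : R) : 0 < u -> is_derive bose u (- 1 * (bose u + bose u * bose u)).
Proof.
  intros H. assert (H1 := exp_gt_1 u H). unfold bose. auto_derive. lra. field. lra.
Qed.

Lemma bose_poly_derive (f : R -> R) : bose_poly f ->
  exists f', bose_poly f' /\ forall u, 0 < u -> is_derive f u (f' u).
Proof.
  induction 1 as [|c f Hf [f' [IH1 IH2]]|f g Hf [f' [IHf1 IHf2]] Hg [g' [IHg1 IHg2]]|f g Hf [f' [IHf1 IHf2]] Hg [g' [IHg1 IHg2]]].
  - exists (fun u => -1 * (bose u + bose u * bose u)). split; [|exact is_derive_bose].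
    apply (bose_poly_scal (-1) (fun u => bose u + bose u * bose u)), (bose_poly_plus bose (fun u => bose u * bose u)).
    apply bose_poly_bose. apply bose_poly_mult; apply bose_poly_bose.
  - exists (fun u => c * f' u). split. now apply bose_poly_scal. intros. apply is_derive_scal; auto.
  - exists (fun u => f' u + g' u). split. now apply bose_poly_plus.
    intros. apply (@is_derive_plus R_AbsRing R_NormedModule); auto.
  - exists (fun u => f' u * g u + f u * g' u). split.
    apply (bose_poly_plus (fun u => f' u * g u) (fun u => f u * g' u)); now apply bose_poly_mult.
    intros. apply (is_derive_mult f g); auto. intros; apply Rmult_comm.
Qed.

(** The upper bound comes from e^u = (e^(u/2))^2 >= (1 + u/2)^2. *)
Lemma bose_bounds (u : R) : 0 < u -> 0 < bose u <= 4 / u ^ 2.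
Proof.
  intros H. assert (H1 := exp_gt_1 u H). unfold bose. split.
  - apply Rinv_0_lt_compat. lra.
  - replace (4 / u ^ 2) with (/ (u ^ 2 / 4)) by (field; lra).
    apply Rinv_le_contravar. assert (0 < u^2) by (apply pow_lt; auto). lra.
    assert (H2 := exp_ineq1_le (u / 2)).
    replace u with (u / 2 + u / 2) at 2 by lra. rewrite exp_plus. nra.
Qed.

Lemma bound_nonneg (y C u : R) : 0 < u -> Rabs y <= C / u ^ 2 -> 0 <= C.
Proof.
  intros Hu H. assert (H1 := Rabs_pos y). assert (H2 : 0 < u ^ 2) by (now apply pow_lt).
  apply Rmult_le_reg_r with (/ u ^ 2). now apply Rinv_0_lt_compat. unfold Rdiv in H. lra.
Qed.

Lemma Rdiv_le_contravar (C a b : R) : 0 <= C -> 0 < a <= b -> C / b <= C / a.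
Proof. intros HC H. apply Rmult_le_compat_l; auto. apply Rinv_le_contravar; lra. Qed.

Lemma bose_poly_bound (f : R -> R) : bose_poly f ->
  forall a, 0 < a -> exists C, forall u, a <= u -> Rabs (f u) <= C / u ^ 2.
Proof.
  induction 1 as [|c f Hf IH|f g Hf IHf Hg IHg|f g Hf IHf Hg IHg]; intros a Ha.
  - exists 4. intros u Hu. destruct (bose_bounds u) as [H1 H2]; [lra|]. rewrite Rabs_pos_eq; lra.
  - destruct (IH a Ha) as [C HC]. exists (Rabs c * C). intros u Hu.
    rewrite Rabs_mult. unfold Rdiv; rewrite Rmult_assoc. apply Rmult_le_compat_l. apply Rabs_pos. now apply HC.
  - destruct (IHf a Ha) as [C HC], (IHg a Ha) as [D HD]. exists (C + D). intros u Hu.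
    eapply Rle_trans; [apply Rabs_triang|]. rewrite Rdiv_plus_distr. apply Rplus_le_compat; auto.
  - destruct (IHf a Ha) as [C HC], (IHg a Ha) as [D HD]. exists (C * D / a ^ 2). intros u Hu.
    rewrite Rabs_mult.
    assert (Hu2 : 0 < u ^ 2) by (apply pow_lt; lra). assert (Ha2 : 0 < a ^ 2) by (apply pow_lt; lra).
    assert (Hau : a ^ 2 <= u ^ 2) by (apply pow_incr; lra).
    specialize (HC u Hu). specialize (HD u Hu).
    assert (HC0 : 0 <= C / u ^ 2) by (eapply Rle_trans; [apply Rabs_pos|exact HC]).
    assert (HD0 : 0 <= D / u ^ 2) by (eapply Rle_trans; [apply Rabs_pos|exact HD]).
    assert (HD1 : D / u ^ 2 <= D / a ^ 2).
    { apply Rdiv_le_contravar; auto. apply (bound_nonneg (g u) D u); auto. lra. }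
    replace (C * D / a ^ 2 / u ^ 2) with (C / u ^ 2 * (D / a ^ 2)) by (field; lra).
    apply Rmult_le_compat; auto using Rabs_pos. lra.
Qed.

Lemma locally_gt (a x : R) : a < x -> locally x (fun y => a < y).
Proof. intros H. apply (open_gt a x H). Qed.

Lemma Derive_n_bose_poly (k : nat) : exists g, bose_poly g /\ forall u, 0 < u -> Derive_n bose k u = g u.
Proof.
  induction k as [|k [g [Hg IH]]].
  - exists bose. split; [constructor | auto].
  - destruct (bose_poly_derive g Hg) as [g' [Hg' Hd]]. exists g'. split; auto. intros u Hu. simpl.
    rewrite (Derive_ext_loc _ g). now apply is_derive_unique, Hd.
    generalize (locally_gt 0 u Hu). apply filter_imp; auto.
Qed.

Lemma is_derive_Derive_n_bose (k : nat) (u : R) : 0 < u -> is_derive (Derive_n bose k) u (Derive_n bose (S k) u).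
Proof.
  intros Hu. simpl. apply Derive_correct.
  destruct (Derive_n_bose_poly k) as [g [Hg H]]. destruct (bose_poly_derive g Hg) as [g' [_ Hd]].
  apply ex_derive_ext_loc with g. generalize (locally_gt 0 u Hu). apply filter_imp. intros; symmetry; auto.
  exists (g' u). auto.
Qed.

Lemma Derive_n_bose_bound (k : nat) (a : R) : 0 < a ->
  exists C, forall u, a <= u -> Rabs (Derive_n bose k u) <= C / u ^ 2.
Proof.
  intros Ha. destruct (Derive_n_bose_poly k) as [g [Hg H]].
  destruct (bose_poly_bound g Hg a Ha) as [C HC]. exists C. intros u Hu. rewrite H by lra. auto.
Qed.

Lemma is_derive_inv_pow (k : nat) (u : R) : u <> 0 ->
  is_derive (fun u => (-1) ^ k * INR (fact k) / u ^ S k) u ((-1) ^ S k * INR (fact (S k)) / u ^ S (S k)).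
Proof.
  intros Hu. auto_derive. apply Rmult_integral_contrapositive; split; auto; apply pow_nonzero; auto.
  rewrite fact_simpl, mult_INR, <- !tech_pow_Rmult. assert (H := pow_nonzero u k Hu).
  change (match k with O => 1 | S _ => INR k + 1 end) with (INR (S k)). field. auto.
Qed.

Lemma Derive_n_bose_reg_pos (k : nat) (u : R) : 0 < u ->
  Derive_n bose_reg k u = (-1) ^ k * INR (fact k) / u ^ S k - Derive_n bose k u.
Proof.
  revert u. induction k as [|k IH]; intros u Hu.
  - simpl. rewrite bose_reg_eq by lra. field. lra.
  - simpl Derive_n at 1. rewrite (Derive_ext_loc _ (fun u => (-1) ^ k * INR (fact k) / u ^ S k - Derive_n bose k u)).
    + apply is_derive_unique. apply (@is_derive_minus R_AbsRing R_NormedModule).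
      apply is_derive_inv_pow; lra. apply is_derive_Derive_n_bose; auto.
    + generalize (locally_gt 0 u Hu). apply filter_imp; auto.
Qed.

Lemma continuous_bounded_unit (f : R -> R) : (forall x, continuous f x) ->
  exists M, forall u, 0 <= u <= 1 -> Rabs (f u) <= M.
Proof.
  intros H. destruct (continuity_ab_maj (fun u => Rabs (f u)) 0 1) as [c [Hc _]]. lra.
  - intros c _. apply continuity_pt_filterlim. apply (continuous_comp f Rabs). apply H. apply continuous_Rabs.
  - exists (Rabs (f c)). exact Hc.
Qed.

(** Continuity gives the bound on [0,1]; beyond 1 the two parts 1/u and
    1/(e^u - 1) are bounded separately. The weak decay j = 1 is needed for the
    function itself, where 1/u dominates, and j = 2 makes the sums converge. *)
Lemma Derive_n_bose_reg_bound (k j : nat) : (1 <= j <= 2)%nat -> (j <= S k)%nat ->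
  exists C, 0 <= C /\ forall u, 0 <= u -> Rabs (Derive_n bose_reg k u) <= C / (1 + u) ^ j.
Proof.
  intros Hj Hjk.
  destruct (continuous_bounded_unit (Derive_n bose_reg k)) as [M HM].
  { intros x. apply (ex_derive_continuous (Derive_n bose_reg k)). apply smooth_bose_reg. }
  destruct (Derive_n_bose_bound k 1 Rlt_0_1) as [C HC].
  assert (HM0 : 0 <= M) by (eapply Rle_trans; [apply Rabs_pos | apply (HM 0); lra]).
  assert (HC0 : 0 <= C) by exact (bound_nonneg _ C 1 Rlt_0_1 (HC 1 (Rle_refl 1))).
  assert (Hf := INR_fact_lt_0 k).
  exists (4 * (M + C + INR (fact k))). split. lra. intros u Hu.
  assert (Hu0 : 0 < (1 + u) ^ j) by (apply pow_lt; lra).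
  apply Rmult_le_reg_r with ((1 + u) ^ j); auto. unfold Rdiv; rewrite Rmult_assoc, Rinv_l, Rmult_1_r by lra.
  destruct (Rle_dec u 1) as [Hu1|Hu1].
  - specialize (HM u (conj Hu Hu1)).
    assert ((1 + u) ^ j <= 4). { replace 4 with (2 ^ 2) by ring. apply Rle_trans with (2 ^ j). apply pow_incr; lra. apply Rle_pow; lra || lia. }
    assert (H1 := Rabs_pos (Derive_n bose_reg k u)). nra.
  - assert (Hu2 : 1 <= u) by lra.
    assert (Huj : 0 < u ^ j) by (apply pow_lt; lra).
    assert (HB : Rabs (Derive_n bose_reg k u) <= (INR (fact k) + C) / u ^ j).
    { rewrite Derive_n_bose_reg_pos by lra. unfold Rminus. eapply Rle_trans; [apply Rabs_triang|].
      rewrite Rabs_Ropp, Rdiv_plus_distr. apply Rplus_le_compat.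
      - unfold Rdiv. rewrite !Rabs_mult, pow_1_abs, Rmult_1_l, (Rabs_pos_eq (INR _)) by lra.
        rewrite Rabs_pos_eq. apply Rmult_le_compat_l; [lra|]. apply Rinv_le_contravar; auto. apply Rle_pow; auto.
        apply Rinv_nonneg, pow_lt; lra.
      - eapply Rle_trans; [apply HC; auto|]. apply Rdiv_le_contravar; auto. split; auto. apply Rle_pow; auto. lia. }
    assert (H2 : (1 + u) ^ j <= 4 * u ^ j).
    { apply Rle_trans with ((2 * u) ^ j). apply pow_incr; lra. rewrite Rpow_mult_distr. apply Rmult_le_compat_r; [lra|].
      replace 4 with (2 ^ 2) by ring. apply Rle_pow; lra || lia. }
    apply Rle_trans with ((INR (fact k) + C) / u ^ j * (4 * u ^ j)).
    + apply Rmult_le_compat; auto using Rabs_pos. lra.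
    + replace ((INR (fact k) + C) / u ^ j * (4 * u ^ j)) with (4 * (INR (fact k) + C)) by (field; lra). lra.
Qed.

(** * Euler-Maclaurin expansion at the left end point *)

(** Sums of reals live in the carrier of an abelian monoid structure; this
    restores the type expected by the arithmetic tactics. *)
Ltac as_R_eq := match goal with |- @eq _ ?a ?b => change (@eq R a b) end.

(** Writes a Taylor polynomial starting at the k-th derivative as a sum over
    a range of derivatives that does not depend on k, so that double sums can be
    exchanged. *)
Lemma sum_n_strict_shift (f : nat -> nat -> R) (k K : nat) : (k <= K)%nat ->
  sum_n (fun i => f i (k + i)%nat) (K - k) =
  f 0%nat k + sum_n (fun j => if Nat.ltb k j then f (j - k)%nat j else 0) K.
Proof.
  assert (Hz : forall K, (K <= k)%nat -> sum_n (fun j => if Nat.ltb k j then f (j - k)%nat j else 0) K = 0).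
  { induction K0 as [|K0 IH]; intros H.
    - rewrite sum_O. reflexivity.
    - rewrite sum_Sn, IH by lia. replace (Nat.ltb k (S K0)) with false by (symmetry; apply Nat.ltb_ge; lia).
      exact (Rplus_0_l 0). }
  induction K as [|K IH]; intros H.
  - rewrite Hz by lia. replace k with 0%nat by lia. simpl (0 - 0)%nat. rewrite sum_O. simpl. ring.
  - destruct (Nat.eq_dec k (S K)) as [->|Hk].
    + rewrite Hz, Nat.sub_diag, sum_O by lia. rewrite Nat.add_0_r. as_R_eq. ring.
    + rewrite sum_Sn. replace (S K - k)%nat with (S (K - k)) by lia.
      rewrite sum_Sn, IH by lia.
      replace (Nat.ltb k (S K)) with true by (symmetry; apply Nat.ltb_lt; lia).
      replace (k + S (K - k))%nat with (S K) by lia. replace (S K - k)%nat with (S (K - k)) by lia.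
      apply Rplus_assoc.
Qed.

Lemma sum_n_0 (n : nat) : sum_n (fun _ => 0) n = 0.
Proof.
  induction n as [|n IH]. now rewrite sum_O. rewrite sum_Sn, IH. exact (Rplus_0_l 0).
Qed.

Lemma Rabs_sum_n_le (a b : nat -> R) (n : nat) :
  (forall k, (k <= n)%nat -> Rabs (a k) <= b k) -> Rabs (sum_n a n) <= sum_n b n.
Proof.
  induction n as [|n IH]; intros H.
  - rewrite !sum_O. auto.
  - rewrite !sum_Sn. unfold plus; simpl. eapply Rle_trans; [apply Rabs_triang|].
    apply Rplus_le_compat; auto.
Qed.

Lemma sum_n_minus_R (a b : nat -> R) (n : nat) :
  sum_n (fun k => a k - b k) n = sum_n a n - sum_n b n.
Proof.
  induction n as [|n IH].
  - now rewrite !sum_O.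
  - rewrite !sum_Sn, IH. unfold plus; simpl. ring.
Qed.

(** Comparison with the integral of 1/(1+u)^2, as a telescoping sum. *)
Lemma sum_inv_square_le (e : R) (M : nat) : 0 < e ->
  sum_n (fun n => e / (1 + e * INR n) ^ 2) M <= e + 1.
Proof.
  intros He.
  assert (H : sum_n (fun n => e / (1 + e * INR n) ^ 2) M <= e + 1 - / (1 + e * INR M)).
  { induction M as [|M IH].
    - rewrite sum_O. simpl. rewrite Rmult_0_r, Rplus_0_r. lra.
    - rewrite sum_Sn. unfold plus; simpl plus.
      apply Rle_trans with ((e + 1 - / (1 + e * INR M)) + e / (1 + e * INR (S M)) ^ 2).
      + apply Rplus_le_compat_r. exact IH.
      + rewrite S_INR. assert (HM := pos_INR M). set (t := 1 + e * INR M).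
        assert (Ht : 1 <= t) by (unfold t; nra).
        replace (1 + e * (INR M + 1)) with (t + e) by (unfold t; ring).
        assert (e / (t + e) ^ 2 <= / t - / (t + e)); [|lra].
        replace (/ t - / (t + e)) with (e / (t * (t + e))) by (field; lra).
        apply Rmult_le_compat_l; [lra|]. apply Rinv_le_contravar; nra. }
  assert (HM := pos_INR M).
  assert (0 < / (1 + e * INR M)) by (apply Rinv_0_lt_compat; nra). lra.
Qed.

Section EulerMaclaurin.

Variable F : R -> R.
Hypothesis F_smooth : smooth F.
Hypothesis F_decay : forall k, exists C, 0 <= C /\ forall u, 0 <= u -> Rabs (Derive_n F k u) <= C / (1 + u) ^ 1.
Hypothesis F'_decay : forall k, exists C, 0 <= C /\ forall u, 0 <= u -> Rabs (Derive_n F (S k) u) <= C / (1 + u) ^ 2.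

Lemma taylor_decay (k n : nat) : exists C, 0 <= C /\ forall a h, 0 <= a -> 0 < h ->
  Rabs (Derive_n F k (a + h) - sum_n (fun i => h ^ i / INR (fact i) * Derive_n F (k + i) a) n)
    <= C * h ^ S n / (1 + a) ^ 2.
Proof.
  destruct (F'_decay (k + n)) as [C [HC0 HC]]. exists C. split; auto. intros a h Ha Hh.
  destruct (Taylor_Lagrange (Derive_n F k) n a (a + h)) as [z [Hz Heq]]. lra.
  { intros t _ [|j] _; simpl; auto. apply smooth_Derive_n; auto. }
  rewrite Heq. rewrite <- sum_n_Reals.
  assert (E : forall i, Derive_n (Derive_n F k) i = Derive_n F (k + i)).
  { intros i. apply functional_extensionality; intros t. rewrite Derive_n_comp. f_equal. lia. }
  replace (sum_n (fun m => (a + h - a) ^ m / INR (fact m) * Derive_n (Derive_n F k) m a) n)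
    with (sum_n (fun i => h ^ i / INR (fact i) * Derive_n F (k + i) a) n).
  2:{ apply sum_n_ext_R; intros i Hi. rewrite E. now replace (a + h - a) with h by ring. }
  rewrite E. replace (a + h - a) with h by ring.
  match goal with |- Rabs (?s + ?t - ?s) <= _ => replace (s + t - s) with t by ring end.
  assert (Hh1 : 0 < h ^ S n) by (apply pow_lt; auto).
  assert (Hf : 1 <= INR (fact (S n))). { change 1 with (INR 1). apply le_INR. apply lt_O_fact. }
  rewrite Rabs_mult. rewrite (Rabs_pos_eq (h ^ S n / _)) by (apply Rlt_le, Rdiv_lt_0_compat; lra).
  replace (C * h ^ S n / (1 + a) ^ 2) with (h ^ S n * (C / (1 + a) ^ 2)) by (unfold Rdiv; ring).
  apply Rmult_le_compat; auto using Rabs_pos.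
  - apply Rlt_le, Rdiv_lt_0_compat; lra.
  - apply Rmult_le_reg_r with (INR (fact (S n))). lra. unfold Rdiv. rewrite Rmult_assoc, Rinv_l by lra. nra.
  - replace (k + S n)%nat with (S (k + n)) by lia. eapply Rle_trans; [apply HC; lra|].
    apply Rdiv_le_contravar; auto. split. apply pow_lt; lra. apply pow_incr; lra.
Qed.

Variable x : R.
Hypothesis x_pos : 0 < x.

Definition bern_coef (k : nat) : R := bernoulli k x / INR (fact k).

(** The operator sum_k B_k(x)/k! e^k D^k is e D exp(x e D) / (exp(e D) - 1), so
    its differences with step e give e D exp(x e D); the coefficients agree by
    the recurrence of the Bernoulli polynomials, order by order up to the
    truncation. *)
Lemma step_identity (e a : R) (K : nat) :
  sum_n (fun k => bern_coef k * e ^ k *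
     (sum_n (fun j => if Nat.ltb k j then e ^ (j - k) / INR (fact (j - k)) * Derive_n F j a else 0) (S K))) (S K)
  = e * sum_n (fun i => (e * x) ^ i / INR (fact i) * Derive_n F (1 + i) a) K.
Proof.
  transitivity (sum_n (fun k => sum_n (fun j =>
     (if Nat.ltb k j then bern_coef k * / INR (fact (j - k)) else 0) * (e ^ j * Derive_n F j a)) (S K)) (S K)).
  { apply sum_n_ext_R; intros k Hk. rewrite <- sum_n_scal_l. apply sum_n_ext_R; intros j Hj.
    destruct (Nat.ltb k j) eqn:E; [|ring]. apply Nat.ltb_lt in E.
    replace (e ^ j) with (e ^ k * e ^ (j - k)). field. apply INR_fact_neq_0.
    rewrite <- pow_add. f_equal. lia. }
  rewrite sum_n_switch.
  rewrite sum_n_incr_1. rewrite <- sum_n_scal_l.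
  match goal with |- ?a + _ = _ => replace a with 0 end.
  2:{ symmetry. transitivity (sum_n (fun _ : nat => 0) (S K)); [|apply sum_n_0]. apply sum_n_ext_R; intros k Hk. cbv beta.
      replace (Nat.ltb k 0) with false by (symmetry; apply Nat.ltb_ge; lia). ring. }
  rewrite Rplus_0_l. apply sum_n_ext_R; intros j Hj.
  transitivity ((e ^ S j * Derive_n F (S j) a) * (x ^ j / INR (fact j))).
  2:{ rewrite Rpow_mult_distr. simpl. field. apply INR_fact_neq_0. }
  rewrite <- bernoulli_recurrence, <- sum_n_scal_l.
  transitivity (sum_n (fun k => if Nat.ltb k (S j) then e ^ S j * Derive_n F (S j) a * (bernoulli k x / INR (fact k) * / INR (fact (S j - k))) else 0) (S K)).
  { apply sum_n_ext_R; intros k Hk. destruct (Nat.ltb k (S j)); unfold bern_coef; ring. }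
  assert (Hcut : forall (g : nat -> R) n M, (n <= M)%nat -> sum_n (fun k => if Nat.ltb k (S n) then g k else 0) M = sum_n g n).
  { intros g n M H. induction H as [|M H IH].
    - apply sum_n_ext_R; intros k Hk. now replace (Nat.ltb k (S n)) with true by (symmetry; apply Nat.ltb_lt; lia).
    - rewrite sum_Sn, IH. replace (Nat.ltb (S M) (S n)) with false by (symmetry; apply Nat.ltb_ge; lia). apply Rplus_0_r. }
  apply Hcut. lia.
Qed.

(** The Taylor remainders of order K + 1 of all the terms of the telescoping
    identity are O(e^(K+2)/(1+a)^2), the decay being that of the derivatives of F. *)
Lemma step_bound (K : nat) : exists D, 0 <= D /\ forall e a, 0 <= a -> 0 < e <= 1 ->
  Rabs (sum_n (fun k => bern_coef k * e ^ k * (Derive_n F k (a + e) - Derive_n F k a)) (S K)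
        - e * Derive_n F 1 (a + e * x)) <= D * e ^ S (S K) / (1 + a) ^ 2.
Proof.
  assert (HT : exists C, 0 <= C /\ forall k, (k <= S K)%nat -> forall a h, 0 <= a -> 0 < h ->
    Rabs (Derive_n F k (a + h) - sum_n (fun i => h ^ i / INR (fact i) * Derive_n F (k + i) a) (S K - k))
    <= C * h ^ S (S K - k) / (1 + a) ^ 2).
  { (* One constant for all the orders k <= m, by induction on m. *)
    generalize (S K) at 1. induction n as [|n [C [HC0 IH]]].
    - destruct (taylor_decay 0 (S K - 0)) as [C [HC0 HC]]. exists C. split; auto.
      intros k Hk. replace k with 0%nat by lia. exact HC.
    - destruct (taylor_decay (S n) (S K - S n)) as [C' [HC0' HC']]. exists (C + C'). split. lra.
      intros k Hk a h Ha Hh.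
      assert (Hp : 0 < h ^ S (S K - k) / (1 + a) ^ 2) by (apply Rdiv_lt_0_compat; apply pow_lt; lra).
      unfold Rdiv in *. rewrite Rmult_assoc.
      destruct (Nat.eq_dec k (S n)) as [->|Hk'].
      + eapply Rle_trans; [apply HC'; auto|]. unfold Rdiv. rewrite Rmult_assoc. nra.
      + eapply Rle_trans; [apply IH; auto; lia|]. unfold Rdiv. rewrite Rmult_assoc. nra. }
  destruct HT as [C [HC0 HC]].
  exists (sum_n (fun k => Rabs (bern_coef k) * C) (S K) + x ^ S K * C).
  assert (HS : 0 <= sum_n (fun k => Rabs (bern_coef k) * C) (S K)).
  { eapply Rle_trans; [|apply (Rabs_sum_n_le (fun _ => 0) (fun k => Rabs (bern_coef k) * C))].
    apply Rabs_pos. intros k _. rewrite Rabs_R0. apply Rmult_le_pos; auto using Rabs_pos. }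
  assert (Hxp : 0 < x ^ S K) by (apply pow_lt; auto).
  split. { apply Rplus_le_le_0_compat; auto. apply Rmult_le_pos; lra. }
  intros e a Ha He.
  assert (Hid := step_identity e a K).
  set (P1 := sum_n (fun i => (e * x) ^ i / INR (fact i) * Derive_n F (1 + i) a) K) in *.
  set (Q := fun k => sum_n (fun j => if Nat.ltb k j then e ^ (j - k) / INR (fact (j - k)) * Derive_n F j a else 0) (S K)).
  change (sum_n (fun k => bern_coef k * e ^ k * Q k) (S K) = e * P1) in Hid.
  replace (sum_n _ (S K) - e * Derive_n F 1 (a + e * x)) with
   (sum_n (fun k => bern_coef k * e ^ k * (Derive_n F k (a + e) - Derive_n F k a - Q k)) (S K)
     - e * (Derive_n F 1 (a + e * x) - P1)).
  2:{ transitivity (sum_n (fun k => bern_coef k * e ^ k * (Derive_n F k (a + e) - Derive_n F k a) - bern_coef k * e ^ k * Q k) (S K)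
     - e * (Derive_n F 1 (a + e * x) - P1)).
      f_equal. apply sum_n_ext_R; intros; ring.
      rewrite sum_n_minus_R, Hid. ring. }
  assert (Hp : 0 < e ^ S (S K) / (1 + a) ^ 2) by (apply Rdiv_lt_0_compat; apply pow_lt; lra).
  replace ((sum_n (fun k => Rabs (bern_coef k) * C) (S K) + x ^ S K * C) * e ^ S (S K) / (1 + a) ^ 2)
   with (sum_n (fun k => e ^ S (S K) / (1 + a) ^ 2 * (Rabs (bern_coef k) * C)) (S K) + x ^ S K * C * e ^ S (S K) / (1 + a) ^ 2).
  2:{ rewrite sum_n_scal_l. unfold Rdiv; ring. }
  unfold Rminus at 1. eapply Rle_trans; [apply Rabs_triang|]. rewrite Rabs_Ropp. apply Rplus_le_compat.
  - apply Rabs_sum_n_le. intros k Hk.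
    specialize (HC k Hk a e Ha (proj1 He)).
    rewrite (sum_n_strict_shift (fun i j => e ^ i / INR (fact i) * Derive_n F j a) k (S K) Hk) in HC.
    fold (Q k) in HC.
    replace (Derive_n F k (a + e) - (e ^ 0 / INR (fact 0) * Derive_n F k a + Q k)) with
      (Derive_n F k (a + e) - Derive_n F k a - Q k) in HC by (simpl; field).
    rewrite Rabs_mult, Rabs_mult, (Rabs_pos_eq (e ^ k)) by (apply pow_le; lra).
    replace (e ^ S (S K)) with (e ^ k * e ^ S (S K - k)) by (rewrite <- pow_add; f_equal; lia).
    replace (e ^ k * e ^ S (S K - k) / (1 + a) ^ 2 * (Rabs (bern_coef k) * C)) with
      (Rabs (bern_coef k) * e ^ k * (C * e ^ S (S K - k) / (1 + a) ^ 2)) by (unfold Rdiv; ring).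
    apply Rmult_le_compat_l; auto. apply Rmult_le_pos. apply Rabs_pos. apply pow_le; lra.
  - assert (H1 : (1 <= S K)%nat) by lia.
    assert (Hex : 0 < e * x) by (apply Rmult_lt_0_compat; lra).
    specialize (HC 1%nat H1 a (e * x) Ha Hex).
    replace (S K - 1)%nat with K in HC by lia. fold P1 in HC.
    rewrite Rabs_mult, (Rabs_pos_eq e) by lra.
    replace (x ^ S K * C * e ^ S (S K) / (1 + a) ^ 2) with (e * (C * (e * x) ^ S K / (1 + a) ^ 2)).
    apply Rmult_le_compat_l; auto; lra.
    rewrite Rpow_mult_distr. rewrite <- (tech_pow_Rmult e (S K)). unfold Rdiv; ring.
Qed.

Lemma ex_series_sampled (e : R) : 0 < e -> ex_series (fun n => e * Derive_n F 1 (e * (INR n + x))).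
Proof.
  intros He. destruct (F'_decay 0) as [C [HC0 HC]].
  apply ex_series_Rabs_le with (fun n => C * (e / (1 + e * INR n) ^ 2)).
  - intros n. assert (Hn := pos_INR n).
    rewrite Rabs_mult, (Rabs_pos_eq e) by lra.
    replace (C * (e / (1 + e * INR n) ^ 2)) with (e * (C / (1 + e * INR n) ^ 2)) by (unfold Rdiv; ring).
    apply Rmult_le_compat_l; [lra|]. eapply Rle_trans; [apply HC; nra|].
    apply Rdiv_le_contravar; auto. split. apply pow_lt; nra. apply pow_incr; nra.
  - apply (ex_series_Rmult_l C).
    apply (ex_series_bounded _ (e + 1)). intros n. apply Rlt_le, Rdiv_lt_0_compat; auto. apply pow_lt.
    assert (Hn := pos_INR n). nra. intros N; now apply sum_inv_square_le.
Qed.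

(** Sum the increments over the points a = e n: the left side telescopes to
    minus its value at 0, and the errors add up to O(e^(K+1)) because
    sum_n e/(1+e n)^2 is bounded. *)
Lemma euler_maclaurin (K : nat) : exists D, forall e, 0 < e <= 1 ->
  Rabs (Series (fun n => e * Derive_n F 1 (e * (INR n + x)))
        + sum_n (fun k => bern_coef k * e ^ k * Derive_n F k 0) (S K)) <= D * e ^ S K.
Proof.
  destruct (step_bound K) as [D [HD0 HD]]. exists (D * 2). intros e He.
  set (A := fun n => sum_n (fun k => bern_coef k * e ^ k * Derive_n F k (e * INR n)) (S K)).
  set (g := fun n => e * Derive_n F 1 (e * (INR n + x))).
  assert (Hstep : forall n, Rabs (A (S n) - A n - g n) <= D * e ^ S K * (e / (1 + e * INR n) ^ 2)).
  { intros n. unfold A, g. rewrite <- sum_n_minus_R. rewrite S_INR.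
    replace (D * e ^ S K * (e / (1 + e * INR n) ^ 2)) with (D * e ^ S (S K) / (1 + e * INR n) ^ 2)
      by (rewrite <- (tech_pow_Rmult e (S K)); unfold Rdiv; ring).
    assert (Hn := pos_INR n).
    eapply Rle_trans; [|apply (HD e (e * INR n)); nra]. right. f_equal.
    f_equal; [|f_equal; f_equal; ring].
    apply sum_n_ext_R; intros k Hk. replace (e * (INR n + 1)) with (e * INR n + e) by ring. ring. }
  assert (Htel : forall M, A (S M) - A 0%nat - sum_n g M = sum_n (fun n => A (S n) - A n - g n) M).
  { induction M as [|M IH]. now rewrite !sum_O. rewrite !sum_Sn, <- IH. unfold plus; simpl plus. simpl. ring. }
  assert (Hbd : forall M, Rabs (A (S M) - A 0%nat - sum_n g M) <= D * 2 * e ^ S K).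
  { intros M. rewrite Htel. eapply Rle_trans; [apply Rabs_sum_n_le; intros k _; apply Hstep|].
    rewrite sum_n_scal_l. assert (H := sum_inv_square_le e M (proj1 He)).
    assert (0 <= D * e ^ S K) by (apply Rmult_le_pos; auto; apply pow_le; lra).
    replace (D * 2 * e ^ S K) with (D * e ^ S K * 2) by ring. apply Rmult_le_compat_l; auto. lra. }
  assert (HA : is_lim_seq (fun M => A (S M)) 0).
  { apply (is_lim_seq_incr_1 A). unfold A.
    replace (Finite 0) with (Finite (sum_n (fun _ : nat => 0) (S K))).
    2:{ f_equal. apply sum_n_0. }
    apply (filterlim_sum_n eventually (fun k n => bern_coef k * e ^ k * Derive_n F k (e * INR n)) (fun _ => 0)).
    intros k. change (is_lim_seq (fun n => bern_coef k * e ^ k * Derive_n F k (e * INR n)) 0).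
    apply (is_lim_seq_ext (fun n => (bern_coef k * e ^ k) * Derive_n F k (e * INR n))). intros; ring.
    replace (Finite 0) with (Rbar_mult (bern_coef k * e ^ k) 0) by (simpl; f_equal; ring).
    apply is_lim_seq_scal_l.
    destruct (F_decay k) as [C [HC0 HC]].
    apply is_lim_seq_abs_0.
    apply is_lim_seq_le_le with (fun _ => 0) (fun n => C / e * / INR (S n) + C * 0).
    - intros n. split. apply Rabs_pos. assert (Hn := pos_INR n). eapply Rle_trans; [apply HC; nra|].
      rewrite pow_1, S_INR, Rmult_0_r, Rplus_0_r. unfold Rdiv. rewrite Rmult_assoc, <- Rinv_mult.
      apply Rmult_le_compat_l; auto. apply Rinv_le_contravar; nra.
    - apply is_lim_seq_const.
    - replace (Finite 0) with (Finite (C / e * 0 + C * 0)) by (f_equal; ring).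
      apply is_lim_seq_plus'. 2: apply is_lim_seq_const.
      apply (is_lim_seq_scal_l _ (C / e) 0).
      exact is_lim_seq_inv_INR_S. }
  assert (Hg : is_lim_seq (sum_n g) (Series g)) by (apply Series_correct, ex_series_sampled; lra).
  assert (Hlim : is_lim_seq (fun M => Rabs (A (S M) - A 0%nat - sum_n g M)) (Rabs (0 - A 0%nat - Series g))).
  { apply (is_lim_seq_abs _ (Finite (0 - A 0%nat - Series g))).
    apply is_lim_seq_minus'; auto. apply is_lim_seq_minus'; auto. apply is_lim_seq_const. }
  assert (HR := is_lim_seq_le _ _ _ _ Hbd Hlim (is_lim_seq_const _)). simpl in HR.
  rewrite <- Rabs_Ropp. eapply Rle_trans; [|exact HR]. right. f_equal.
  fold g. transitivity (0 - sum_n (fun k => bern_coef k * e ^ k * Derive_n F k 0) (S K) - Series g). ring.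
  f_equal. f_equal. unfold A. apply sum_n_ext_R; intros k Hk. now rewrite Rmult_0_r.
Qed.

End EulerMaclaurin.

(** * Termwise differentiation of sums over n + y *)

(** A sequence of functions on u > 0, each the derivative of the previous one,
    with enough decay for the sums over n of g_k(n + y) to converge locally
    uniformly in y. *)
Record summable_tower (g : nat -> R -> R) : Prop := {
  tower_derive : forall k u, 0 < u -> is_derive (g k) u (g (S k) u);
  tower_bound : forall k a, 0 < a -> exists C, forall u, a <= u -> Rabs (g k u) <= C / u ^ 2
}.

Lemma ex_series_inv_square (a C : R) : 0 < a -> ex_series (fun n => C / (INR n + a) ^ 2).
Proof.
  intros Ha. apply ex_series_ext with (fun n => C / a * (/ a / (1 + / a * INR n) ^ 2)).
  - intros n. assert (Hn := pos_INR n). as_R_eq. field. split; lra.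
  - apply (ex_series_Rmult_l (C / a)).
    assert (Hi : 0 < / a) by (apply Rinv_0_lt_compat; auto).
    apply (ex_series_bounded _ (/ a + 1)).
    + intros n. assert (Hn := pos_INR n). apply Rlt_le, Rdiv_lt_0_compat; auto. apply pow_lt. nra.
    + intros N; now apply sum_inv_square_le.
Qed.

Lemma tower_ex_series (g : nat -> R -> R) (k : nat) (y : R) :
  summable_tower g -> 0 < y -> ex_series (fun n => g k (INR n + y)).
Proof.
  intros Hg Hy. destruct (tower_bound g Hg k y Hy) as [C HC].
  apply ex_series_Rabs_le with (fun n => C / (INR n + y) ^ 2).
  - intros n. apply HC. assert (Hn := pos_INR n). lra.
  - now apply ex_series_inv_square.
Qed.

(** For |z - y| < y/2 the terms of the differentiated series are at most
    C/(n + y/2)^2, with C the decay constant on u >= y/2. *)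
Lemma tower_is_derive (g : nat -> R -> R) (k : nat) (y : R) :
  summable_tower g -> 0 < y ->
  is_derive (fun y => Series (fun n => g k (INR n + y))) y (Series (fun n => g (S k) (INR n + y))).
Proof.
  intros Hg Hy. assert (Hy2 : 0 < y / 2) by lra.
  destruct (tower_bound g Hg (S k) (y / 2) Hy2) as [C HC].
  assert (HC0 : 0 <= C) by exact (bound_nonneg _ C (y / 2) Hy2 (HC _ (Rle_refl _))).
  apply (is_derive_Series (fun n y => g k (INR n + y)) (fun n y => g (S k) (INR n + y))
    (fun n => C / (INR n + y / 2) ^ 2) y (y / 2) Hy2).
  - now apply ex_series_inv_square.
  - intros n z Hz. apply Rabs_def2 in Hz. assert (Hn := pos_INR n).
    replace (g (S k) (INR n + z)) with (1 * g (S k) (INR n + z)) by ring.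
    apply (is_derive_comp (g k) (fun z => INR n + z)).
    apply (tower_derive g Hg). lra. auto_derive; auto; ring.
  - intros n z Hz. apply Rabs_def2 in Hz. assert (Hn := pos_INR n).
    eapply Rle_trans; [apply HC; lra|]. apply Rdiv_le_contravar; auto. split. apply pow_lt; lra. apply pow_incr; lra.
  - intros z Hz. apply Rabs_def2 in Hz. apply tower_ex_series; auto. lra.
Qed.

Lemma tower_Derive_n (g : nat -> R -> R) (f : R -> R) (c : R) (k : nat) (y : R) :
  summable_tower g ->
  (forall y, 0 < y -> f y = c + Series (fun n => g 0%nat (INR n + y))) ->
  0 < y -> Derive_n f (S k) y = Series (fun n => g (S k) (INR n + y)).
Proof.
  intros Hg Hf. revert y. induction k as [|k IH]; intros y Hy.
  - simpl. rewrite (Derive_ext_loc (fun x => f x) (fun y => c + Series (fun n => g 0%nat (INR n + y)))).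
    2:{ generalize (locally_gt 0 y Hy). apply filter_imp; auto. }
    apply is_derive_unique. rewrite <- (Rplus_0_l (Series _)).
    apply (@is_derive_plus R_AbsRing R_NormedModule). apply (@is_derive_const R_AbsRing R_NormedModule).
    now apply tower_is_derive.
  - change (Derive_n f (S (S k)) y) with (Derive (Derive_n f (S k)) y).
    rewrite (Derive_ext_loc _ (fun y => Series (fun n => g (S k) (INR n + y)))).
    2:{ generalize (locally_gt 0 y Hy). apply filter_imp; auto. }
    apply is_derive_unique. now apply tower_is_derive.
Qed.

(** * The q-polygamma functions *)

Lemma opp_ln_pos (q : R) : 0 < q < 1 -> 0 < - ln q.
Proof. intros Hq. assert (H := ln_increasing q 1). rewrite ln_1 in H. lra. Qed.

Definition log_term (u : R) : R := - ln (1 - exp (- u)).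

Lemma exp_neg_lt_1 (u : R) : 0 < u -> 0 < exp (- u) < 1.
Proof.
  intros Hu. split. apply exp_pos. rewrite <- exp_0. apply exp_increasing. lra.
Qed.

Lemma is_derive_log_term (u : R) : 0 < u -> is_derive log_term u (- bose u).
Proof.
  intros Hu. destruct (exp_neg_lt_1 u Hu) as [H1 H2]. unfold log_term, bose.
  assert (H3 := exp_gt_1 u Hu).
  auto_derive. lra. rewrite exp_Ropp. rewrite exp_Ropp in H2. field. lra.
Qed.

(** From 1/(1 - e^(-u)) = 1 + b(u) and ln (1 + b) <= b. *)
Lemma log_term_bounds (u : R) : 0 < u -> 0 <= log_term u <= bose u.
Proof.
  intros Hu. destruct (exp_neg_lt_1 u Hu) as [H1 H2]. unfold log_term.
  rewrite <- ln_Rinv by lra. assert (H3 := exp_gt_1 u Hu).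
  replace (/ (1 - exp (- u))) with (1 + bose u).
  - destruct (bose_bounds u Hu) as [Hp _]. split.
    + rewrite <- ln_1. apply ln_le; lra.
    + rewrite <- (ln_exp (bose u)) at 2. apply ln_le; [lra|]. apply exp_ineq1_le.
  - unfold bose. rewrite exp_Ropp. rewrite exp_Ropp in H2. field. split; lra.
Qed.

(** The successive derivatives of y |-> - ln (1 - e^(-e y)); for e = - ln q the
    sum over n of the values at n + y is minus the logarithm of the product of the
    1 - q^(n+y). *)
Definition q_tower (e : R) (k : nat) (y : R) : R :=
  match k with
  | O => log_term (e * y)
  | S k => - e ^ S k * Derive_n bose k (e * y)
  end.

Lemma q_tower_summable (e : R) : 0 < e -> summable_tower (q_tower e).
Proof.
  intros He. split.
  - intros k u Hu. assert (Heu : 0 < e * u) by (apply Rmult_lt_0_compat; auto).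
    destruct k as [|k].
    + replace (q_tower e 1 u) with (e * - bose (e * u)) by (simpl; ring).
      apply (is_derive_comp log_term (fun y => e * y)). now apply is_derive_log_term.
      auto_derive; auto; ring.
    + replace (q_tower e (S (S k)) u) with ((- e ^ S k) * (e * Derive_n bose (S k) (e * u)))
        by (unfold q_tower; rewrite <- (tech_pow_Rmult e (S k)); ring).
      apply is_derive_scal. apply (is_derive_comp (Derive_n bose k) (fun y => e * y)).
      now apply is_derive_Derive_n_bose. auto_derive; auto; ring.
  - assert (Hk : forall k a, 0 < a -> exists C, 0 <= C /\ forall u, a <= u -> Rabs (Derive_n bose k (e * u)) <= C / u ^ 2).
    { intros k a Ha. destruct (Derive_n_bose_bound k (e * a)) as [C HC]. apply Rmult_lt_0_compat; auto.
      assert (HC0 : 0 <= C) by (apply (bound_nonneg _ C (e * a) (Rmult_lt_0_compat _ _ He Ha) (HC _ (Rle_refl _)))).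
      exists (C / e ^ 2). assert (He2 : 0 < e ^ 2) by (apply pow_lt; auto). split.
      { apply Rdiv_le_0_compat; auto. }
      intros u Hu. eapply Rle_trans; [apply HC; nra|]. right. field. lra. }
    intros k a Ha. destruct k as [|k]; simpl q_tower.
    + destruct (Hk 0%nat a Ha) as [C [HC0 HC]]. exists C. intros u Hu.
      assert (Heu : 0 < e * u) by (apply Rmult_lt_0_compat; lra).
      destruct (log_term_bounds (e * u) Heu) as [H1 H2]. rewrite Rabs_pos_eq by auto.
      eapply Rle_trans; [exact H2|]. eapply Rle_trans; [|apply HC; auto]. apply Rle_abs.
    + destruct (Hk k a Ha) as [C [HC0 HC]]. exists (Rabs (- (e * e ^ k)) * C). intros u Hu.
      rewrite Rabs_mult. unfold Rdiv; rewrite Rmult_assoc. apply Rmult_le_compat_l. apply Rabs_pos. now apply HC.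
Qed.

Lemma prod_f_R0_exp (f l : nat -> R) (M : nat) :
  (forall n, f n = exp (l n)) -> prod_f_R0 f M = exp (sum_n l M).
Proof.
  intros H. induction M as [|M IH].
  - simpl. now rewrite sum_O.
  - simpl. rewrite sum_Sn, IH, H. symmetry. apply exp_plus.
Qed.

(** Turns the infinite product into the difference of two convergent series,
    at y and at 1; only the first depends on y. *)
Lemma ln_q_Gamma (q y : R) : 0 < q < 1 -> 0 < y ->
  ln (q_Gamma q y) = (1 - y) * ln (1 - q) +
    (Series (fun n => q_tower (- ln q) 0 (INR n + y)) - Series (fun n => q_tower (- ln q) 0 (INR n + 1))).
Proof.
  intros Hq Hy.
  assert (He := opp_ln_pos q Hq).
  set (e := - ln q) in *.
  assert (Hs := q_tower_summable e He).
  assert (Hy1 := tower_ex_series _ 0 y Hs Hy). assert (H11 := tower_ex_series _ 0 1 Hs Rlt_0_1).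
  set (l := fun n : nat => q_tower e 0 (INR n + y) - q_tower e 0 (INR n + 1)).
  assert (Hprod : forall M, prod_f_R0 (fun n => (1 - q ^ (n + 1)) / (1 - Rpower q (INR n + y))) M = exp (sum_n l M)).
  { intros M. apply prod_f_R0_exp. intros n. assert (Hn := pos_INR n).
    unfold l, q_tower, log_term.
    assert (E1 : 0 < e * (INR n + y)) by (apply Rmult_lt_0_compat; lra).
    assert (E2 : 0 < e * (INR n + 1)) by (apply Rmult_lt_0_compat; lra).
    destruct (exp_neg_lt_1 _ E1), (exp_neg_lt_1 _ E2).
    replace (- ln (1 - exp (- (e * (INR n + y)))) - - ln (1 - exp (- (e * (INR n + 1)))))
      with (ln (1 - exp (- (e * (INR n + 1)))) + - ln (1 - exp (- (e * (INR n + y))))) by ring.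
    rewrite exp_plus, (exp_Ropp (ln (1 - exp (- (e * (INR n + y)))))), !exp_ln by lra. unfold Rdiv. f_equal; f_equal.
    - rewrite <- Rpower_pow by lra. unfold Rpower. rewrite plus_INR. simpl (INR 1). unfold e. f_equal. f_equal. ring.
    - unfold Rpower, e. f_equal. f_equal. ring. }
  unfold q_Gamma.
  rewrite (Lim_seq_ext (fun M => prod_f_R0 (fun n => (1 - q ^ (n + 1)) / (1 - Rpower q (INR n + y))) M) _ Hprod).
  assert (Hl : is_lim_seq (fun M => exp (sum_n l M)) (exp (Series l))).
  { apply (is_lim_seq_continuous exp). apply derivable_continuous_pt, derivable_pt_exp.
    apply Series_correct. apply (@ex_series_minus R_AbsRing R_NormedModule _ _ Hy1 H11). }
  rewrite (is_lim_seq_unique _ _ Hl). simpl real.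
  rewrite ln_mult by (unfold Rpower; apply exp_pos). unfold Rpower. rewrite !ln_exp. f_equal.
  unfold l. now rewrite Series_minus.
Qed.

Lemma q_polygamma_series (m : nat) (q x : R) : 0 < q < 1 -> 0 < x ->
  q_polygamma (S m) q x =
  Series (fun n => - (- ln q) ^ S (S m) * Derive_n bose (S m) (- ln q * (INR n + x))).
Proof.
  intros Hq Hx.
  assert (He := opp_ln_pos q Hq).
  assert (Hs := q_tower_summable _ He).
  assert (Hs1 : summable_tower (fun k => q_tower (- ln q) (S k))).
  { split; intros k; [apply (tower_derive _ Hs) | apply (tower_bound _ Hs)]. }
  unfold q_polygamma.
  apply (tower_Derive_n (fun k => q_tower (- ln q) (S k)) _ (- ln (1 - q)) m x Hs1); auto.
  intros y Hy. unfold q_digamma.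
  rewrite (Derive_ext_loc _ (fun y => (1 - y) * ln (1 - q) +
    (Series (fun n => q_tower (- ln q) 0 (INR n + y)) - Series (fun n => q_tower (- ln q) 0 (INR n + 1))))).
  2:{ generalize (locally_gt 0 y Hy). apply filter_imp. intros z Hz. now apply ln_q_Gamma. }
  apply is_derive_unique. apply (@is_derive_plus R_AbsRing R_NormedModule).
  - auto_derive; auto; ring.
  - replace (Series (fun n => q_tower (- ln q) 1 (INR n + y))) with
      (minus (Series (fun n => q_tower (- ln q) 1 (INR n + y))) 0) by (unfold minus, plus, opp; simpl; ring).
    apply (@is_derive_minus R_AbsRing R_NormedModule).
    now apply tower_is_derive. apply (@is_derive_const R_AbsRing R_NormedModule).
Qed.

(** * The Gamma function *)

(** For a nonnegative integrand the integrals over [a,b] increase as the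
    interval grows, so their supremum is their limit. *)
Lemma ex_RInt_gen_pos (f : R -> R) (M : R) :
  (forall t, 0 < t -> continuous f t) -> (forall t, 0 < t -> 0 <= f t) ->
  (forall a b, 0 < a -> a <= b -> RInt f a b <= M) ->
  ex_RInt_gen f (at_right 0) (Rbar_locally p_infty).
Proof.
  intros Hc Hp HM.
  assert (Hex : forall a b, 0 < a -> a <= b -> ex_RInt f a b).
  { intros a b Ha Hab. apply (@ex_RInt_continuous R_CompleteNormedModule).
    intros z Hz. apply Hc. rewrite Rmin_left in Hz by auto. lra. }
  assert (Hpos : forall a b, 0 < a -> a <= b -> 0 <= RInt f a b).
  { intros a b Ha Hab. apply RInt_ge_0; auto. intros; apply Hp; lra. }
  set (E := fun v => exists a b, 0 < a <= 1 /\ 1 <= b /\ v = RInt f a b).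
  destruct (completeness E) as [L [HL1 HL2]].
  - exists M. intros v [a [b [Ha [Hb ->]]]]. apply HM; lra.
  - exists (RInt f 1 1), 1, 1. repeat split; lra.
  - exists L. intros P [eps HP].
    assert (Hnot : ~ is_upper_bound E (L - eps)).
    { intros H. specialize (HL2 _ H). destruct eps; simpl in *; lra. }
    assert (Hsup : exists a b, 0 < a <= 1 /\ 1 <= b /\ L - eps < RInt f a b).
    { apply Classical_Prop.NNPP. intros Hn. apply Hnot. intros v [a [b [Ha [Hb ->]]]].
      destruct (Rle_lt_dec (RInt f a b) (L - eps)); auto. exfalso. apply Hn. exists a, b. auto. }
    destruct Hsup as [a0 [b0 [Ha0 [Hb0 Hlt]]]].
    apply (Filter_prod _ _ _ (fun a => 0 < a < a0) (fun b => b0 < b)).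
    + exists (mkposreal a0 (proj1 Ha0)). intros y Hy Hy0. split; auto.
      apply ball_R in Hy. apply Rabs_def2 in Hy. simpl in Hy. lra.
    + exists b0. auto.
    + intros a b Ha Hb. exists (RInt f a b). split.
      * simpl. apply (@RInt_correct R_CompleteNormedModule). apply Hex; lra.
      * apply HP, ball_R_intro.
        assert (H1 : RInt f a b <= L) by (apply HL1; exists a, b; repeat split; lra).
        assert (H2 : RInt f a b = RInt f a a0 + (RInt f a0 b0 + RInt f b0 b)).
        { rewrite <- (RInt_Chasles f a a0 b), <- (RInt_Chasles f a0 b0 b); auto; apply Hex; lra. }
        assert (H3 := Hpos a a0 (proj1 Ha) ltac:(lra)). assert (H4 := Hpos b0 b ltac:(lra) ltac:(lra)).
        apply Rabs_def1; lra.
Qed.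

Lemma exp_incr_le (a b : R) : a <= b -> exp a <= exp b.
Proof. intros [H|H]; [left; now apply exp_increasing | right; now rewrite H]. Qed.

Definition Gamma_integrand (s t : R) : R := Rpower t (s - 1) * exp (- t).

Lemma Gamma_integrand_pos (s t : R) : 0 < Gamma_integrand s t.
Proof. unfold Gamma_integrand, Rpower. apply Rmult_lt_0_compat; apply exp_pos. Qed.

Lemma Gamma_integrand_continuous (s t : R) : 0 < t -> continuous (Gamma_integrand s) t.
Proof.
  intros Ht. apply (@ex_derive_continuous R_AbsRing R_NormedModule).
  unfold Gamma_integrand, Rpower. auto_derive. auto.
Qed.

(** Equivalent to ln (1+t) <= ln (s+1) + t/(s+1), which follows from
    e^y >= 1 + y at y = t/(s+1). *)
Lemma exp_dominates_power (s t : R) : 0 < s -> 0 < t ->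
  Rpower (1 + t) (s + 1) * exp (- t) <= Rpower (s + 1) (s + 1).
Proof.
  intros Hs Ht. unfold Rpower. rewrite <- exp_plus.
  assert (H : ln (1 + t) <= ln (s + 1) + t / (s + 1)).
  { rewrite <- (ln_exp (t / (s + 1))), <- ln_mult by (apply exp_pos || lra).
    apply ln_le; [lra|].
    apply Rle_trans with ((s + 1) * (1 + t / (s + 1))).
    - replace ((s + 1) * (1 + t / (s + 1))) with (s + 1 + t) by (field; lra). lra.
    - apply Rmult_le_compat_l; [lra|]. apply exp_ineq1_le. }
  assert (H2 : (s + 1) * ln (1 + t) + - t <= (s + 1) * ln (s + 1)).
  { apply Rle_trans with ((s + 1) * (ln (s + 1) + t / (s + 1)) + - t).
    - apply Rplus_le_compat_r, Rmult_le_compat_l; lra.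
    - right. field. lra. }
  now apply exp_incr_le.
Qed.

(** The integrand is dominated by a multiple of the derivative of the bounded
    function (t/(1+t))^s, which settles both ends of the integral at once. *)
Lemma is_RInt_gen_Gamma (s : R) : 0 < s ->
  is_RInt_gen (Gamma_integrand s) (at_right 0) (Rbar_locally p_infty) (Gamma s).
Proof.
  intros Hs. apply (@RInt_gen_correct R_CompleteNormedModule); try apply Proper_StrongProper; try typeclasses eauto.
  set (K := Rpower (s + 1) (s + 1) / s).
  assert (HK : 0 < K) by (apply Rdiv_lt_0_compat; auto; apply exp_pos).
  apply ex_RInt_gen_pos with K.
  - intros; now apply Gamma_integrand_continuous.
  - intros; apply Rlt_le, Gamma_integrand_pos.
  - intros a b Ha Hab.
    set (G := fun t => Rpower (t / (1 + t)) s).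
    set (g := fun t => s * Rpower t (s - 1) * / Rpower (1 + t) (s + 1)).
    assert (HG : forall t, 0 < t -> is_derive G t (g t)).
    { intros t Ht. unfold G, g, Rpower. assert (0 < t / (1 + t)) by (apply Rdiv_lt_0_compat; lra).
      auto_derive. split; [lra|split; auto].
      change (t * / (1 + t)) with (t / (1 + t)). rewrite ln_div by lra. rewrite <- exp_Ropp.
      replace (exp (s * (ln t - ln (1 + t)))) with (exp ((s - 1) * ln t) * exp (- ((s + 1) * ln (1 + t))) * (exp (ln t) * exp (ln (1 + t)))).
      rewrite !exp_ln by lra. field. lra.
      rewrite <- !exp_plus. f_equal. ring. }
    assert (Hgc : forall t, 0 < t -> continuous g t).
    { intros t Ht. apply (@ex_derive_continuous R_AbsRing R_NormedModule).
      unfold g, Rpower. auto_derive. repeat split; try lra. apply Rgt_not_eq, exp_pos. }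
    assert (HI : is_RInt (fun t => K * g t) a b (K * (G b - G a))).
    { apply (@is_RInt_scal R_NormedModule). apply (@is_RInt_derive R_CompleteNormedModule).
      - intros t Ht. rewrite Rmin_left in Ht by auto. apply HG; lra.
      - intros t Ht. rewrite Rmin_left in Ht by auto. apply Hgc; lra. }
    apply Rle_trans with (K * (G b - G a)).
    + rewrite <- (is_RInt_unique _ _ _ _ HI). apply RInt_le; auto.
      * apply (@ex_RInt_continuous R_CompleteNormedModule). intros t Ht. rewrite Rmin_left in Ht by auto.
        apply Gamma_integrand_continuous; lra.
      * eexists; exact HI.
      * intros t Ht. unfold Gamma_integrand, g, K.
        assert (Hd := exp_dominates_power s t Hs ltac:(lra)).
        assert (H1 : 0 < Rpower (1 + t) (s + 1)) by apply exp_pos.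
        assert (H2 : 0 < Rpower t (s - 1)) by apply exp_pos.
        replace (Rpower (s + 1) (s + 1) / s * (s * Rpower t (s - 1) * / Rpower (1 + t) (s + 1)))
          with (Rpower t (s - 1) * (Rpower (s + 1) (s + 1) / Rpower (1 + t) (s + 1))) by (field; lra).
        apply Rmult_le_compat_l; [lra|]. apply Rmult_le_reg_r with (Rpower (1 + t) (s + 1)); auto.
        unfold Rdiv. rewrite Rmult_assoc, Rinv_l by lra. lra.
    + assert (H1 : G b <= 1).
      { assert (Hb : 0 < b / (1 + b)) by (apply Rdiv_lt_0_compat; lra).
        assert (Hb1 : b / (1 + b) <= 1). { apply Rmult_le_reg_r with (1 + b). lra. unfold Rdiv; rewrite Rmult_assoc, Rinv_l; lra. }
        assert (ln (b / (1 + b)) <= 0) by (rewrite <- ln_1; apply ln_le; auto).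
        assert (Hle : s * ln (b / (1 + b)) <= 0) by nra. unfold G, Rpower.
        apply Rle_trans with (exp 0); [|right; apply exp_0].
        now apply exp_incr_le. }
      assert (H2 : 0 < G a) by apply exp_pos. nra.
Qed.

Lemma at_right_0_pos : at_right 0 (fun t => 0 < t).
Proof. exists (mkposreal 1 Rlt_0_1). auto. Qed.

Lemma filter_prod_pos_interval (P : R -> Prop) : (forall t, 0 < t -> P t) ->
  filter_prod (at_right 0) (Rbar_locally p_infty)
    (fun ab => forall t, Rmin (fst ab) (snd ab) <= t <= Rmax (fst ab) (snd ab) -> P t).
Proof.
  intros HP. apply (Filter_prod _ _ _ (fun a => 0 < a) (fun b => 0 < b)).
  apply at_right_0_pos. exists 0; auto.
  intros a b Ha Hb t [Ht _]. apply HP. simpl in Ht. eapply Rlt_le_trans; [|exact Ht]. apply Rmin_glb_lt; auto.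
Qed.

Lemma filter_prod_pos_interval_open (P : R -> Prop) : (forall t, 0 < t -> P t) ->
  filter_prod (at_right 0) (Rbar_locally p_infty)
    (fun ab => forall t, Rmin (fst ab) (snd ab) < t < Rmax (fst ab) (snd ab) -> P t).
Proof.
  intros HP. generalize (filter_prod_pos_interval P HP). apply filter_imp.
  intros ab H t Ht. apply H. lra.
Qed.

Lemma is_RInt_gen_0_infty_deriv (F f : R -> R) (la lb : R) :
  (forall t, 0 < t -> is_derive F t (f t)) -> (forall t, 0 < t -> continuous f t) ->
  filterlim F (at_right 0) (locally la) -> filterlim F (Rbar_locally p_infty) (locally lb) ->
  is_RInt_gen f (at_right 0) (Rbar_locally p_infty) (lb - la).
Proof.
  intros HF Hf Ha Hb. apply (is_RInt_gen_ext (Derive F)).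
  - apply filter_prod_pos_interval_open. intros t Ht. now apply is_derive_unique, HF.
  - apply is_RInt_gen_Derive; auto.
    + apply filter_prod_pos_interval. intros t Ht. exists (f t). auto.
    + apply filter_prod_pos_interval. intros t Ht. apply (continuous_ext_loc _ f).
      generalize (locally_gt 0 t Ht). apply filter_imp. intros y Hy. symmetry. now apply is_derive_unique, HF.
      auto.
Qed.

Lemma is_RInt_gen_0_infty_unique (f : R -> R) (l l' : R) :
  is_RInt_gen f (at_right 0) (Rbar_locally p_infty) l ->
  is_RInt_gen f (at_right 0) (Rbar_locally p_infty) l' -> l = l'.
Proof.
  assert (PF : ProperFilter' (at_right 0)) by apply Proper_StrongProper, at_right_proper_filter.
  assert (PF2 : ProperFilter' (Rbar_locally p_infty)) by apply Proper_StrongProper, Rbar_locally_filter.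
  intros H H'. rewrite <- (is_RInt_gen_unique _ _ H). now apply is_RInt_gen_unique.
Qed.

(** Integration by parts, written as the integral of the derivative of
    t^s e^(-t), which vanishes at both ends. *)
Lemma Gamma_succ (s : R) : 0 < s -> Gamma (s + 1) = s * Gamma s.
Proof.
  intros Hs.
  assert (H1 : is_RInt_gen (fun t => s * Gamma_integrand s t - Gamma_integrand (s + 1) t)
            (at_right 0) (Rbar_locally p_infty) (0 - 0)).
  { apply (is_RInt_gen_0_infty_deriv (fun t => Rpower t s * exp (- t))).
    - intros t Ht. unfold Gamma_integrand, Rpower. auto_derive; auto.
      replace (s + 1 - 1) with s by ring.
      replace (exp (s * ln t)) with (exp ((s - 1) * ln t) * exp (ln t)).
      rewrite exp_ln by auto. field. lra.
      rewrite <- exp_plus. f_equal. ring.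
    - intros t Ht. apply (@continuous_minus R_UniformSpace R_AbsRing R_NormedModule).
      apply (@continuous_scal_r R_UniformSpace R_AbsRing R_NormedModule s). now apply Gamma_integrand_continuous.
      now apply Gamma_integrand_continuous.
    - assert (Hl : filterlim (fun t => exp (s * ln t)) (at_right 0) (locally 0)).
      { apply filterlim_comp with (Rbar_locally m_infty); [|apply (is_lim_exp_m)].
        apply filterlim_comp with (Rbar_locally m_infty); [apply is_lim_ln_0|].
        intros P [M HM]. exists (M / s). intros y Hy. apply HM.
        apply Rmult_lt_reg_r with (/ s). apply Rinv_0_lt_compat; auto.
        unfold Rdiv in Hy. replace (s * y * / s) with y by (field; lra). auto. }
      apply filterlim_locally. intros eps.
      generalize (filter_and _ _ at_right_0_pos (proj1 (filterlim_locally _ _) Hl eps)). apply filter_imp.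
      intros t [Ht1 Ht2]. apply ball_R in Ht2. apply ball_R_intro. revert Ht2. rewrite !Rminus_0_r. unfold Rpower.
      assert (H := exp_pos (s * ln t)). destruct (exp_neg_lt_1 t Ht1).
      rewrite !Rabs_pos_eq by nra. intros; nra.
    - apply filterlim_locally. intros eps.
      set (K := Rpower (s + 1) (s + 1)).
      exists (Rmax 1 (K / eps)). intros t Ht.
      assert (Ht1 : 1 < t) by (eapply Rle_lt_trans; [apply Rmax_l|exact Ht]).
      assert (Ht2 : K / eps < t) by (eapply Rle_lt_trans; [apply Rmax_r|exact Ht]).
      apply ball_R_intro. rewrite Rminus_0_r.
      assert (H0 : 0 < Rpower t s * exp (- t)) by (apply Rmult_lt_0_compat; apply exp_pos).
      rewrite Rabs_pos_eq by lra.
      assert (Hd := exp_dominates_power s t Hs ltac:(lra)). fold K in Hd.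
      assert (Hm : t * (Rpower t s * exp (- t)) <= K).
      { eapply Rle_trans; [|exact Hd]. rewrite <- Rmult_assoc. apply Rmult_le_compat_r. apply Rlt_le, exp_pos.
        rewrite <- (Rpower_1 t) at 1 by lra. rewrite <- Rpower_plus. rewrite Rplus_comm. apply Rle_Rpower_l; lra. }
      destruct eps as [eps Heps]; simpl in *.
      apply Rmult_lt_reg_l with t; [lra|]. eapply Rle_lt_trans; [exact Hm|].
      apply Rmult_lt_reg_r with (/ eps). apply Rinv_0_lt_compat; auto.
      replace (t * eps * / eps) with t by (field; lra). exact Ht2. }
  assert (H2 := is_RInt_gen_minus _ _ _ _ (is_RInt_gen_scal _ s _ (is_RInt_gen_Gamma s Hs))
      (is_RInt_gen_Gamma (s + 1) ltac:(lra))).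
  assert (E : 0 - 0 = s * Gamma s - Gamma (s + 1)) by exact (is_RInt_gen_0_infty_unique _ _ _ H1 H2).
  lra.
Qed.

Lemma Gamma_1 : Gamma 1 = 1.
Proof.
  assert (H1 : is_RInt_gen (Gamma_integrand 1) (at_right 0) (Rbar_locally p_infty) (0 - -1)).
  { apply (is_RInt_gen_ext (fun t => exp (- t))).
    - apply filter_prod_pos_interval_open. intros t Ht. unfold Gamma_integrand.
      rewrite Rminus_diag, Rpower_O by auto. as_R_eq; ring.
    - apply (is_RInt_gen_0_infty_deriv (fun t => - exp (- t))).
      + intros t Ht. auto_derive; auto. ring.
      + intros t Ht. apply (@ex_derive_continuous R_AbsRing R_NormedModule). auto_derive; auto.
      + replace (-1) with (- exp (- 0)) by (rewrite Ropp_0, exp_0; ring).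
        apply (filterlim_filter_le_1 (G := at_right 0) (F := locally 0) (fun t => - exp (- t))); [apply filter_le_within; typeclasses eauto|].
        apply (@ex_derive_continuous R_AbsRing R_NormedModule (fun t => - exp (- t))). auto_derive; auto.
      + replace 0 with (- 0) by ring.
        apply filterlim_comp with (locally 0); [|apply (@filterlim_opp R_AbsRing R_NormedModule 0)].
        apply filterlim_comp with (Rbar_locally m_infty); [|apply is_lim_exp_m].
        apply (filterlim_Rbar_opp p_infty). }
  assert (E : 0 - -1 = Gamma 1) by exact (is_RInt_gen_0_infty_unique _ _ _ H1 (is_RInt_gen_Gamma 1 Rlt_0_1)).
  lra.
Qed.

(** With w = 1 - a + a v, add e^y >= 1 + y at y = ln (v/w) and y = ln (1/w) with
    weights a and 1 - a. *)
Lemma weighted_AM_GM (a v : R) : 0 <= a <= 1 -> 0 < v -> Rpower v a <= 1 - a + a * v.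
Proof.
  intros Ha Hv. set (w := 1 - a + a * v).
  assert (Hw : 0 < w) by (unfold w; destruct (Req_dec a 0) as [->|]; [lra|nra]).
  assert (H1 : 1 + ln (v / w) <= v / w).
  { rewrite <- (exp_ln (v / w)) at 2 by (apply Rdiv_lt_0_compat; auto). apply exp_ineq1_le. }
  assert (H2 : 1 + ln (/ w) <= / w).
  { rewrite <- (exp_ln (/ w)) at 2 by (apply Rinv_0_lt_compat; auto). apply exp_ineq1_le. }
  rewrite ln_div in H1 by auto. rewrite ln_Rinv in H2 by auto.
  assert (H3 : a * (v / w) + (1 - a) * / w = 1) by (unfold w in *; field; lra).
  assert (H4 : a * ln v <= ln w) by nra.
  unfold Rpower. rewrite <- (exp_ln w Hw).
  now apply exp_incr_le.
Qed.

(** A form of log-convexity: integrate (t/s)^a <= 1 - a + a t/s against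
    t^(s-1) e^(-t). The absolute value is what the comparison of integrals
    delivers before Gamma is known to be positive. *)
Lemma Gamma_shift_le (s a : R) : 0 < s -> 0 <= a <= 1 ->
  Rabs (Gamma (s + a)) <= Rpower s a * Gamma s.
Proof.
  intros Hs Ha.
  assert (Hg : is_RInt_gen (fun t => plus (scal (Rpower s a * (1 - a)) (Gamma_integrand s t))
       (scal (Rpower s a * a / s) (Gamma_integrand (s + 1) t)))
     (at_right 0) (Rbar_locally p_infty) (plus (scal (Rpower s a * (1 - a)) (Gamma s))
       (scal (Rpower s a * a / s) (Gamma (s + 1))))).
  { assert (Hs1 : 0 < s + 1) by lra.
    exact (is_RInt_gen_plus _ _ _ _ (is_RInt_gen_scal _ (Rpower s a * (1 - a)) _ (is_RInt_gen_Gamma s Hs))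
      (is_RInt_gen_scal _ (Rpower s a * a / s) _ (is_RInt_gen_Gamma (s + 1) Hs1))). }
  replace (Rpower s a * Gamma s) with (plus (scal (Rpower s a * (1 - a)) (Gamma s))
       (scal (Rpower s a * a / s) (Gamma (s + 1)))).
  2:{ rewrite Gamma_succ by auto. unfold plus, scal; simpl. unfold mult; simpl. field. lra. }
  apply (RInt_gen_norm (Fa := at_right 0) (Fb := Rbar_locally p_infty) (Gamma_integrand (s + a))
     (fun t => plus (scal (Rpower s a * (1 - a)) (Gamma_integrand s t))
       (scal (Rpower s a * a / s) (Gamma_integrand (s + 1) t)))); auto.
  - apply (Filter_prod _ _ _ (fun a => a < 1) (fun b => 1 < b)).
    + exists (mkposreal 1 Rlt_0_1). intros y Hy _.
      apply ball_R in Hy. apply Rabs_def2 in Hy. simpl in Hy. lra.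
    + exists 1; auto.
    + simpl; intros; lra.
  - apply (Filter_prod _ _ _ (fun a => 0 < a) (fun b => 1 < b)).
    + apply at_right_0_pos.
    + exists 1; auto.
    + intros b c Hb Hc t Ht. simpl in Ht. unfold norm; simpl. unfold abs; simpl.
      assert (Ht0 : 0 < t) by lra.
      rewrite Rabs_pos_eq by apply Rlt_le, Gamma_integrand_pos.
      unfold plus, scal; simpl. unfold mult; simpl. unfold Gamma_integrand.
      replace (s + a - 1) with ((s - 1) + a) by ring. replace (s + 1 - 1) with ((s - 1) + 1) by ring.
      rewrite !Rpower_plus, Rpower_1 by auto.
      assert (HA := weighted_AM_GM a (t / s) Ha ltac:(apply Rdiv_lt_0_compat; auto)).
      assert (E : Rpower t a = Rpower s a * Rpower (t / s) a).
      { rewrite Rpower_mult_distr; auto. 2: apply Rdiv_lt_0_compat; auto. f_equal. field. lra. }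
      rewrite E. assert (H1 : 0 < Rpower t (s - 1)) by apply exp_pos. assert (H2 := exp_pos (- t)).
      assert (H3 : 0 < Rpower s a) by apply exp_pos.
      replace (Rpower s a * (1 - a) * (Rpower t (s - 1) * exp (- t)) + Rpower s a * a / s * (Rpower t (s - 1) * t * exp (- t)))
        with ((Rpower t (s - 1) * Rpower s a * exp (- t)) * (1 - a + a * (t / s))) by (field; lra).
      replace (Rpower t (s - 1) * (Rpower s a * Rpower (t / s) a) * exp (- t)) with
        ((Rpower t (s - 1) * Rpower s a * exp (- t)) * Rpower (t / s) a) by ring.
      apply Rmult_le_compat_l; auto. apply Rlt_le. repeat apply Rmult_lt_0_compat; auto.
  - apply is_RInt_gen_Gamma. lra.
Qed.

Lemma Gamma_nat_pos (n : nat) : 0 < Gamma (INR n + 1).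
Proof.
  induction n as [|n IH].
  - simpl. rewrite Rplus_0_l, Gamma_1. lra.
  - rewrite S_INR. assert (Hn := pos_INR n). rewrite Gamma_succ by lra. apply Rmult_lt_0_compat; lra.
Qed.

(** The shift inequality bounds Gamma(s) below by a multiple of a factorial. *)
Lemma Gamma_pos (s : R) : 0 < s -> 0 < Gamma s.
Proof.
  intros Hs.
  destruct (nfloor_ex s (Rlt_le _ _ Hs)) as [n Hn].
  assert (H := Gamma_shift_le s (INR n + 1 - s) Hs ltac:(lra)).
  replace (s + (INR n + 1 - s)) with (INR n + 1) in H by ring.
  assert (Hp := Gamma_nat_pos n). rewrite Rabs_pos_eq in H by lra.
  assert (H3 : 0 < Rpower s (INR n + 1 - s)) by apply exp_pos.
  nra.
Qed.

(** * Gauss's limit and the polygamma functions *)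

Definition ln_Gamma_defect (x : R) (n : nat) : R :=
  ln (Gamma (INR (S n) + x)) - ln (Gamma (INR (S n))) - x * ln (INR (S n)).

Lemma is_lim_ln_ratio (x : R) : 0 <= x -> is_lim_seq (fun n => ln (INR (S n) + x) - ln (INR (S n))) 0.
Proof.
  intros Hx. apply is_lim_seq_ext with (fun n => ln (1 + x * / INR (S n))).
  - intros n. assert (Hn := INR_S_pos n).
    rewrite <- ln_div by lra. f_equal. field. lra.
  - assert (E0 : ln (1 + x * 0) = 0) by (rewrite Rmult_0_r, Rplus_0_r; apply ln_1).
    rewrite <- E0.
    apply (is_lim_seq_continuous (fun y => ln (1 + x * y)) (fun n => / INR (S n)) 0).
    + apply continuity_pt_filterlim. apply (@ex_derive_continuous R_AbsRing R_NormedModule (fun y => ln (1 + x * y))). auto_derive. lra.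
    + exact is_lim_seq_inv_INR_S.
Qed.

(** Gauss's limit in logarithmic form. For 0 <= x <= 1 the defect is squeezed by
    the shift inequality at n with step x and at n + x with step 1 - x; the
    functional equation extends it to larger x. *)
Lemma ln_Gamma_defect_lim (x : R) : 0 <= x -> is_lim_seq (ln_Gamma_defect x) 0.
Proof.
  assert (H : forall k x, 0 <= x <= 1 -> is_lim_seq (ln_Gamma_defect (x + INR k)) 0).
  { induction k as [|k IH]; intros y Hy.
    - simpl. rewrite Rplus_0_r.
      apply is_lim_seq_le_le with (fun n => - ((1 - y) * (ln (INR (S n) + y) - ln (INR (S n))))) (fun _ => 0).
      + intros n. assert (Hn := INR_S_pos n). unfold ln_Gamma_defect.
        assert (G1 := Gamma_pos (INR (S n)) Hn). assert (G2 := Gamma_pos (INR (S n) + y) ltac:(lra)).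
        assert (U := Gamma_shift_le (INR (S n)) y Hn Hy). rewrite Rabs_pos_eq in U by lra.
        assert (V := Gamma_shift_le (INR (S n) + y) (1 - y) ltac:(lra) ltac:(lra)).
        replace (INR (S n) + y + (1 - y)) with (INR (S n) + 1) in V by ring.
        rewrite Gamma_succ in V by auto. rewrite Rabs_pos_eq in V by nra.
        apply ln_le in U; auto. apply ln_le in V; [|nra].
        unfold Rpower in U, V. rewrite ln_mult, ln_exp in U by (auto using exp_pos).
        rewrite !ln_mult, ln_exp in V by (auto using exp_pos). lra.
      + replace (Finite 0) with (Finite (- ((1 - y) * 0))) by (f_equal; ring).
        apply (is_lim_seq_opp _ (Finite ((1 - y) * 0))). apply (is_lim_seq_scal_l _ (1 - y) 0).
        apply is_lim_ln_ratio. lra.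
      + apply is_lim_seq_const.
    - apply is_lim_seq_ext with (fun n => ln_Gamma_defect (y + INR k) n + (ln (INR (S n) + (y + INR k)) - ln (INR (S n)))).
      + intros n. unfold ln_Gamma_defect. assert (Hn := INR_S_pos n).
        assert (Hk := pos_INR k). rewrite (S_INR k).
        replace (INR (S n) + (y + (INR k + 1))) with ((INR (S n) + (y + INR k)) + 1) by ring.
        rewrite (Gamma_succ (INR (S n) + (y + INR k))) by lra. rewrite ln_mult; [ring|lra|]. apply Gamma_pos; lra.
      + replace (Finite 0) with (Finite (0 + 0)) by (f_equal; ring).
        apply is_lim_seq_plus'. now apply IH. apply is_lim_ln_ratio. assert (Hk := pos_INR k). lra. }
  intros Hx. destruct (nfloor_ex x Hx) as [k Hk].
  replace x with ((x - INR k) + INR k) by ring. apply H. lra.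
Qed.

Definition ln_Gamma_term (j : nat) (x : R) : R :=
  x * (ln (INR (S (S j))) - ln (INR (S j))) - (ln (x + INR (S j)) - ln (INR (S j))).

(** The partial sums telescope, by the functional equation, to the left side
    minus the defect in Gauss's limit. *)
Lemma ln_Gamma_series (x : R) : 0 < x ->
  is_series (fun j => ln_Gamma_term j x) (ln (Gamma (x + 1))).
Proof.
  intros Hx.
  assert (E : forall N, sum_n (fun j => ln_Gamma_term j x) N = ln (Gamma (x + 1)) - ln_Gamma_defect x (S N)).
  { induction N as [|N IH].
    - rewrite sum_O. unfold ln_Gamma_term, ln_Gamma_defect. simpl.
      replace (1 + 1 + x) with (x + 1 + 1) by ring.
      rewrite !Gamma_succ, Gamma_1, !ln_mult, ln_1 by (lra || (try apply Rmult_lt_0_compat; try apply Gamma_pos; lra)).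
      ring.
    - rewrite sum_Sn_R, IH. unfold ln_Gamma_term, ln_Gamma_defect.
      assert (Hn := INR_S_pos (S N)).
      rewrite (S_INR (S (S N))).
      replace (INR (S (S N)) + 1 + x) with ((INR (S (S N)) + x) + 1) by ring.
      rewrite (Gamma_succ (INR (S (S N)) + x)), (Gamma_succ (INR (S (S N)))) by lra.
      rewrite !ln_mult; try apply Gamma_pos; try lra.
      replace (x + INR (S (S N))) with (INR (S (S N)) + x) by ring. as_R_eq. ring. }
  change (is_lim_seq (sum_n (fun j => ln_Gamma_term j x)) (ln (Gamma (x + 1)))).
  apply is_lim_seq_ext with (fun N => ln (Gamma (x + 1)) - ln_Gamma_defect x (S N)). intros; now rewrite E.
  replace (Finite (ln (Gamma (x + 1)))) with (Finite (ln (Gamma (x + 1)) - 0)) by (f_equal; ring).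
  apply is_lim_seq_minus'. apply is_lim_seq_const.
  apply (is_lim_seq_incr_1 (ln_Gamma_defect x)). apply ln_Gamma_defect_lim. lra.
Qed.

Definition digamma_term (j : nat) (x : R) : R :=
  (ln (INR (S (S j))) - ln (INR (S j))) - / (x + INR (S j)).

Lemma digamma_term_bound (j : nat) (x X : R) : 0 < x <= X ->
  Rabs (digamma_term j x) <= (X + 1) / (INR j + 1) ^ 2.
Proof.
  intros Hx. unfold digamma_term. rewrite (S_INR (S j)), (S_INR j).
  assert (Hj := pos_INR j). set (i := INR j + 1). assert (Hi : 1 <= i) by (unfold i; lra).
  assert (U : ln (i + 1) - ln i <= / i).
  { rewrite <- ln_div by lra. rewrite <- (ln_exp (/ i)). apply ln_le. apply Rdiv_lt_0_compat; lra.
    eapply Rle_trans; [|apply exp_ineq1_le]. right. field. lra. }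
  assert (V : / (i + 1) <= ln (i + 1) - ln i).
  { assert (ln i - ln (i + 1) <= - / (i + 1)); [|lra].
    rewrite <- ln_div by lra. rewrite <- (ln_exp (- / (i + 1))). apply ln_le. apply Rdiv_lt_0_compat; lra.
    eapply Rle_trans; [|apply exp_ineq1_le]. right. field. lra. }
  assert (A1 : / i - / (x + i) <= (X + 1) / i ^ 2).
  { replace (/ i - / (x + i)) with (x * / (i * (x + i))) by (field; lra).
    apply Rmult_le_compat; try lra. apply Rinv_nonneg; nra.
    apply Rinv_le_contravar; nra. }
  assert (A2 : / (x + i) - / (i + 1) <= (X + 1) / i ^ 2).
  { apply Rle_trans with (/ i - / (i + 1)). apply Rplus_le_compat_r. apply Rinv_le_contravar; lra.
    replace (/ i - / (i + 1)) with (1 * / (i * (i + 1))) by (field; lra).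
    apply Rmult_le_compat; try lra. apply Rinv_nonneg; nra.
    apply Rinv_le_contravar; nra. }
  apply Rabs_le. lra.
Qed.

(** Gamma is the exponential of a series that can be differentiated termwise.
    The series is used for Gamma(y+1), whose terms are small, hence the separate
    term - 1/y. *)
Lemma digamma_eq (y : R) : 0 < y -> digamma y = - / y + Series (fun j => digamma_term j y).
Proof.
  intros Hy. set (l := - / y + Series (fun j => digamma_term j y)).
  assert (Hd : is_derive (fun z => - ln z + Series (fun j => ln_Gamma_term j z)) y l).
  { apply (@is_derive_plus R_AbsRing R_NormedModule). auto_derive; auto; field; lra.
    apply (is_derive_Series ln_Gamma_term digamma_term (fun j => (2 * y + 1) / (INR j + 1) ^ 2) y (y / 2)). lra.
    - apply ex_series_inv_square. lra.
    - intros n z Hz. apply Rabs_def2 in Hz. unfold ln_Gamma_term, digamma_term.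
      assert (Hn := INR_S_pos n).
      revert Hn. generalize (INR (S n)) (INR (S (S n))). intros i i' Hn.
      auto_derive. lra. field. lra.
    - intros n z Hz. apply Rabs_def2 in Hz. apply digamma_term_bound. lra.
    - intros z Hz. apply Rabs_def2 in Hz. exists (ln (Gamma (z + 1))). apply ln_Gamma_series. lra. }
  assert (HG : is_derive Gamma y (l * Gamma y)).
  { assert (E : forall z, 0 < z -> exp (- ln z + Series (fun j => ln_Gamma_term j z)) = Gamma z).
    { intros z Hz. rewrite (is_series_unique _ _ (ln_Gamma_series z Hz)). rewrite Gamma_succ by auto.
      assert (HG := Gamma_pos z Hz).
      rewrite ln_mult by auto. replace (- ln z + (ln z + ln (Gamma z))) with (ln (Gamma z)) by ring. now apply exp_ln. }
    apply is_derive_ext_loc with (fun z => exp (- ln z + Series (fun j => ln_Gamma_term j z))).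
    - generalize (locally_gt 0 y Hy). apply filter_imp; auto.
    - rewrite <- (E y Hy). apply (is_derive_comp exp); auto. apply is_derive_exp. }
  unfold digamma. rewrite (is_derive_unique _ _ _ HG). field.
  apply Rgt_not_eq, Gamma_pos; auto.
Qed.

(** The derivatives of 1/u^2, which is the common term of the series for
    psi'. *)
Definition inv_square_tower (k : nat) (u : R) : R := (-1) ^ k * INR (fact (S k)) / u ^ S (S k).

Lemma inv_square_tower_summable : summable_tower inv_square_tower.
Proof.
  split.
  - intros k u Hu. assert (H := is_derive_inv_pow (S k) u ltac:(lra)).
    apply (is_derive_scal _ u (-1)) in H. unfold inv_square_tower.
    replace ((-1) ^ S k * INR (fact (S (S k))) / u ^ S (S (S k))) with
      (-1 * ((-1) ^ S (S k) * INR (fact (S (S k))) / u ^ S (S (S k)))).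
    2:{ rewrite <- (tech_pow_Rmult (-1) (S k)). unfold Rdiv. ring. }
    revert H. apply is_derive_ext. intros t. rewrite <- (tech_pow_Rmult (-1) k). unfold Rdiv. as_R_eq. ring.
  - intros k a Ha. exists (INR (fact (S k)) / a ^ k). intros u Hu. unfold inv_square_tower, Rdiv.
    rewrite !Rabs_mult, pow_1_abs, Rmult_1_l.
    assert (Hf := INR_fact_lt_0 (S k)). assert (Ha0 : 0 < a ^ k) by (apply pow_lt; auto).
    assert (Hu2 : 0 < u ^ 2) by (apply pow_lt; lra).
    assert (Huk : a ^ k <= u ^ k) by (apply pow_incr; lra).
    rewrite (Rabs_pos_eq (INR _)) by lra.
    rewrite Rabs_pos_eq by (apply Rinv_nonneg, pow_lt; lra).
    rewrite Rmult_assoc. apply Rmult_le_compat_l; [lra|].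
    rewrite <- Rinv_mult. apply Rinv_le_contravar. apply Rmult_lt_0_compat; auto.
    replace (u ^ S (S k)) with (u ^ k * u ^ 2) by (simpl; ring). apply Rmult_le_compat_r; lra.
Qed.

Lemma is_derive_digamma (y : R) : 0 < y ->
  is_derive digamma y (Series (fun n => inv_square_tower 0 (INR n + y))).
Proof.
  intros Hy.
  assert (Hs := tower_ex_series _ 0 y inv_square_tower_summable Hy).
  rewrite (Series_incr_1 _ Hs).
  apply is_derive_ext_loc with (fun y => - / y + Series (fun j => digamma_term j y)).
  { generalize (locally_gt 0 y Hy). apply filter_imp. intros; symmetry; now apply digamma_eq. }
  apply (@is_derive_plus R_AbsRing R_NormedModule).
  - unfold inv_square_tower. simpl. auto_derive; [lra|]. field. lra.
  - apply (is_derive_Series digamma_term (fun n y => inv_square_tower 0 (INR (S n) + y)) (fun j => 1 / (INR j + 1) ^ 2) y (y / 2)). lra.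
    + apply ex_series_inv_square. lra.
    + intros n z Hz. apply Rabs_def2 in Hz. assert (Hn := INR_S_pos n).
      unfold digamma_term, inv_square_tower. revert Hn. generalize (INR (S n)) (INR (S (S n))). intros i i' Hn.
      auto_derive. lra. simpl. field. lra.
    + intros n z Hz. apply Rabs_def2 in Hz. unfold inv_square_tower. rewrite S_INR. assert (Hn := pos_INR n).
      simpl fact. simpl (INR 1). rewrite pow_O, Rmult_1_l.
      rewrite Rabs_pos_eq by (apply Rlt_le, Rdiv_lt_0_compat; [lra|apply pow_lt; lra]).
      apply Rmult_le_compat_l; [lra|]. apply Rinv_le_contravar. apply pow_lt; lra. apply pow_incr; lra.
    + intros z Hz. apply Rabs_def2 in Hz.
      apply ex_series_Rabs_le with (fun j => (z + 1) / (INR j + 1) ^ 2). intros n; apply digamma_term_bound; lra.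
      apply ex_series_inv_square; lra.
Qed.

Lemma polygamma_series (m : nat) (x : R) : 0 < x ->
  polygamma (S m) x = Series (fun n => inv_square_tower m (INR n + x)).
Proof.
  intros Hx. unfold polygamma. rewrite Derive_n_S. destruct m as [|m].
  - simpl. now apply is_derive_unique, is_derive_digamma.
  - apply (tower_Derive_n inv_square_tower (Derive digamma) 0 m x inv_square_tower_summable); auto.
    intros y Hy. rewrite Rplus_0_l. now apply is_derive_unique, is_derive_digamma.
Qed.

(** * Complex series *)

(** Convergence of a complex series, componentwise, so that the results on
    real series apply directly. *)
Definition is_Cseries (a : nat -> C) (l : C) : Prop :=
  is_series (fun n => Re (a n)) (Re l) /\ is_series (fun n => Im (a n)) (Im l).

Definition Cseries (a : nat -> C) : C :=
  (Series (fun n => Re (a n)), Series (fun n => Im (a n))).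

Lemma C_eq (z w : C) : Re z = Re w -> Im z = Im w -> z = w.
Proof. destruct z, w; simpl; intros; subst; auto. Qed.

Lemma C_sum_n_Re (a : nat -> C) (N : nat) :
  Re (@sum_n C_AbelianMonoid a N) = sum_n (fun n => Re (a n)) N.
Proof.
  induction N as [|N IH]. now rewrite !sum_O. rewrite !sum_Sn, <- IH. reflexivity.
Qed.

Lemma C_sum_n_Im (a : nat -> C) (N : nat) :
  Im (@sum_n C_AbelianMonoid a N) = sum_n (fun n => Im (a n)) N.
Proof.
  induction N as [|N IH]. now rewrite !sum_O. rewrite !sum_Sn, <- IH. reflexivity.
Qed.

Lemma is_Cseries_is_series (a : nat -> C) (l : C) :
  is_Cseries a l <-> @is_series C_AbsRing C_NormedModule a l.
Proof.
  split.
  - intros [H1 H2]. unfold is_series in *. apply filterlim_locally. intros eps.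
    generalize (filter_and _ _ (proj1 (filterlim_locally _ _) H1 eps) (proj1 (filterlim_locally _ _) H2 eps)).
    apply filter_imp. intros N [B1 B2]. split.
    + change (ball (Re l) eps (Re (@sum_n C_AbelianMonoid a N))). now rewrite C_sum_n_Re.
    + change (ball (Im l) eps (Im (@sum_n C_AbelianMonoid a N))). now rewrite C_sum_n_Im.
  - intros H. unfold is_series in H.
    split; apply filterlim_locally; intros eps;
    generalize (proj1 (filterlim_locally _ _) H eps); apply filter_imp; intros N [B1 B2].
    + rewrite <- C_sum_n_Re. exact B1.
    + rewrite <- C_sum_n_Im. exact B2.
Qed.

Lemma is_Cseries_unique (a : nat -> C) (l : C) : is_Cseries a l -> Cseries a = l.
Proof.
  intros [H1 H2]. apply C_eq; simpl; now apply is_series_unique.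
Qed.

Lemma is_Cseries_ext (a b : nat -> C) (l : C) : (forall n, a n = b n) -> is_Cseries a l -> is_Cseries b l.
Proof.
  intros H [H1 H2]. split; [revert H1|revert H2]; apply is_series_ext; intros n; now rewrite H.
Qed.

Lemma Cseries_ext (a b : nat -> C) : (forall n, a n = b n) -> Cseries a = Cseries b.
Proof. intros H. apply C_eq; simpl; apply Series_ext; intros; now rewrite H. Qed.

Lemma is_Cseries_plus (a b : nat -> C) (la lb : C) :
  is_Cseries a la -> is_Cseries b lb -> is_Cseries (fun n => a n + b n)%C (la + lb)%C.
Proof.
  intros [H1 H2] [H3 H4]. split.
  - apply (is_series_plus _ _ _ _ H1 H3).
  - apply (is_series_plus _ _ _ _ H2 H4).
Qed.

Lemma is_series_Rmult_l (c : R) (a : nat -> R) (l : R) : is_series a l -> is_series (fun n => c * a n) (c * l).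
Proof. intros H. exact (is_series_scal c a l H). Qed.

Lemma is_Cseries_scal (c : C) (a : nat -> C) (l : C) :
  is_Cseries a l -> is_Cseries (fun n => c * a n)%C (c * l)%C.
Proof.
  intros [H1 H2]. split; simpl.
  - apply (is_series_minus _ _ _ _ (is_series_Rmult_l (Re c) _ _ H1) (is_series_Rmult_l (Im c) _ _ H2)).
  - apply (is_series_plus _ _ _ _ (is_series_Rmult_l (Re c) _ _ H2) (is_series_Rmult_l (Im c) _ _ H1)).
Qed.

Lemma is_series_shift (a : nat -> R) (l : R) : is_series (fun n => a (S n)) l <-> is_series a (a 0%nat + l).
Proof.
  split; intros H.
  - apply is_series_decr_1. change (is_series (fun n => a (S n)) (a 0%nat + l + - a 0%nat)).
    now replace (a 0%nat + l + - a 0%nat) with l by ring.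
  - apply is_series_incr_1. change (is_series a (l + a 0%nat)). now rewrite Rplus_comm.
Qed.

Lemma is_Cseries_incr_1 (a : nat -> C) (l : C) :
  is_Cseries (fun n => a (S n)) l -> is_Cseries a (a 0%nat + l)%C.
Proof.
  intros [H1 H2]. split.
  - now apply (is_series_shift (fun n => Re (a n))).
  - now apply (is_series_shift (fun n => Im (a n))).
Qed.

Lemma is_Cseries_decr_1 (a : nat -> C) (l : C) :
  is_Cseries a l -> is_Cseries (fun n => a (S n)) (l - a 0%nat)%C.
Proof.
  intros [H1 H2]. split.
  - apply (is_series_shift (fun n => Re (a n))).
    change (Re (l - a 0%nat)%C) with (Re l + - Re (a 0%nat)).
    now replace (Re (a 0%nat) + (Re l + - Re (a 0%nat))) with (Re l) by ring.
  - apply (is_series_shift (fun n => Im (a n))).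
    change (Im (l - a 0%nat)%C) with (Im l + - Im (a 0%nat)).
    now replace (Im (a 0%nat) + (Im l + - Im (a 0%nat))) with (Im l) by ring.
Qed.

Lemma Im_le_Cmod (c : C) : Rabs (Im c) <= Cmod c.
Proof.
  eapply Rle_trans; [apply Rmax_r|]. apply (Rmax_Cmod c).
Qed.

Lemma Cmod_le_Re_Im (c : C) : Cmod c <= Rabs (Re c) + Rabs (Im c).
Proof.
  replace c with (RtoC (Re c) + RtoC (Im c) * Ci)%C at 1.
  - eapply Rle_trans; [apply Cmod_triangle|]. rewrite Cmod_mult, !Cmod_R.
    replace (Cmod Ci) with 1. lra. unfold Cmod, Ci; simpl. rewrite <- sqrt_1 at 1. f_equal. ring.
  - apply C_eq; simpl; ring.
Qed.

Lemma ex_Cseries_Cmod (a : nat -> C) (b : nat -> R) :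
  (forall n, Cmod (a n) <= b n) -> ex_series b -> is_Cseries a (Cseries a).
Proof.
  intros H Hb. split; simpl; apply Series_correct; apply ex_series_Rabs_le with b; auto; intros n.
  eapply Rle_trans; [apply re_le_Cmod|apply H]. eapply Rle_trans; [apply Im_le_Cmod|apply H].
Qed.

Lemma Cmod_sum_n_le (a : nat -> C) (N : nat) :
  Cmod (@sum_n C_AbelianMonoid a N) <= sum_n (fun n => Cmod (a n)) N.
Proof.
  induction N as [|N IH]. rewrite !sum_O; lra. rewrite sum_Sn, sum_Sn_R.
  eapply Rle_trans; [apply Cmod_triangle|]. lra.
Qed.

Lemma Cmod_is_Cseries_le (a : nat -> C) (l : C) (M : R) :
  is_Cseries a l -> (forall N, sum_n (fun n => Cmod (a n)) N <= M) -> Cmod l <= M.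
Proof.
  intros H HM.
  assert (Hl : is_lim_seq (fun N => Cmod (@sum_n C_AbelianMonoid a N)) (Cmod l)).
  { destruct H as [H1 H2].
    apply is_lim_seq_ext with (fun N => sqrt (sum_n (fun n => Re (a n)) N ^ 2 + sum_n (fun n => Im (a n)) N ^ 2)).
    { intros N. unfold Cmod. now rewrite <- C_sum_n_Re, <- C_sum_n_Im. }
    unfold Cmod. apply (is_lim_seq_continuous sqrt).
    - apply continuity_pt_filterlim, continuous_sqrt.
    - assert (Hp : forall u (v : R), is_lim_seq u v -> is_lim_seq (fun n => u n ^ 2) (v ^ 2)).
      { intros u v Hu. apply is_lim_seq_ext with (fun n => u n * u n). intros; ring.
        replace (v ^ 2) with (v * v) by ring. now apply is_lim_seq_mult'. }
      apply is_lim_seq_plus'; apply Hp; assumption. }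
  exact (is_lim_seq_le _ (fun _ => M) (Cmod l) M
    (fun N => Rle_trans _ _ _ (Cmod_sum_n_le a N) (HM N)) Hl (is_lim_seq_const M)).
Qed.

Lemma sum_n_le_R (a b : nat -> R) (N : nat) : (forall n, (n <= N)%nat -> a n <= b n) -> sum_n a N <= sum_n b N.
Proof.
  induction N as [|N IH]; intros H. rewrite !sum_O; auto. rewrite !sum_Sn_R.
  assert (H1 := H (S N) (le_n _)). assert (H2 : sum_n a N <= sum_n b N) by auto. lra.
Qed.

(** The theorem on real double series, applied to real and imaginary parts. *)
Lemma is_Cseries_swap (u : nat -> nat -> C) (B : nat -> R) (G c : nat -> C) :
  ex_series B ->
  (forall i K, sum_n (fun k => Cmod (u i k)) K <= B i) ->
  (forall i, is_Cseries (u i) (G i)) ->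
  (forall k, is_Cseries (fun i => u i k) (c k)) ->
  is_Cseries c (Cseries G).
Proof.
  intros HB Hu HG Hc.
  assert (Hproj : forall proj : C -> R, (forall z, Rabs (proj z) <= Cmod z) ->
    (forall i, is_series (fun k => proj (u i k)) (proj (G i))) ->
    (forall k, is_series (fun i => proj (u i k)) (proj (c k))) ->
    is_series (fun k => proj (c k)) (Series (fun i => proj (G i)))).
  { intros proj Hp HGp Hcp.
    rewrite (Series_ext _ (fun i => Series (fun k => proj (u i k)))).
    2:{ intros i. symmetry. now apply is_series_unique. }
    eapply is_series_ext; [|apply (Series_swap (fun i k => proj (u i k)) B HB)].
    - intros k. now apply is_series_unique.
    - intros i K. eapply Rle_trans; [|apply Hu]. now apply sum_n_le_R. }
  split; apply Hproj; auto using re_le_Cmod, Im_le_Cmod; intros; (apply HG || apply Hc).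
Qed.

(** * Power series with a weighted l^1 bound *)

(** Analyticity near s0 in quantitative form: g is the sum on the closed disc
    of radius rho of a power series whose coefficients have weighted l^1 norm at
    most B. Such bounds add up, so locally uniform sums of analytic functions are
    analytic by mere rearrangement of double series. *)
Definition majorized (g : C -> C) (s0 : C) (rho B : R) : Prop :=
  exists a : nat -> C,
    (forall N, sum_n (fun k => Cmod (a k) * rho ^ k) N <= B) /\
    forall z : C, Cmod z <= rho -> is_Cseries (fun k => a k * z ^ k)%C (g (s0 + z)%C).

Lemma majorized_ext (f g : C -> C) (s0 : C) (rho B : R) :
  (forall z, Cmod z <= rho -> f (s0 + z)%C = g (s0 + z)%C) ->
  majorized f s0 rho B -> majorized g s0 rho B.
Proof.
  intros H [a [Ha1 Ha2]]. exists a. split; auto. intros z Hz. rewrite <- H; auto.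
Qed.

Lemma majorized_translate (g : C -> C) (w s0 : C) (rho B : R) :
  majorized g (s0 + w)%C rho B -> majorized (fun s => g (s + w)%C) s0 rho B.
Proof.
  intros [a [Ha1 Ha2]]. exists a. split; auto. intros z Hz.
  replace (s0 + z + w)%C with (s0 + w + z)%C by ring. auto.
Qed.

Lemma majorized_scal (c : C) (g : C -> C) (s0 : C) (rho B : R) :
  majorized g s0 rho B -> majorized (fun s => c * g s)%C s0 rho (Cmod c * B).
Proof.
  intros [a [Ha1 Ha2]]. exists (fun k => c * a k)%C. split.
  - intros N. rewrite (sum_n_ext_R _ (fun k => Cmod c * (Cmod (a k) * rho ^ k))).
    2:{ intros; rewrite Cmod_mult; ring. }
    rewrite sum_n_scal_l. apply Rmult_le_compat_l; auto. apply Cmod_ge_0.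
  - intros z Hz. eapply is_Cseries_ext; [|apply (is_Cseries_scal c _ _ (Ha2 z Hz))].
    intros; simpl; ring.
Qed.

Lemma majorized_plus (f g : C -> C) (s0 : C) (rho B1 B2 : R) : 0 <= rho ->
  majorized f s0 rho B1 -> majorized g s0 rho B2 -> majorized (fun s => f s + g s)%C s0 rho (B1 + B2).
Proof.
  intros Hr [a [Ha1 Ha2]] [b [Hb1 Hb2]].
  exists (fun k => a k + b k)%C. split.
  - intros N. eapply Rle_trans; [apply (sum_n_le_R _ (fun k => Cmod (a k) * rho ^ k + Cmod (b k) * rho ^ k))|].
    2:{ rewrite sum_n_plus_R. apply Rplus_le_compat; auto. }
    intros k Hk. rewrite <- Rmult_plus_distr_r. apply Rmult_le_compat_r.
    now apply pow_le. apply Cmod_triangle.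
  - intros z Hz. eapply is_Cseries_ext; [|apply (is_Cseries_plus _ _ _ _ (Ha2 z Hz) (Hb2 z Hz))].
    intros; simpl; ring.
Qed.

Lemma majorized_affine (c : C) (g : C -> C) (s0 : C) (rho B : R) : 0 <= rho ->
  majorized g s0 rho B -> majorized (fun s => (s + c) * g s)%C s0 rho ((Cmod (s0 + c) + rho) * B).
Proof.
  intros Hr [a [Ha1 Ha2]].
  set (d := (s0 + c)%C).
  exists (fun k => d * a k + match k with O => 0 | S k => a k end)%C. split.
  - assert (Hsh : forall N, sum_n (fun k => Cmod (match k with O => 0 | S k => a k end)%C * rho ^ k) N <= rho * B).
    { assert (HB : 0 <= B).
      { specialize (Ha1 0%nat). rewrite sum_O in Ha1. simpl in Ha1. assert (H := Cmod_ge_0 (a 0%nat)). lra. }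
      intros [|N]. rewrite sum_O, Cmod_0. nra.
      rewrite sum_n_incr_1, Cmod_0, Rmult_0_l, Rplus_0_l.
      rewrite (sum_n_ext_R _ (fun k => rho * (Cmod (a k) * rho ^ k))) by (intros; simpl; ring).
      rewrite sum_n_scal_l. apply Rmult_le_compat_l; auto. }
    intros N. eapply Rle_trans.
    + apply (sum_n_le_R _ (fun k => Cmod d * (Cmod (a k) * rho ^ k) + Cmod (match k with O => 0 | S k => a k end)%C * rho ^ k)).
      intros k _. rewrite <- Rmult_assoc, <- Rmult_plus_distr_r. apply Rmult_le_compat_r. now apply pow_le.
      rewrite <- Cmod_mult. apply Cmod_triangle.
    + rewrite sum_n_plus_R, sum_n_scal_l. rewrite Rmult_plus_distr_r. apply Rplus_le_compat; auto.
      apply Rmult_le_compat_l; auto. apply Cmod_ge_0.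
  - intros z Hz.
    assert (H1 := is_Cseries_scal d _ _ (Ha2 z Hz)).
    assert (H2 : is_Cseries (fun k => match k with O => 0 | S k => a k end * z ^ k)%C (z * g (s0 + z))%C).
    { replace (z * g (s0 + z))%C with (0 * z ^ 0 + z * g (s0 + z))%C by ring.
      apply (is_Cseries_incr_1 (fun k => match k with O => 0 | S k => a k end * z ^ k)%C).
      eapply is_Cseries_ext; [|apply (is_Cseries_scal z _ _ (Ha2 z Hz))]. intros n; simpl. ring. }
    replace ((s0 + z + c) * g (s0 + z))%C with (d * g (s0 + z) + z * g (s0 + z))%C by (unfold d; ring).
    eapply is_Cseries_ext; [|apply (is_Cseries_plus _ _ _ _ H1 H2)].
    intros n; simpl; ring.
Qed.

(** Rearrange the double series: the power series coefficients of the sum are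
    the sums of the coefficients. *)
Lemma majorized_series (g : nat -> C -> C) (s0 : C) (rho : R) (B : nat -> R) :
  0 < rho -> ex_series B -> (forall i, majorized (g i) s0 rho (B i)) ->
  majorized (fun s => Cseries (fun i => g i s)) s0 rho (Series B).
Proof.
  intros Hr HB Hg.
  set (a := fun i => proj1_sig (constructive_indefinite_description _ (Hg i))).
  assert (Ha : forall i, (forall N, sum_n (fun k => Cmod (a i k) * rho ^ k) N <= B i) /\
    forall z : C, Cmod z <= rho -> is_Cseries (fun k => a i k * z ^ k)%C (g i (s0 + z)%C)).
  { intros i. unfold a. destruct constructive_indefinite_description as [b Hb]. exact Hb. }
  assert (Hbd : forall z, Cmod z <= rho -> forall i K, sum_n (fun k => Cmod (a i k * z ^ k)%C) K <= B i).
  { intros z Hz i K. eapply Rle_trans; [|apply (proj1 (Ha i) K)]. apply sum_n_le_R. intros k _.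
    rewrite Cmod_mult, Cmod_pow. apply Rmult_le_compat_l. apply Cmod_ge_0. apply pow_incr. split; auto. apply Cmod_ge_0. }
  assert (Hrc : Cmod (RtoC rho) <= rho) by (rewrite Cmod_R, Rabs_pos_eq; lra).
  assert (Hcol : forall k, is_Cseries (fun i => a i k) (Cseries (fun i => a i k))).
  { intros k. assert (Hrk : 0 < rho ^ k) by (apply pow_lt; auto).
    apply ex_Cseries_Cmod with (fun i => / rho ^ k * B i).
    - intros i. assert (H := Hbd (RtoC rho) Hrc i k).
      assert (H2 := sum_n_term_le (fun k => Cmod (a i k * RtoC rho ^ k)%C) k k (fun n => Cmod_ge_0 _) (le_n _)).
      simpl in H2. rewrite Cmod_mult, Cmod_pow, Cmod_R, (Rabs_pos_eq rho) in H2 by lra.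
      apply Rmult_le_reg_r with (rho ^ k); auto.
      replace (/ rho ^ k * B i * rho ^ k) with (B i) by (field; lra). lra.
    - apply (ex_series_Rmult_l (/ rho ^ k)). auto. }
  exists (fun k => Cseries (fun i => a i k)). split.
  - intros N.
    assert (Hcm : forall i k, Cmod (a i k) * rho ^ k <= B i).
    { intros i k. eapply Rle_trans; [|apply (proj1 (Ha i) k)].
      apply (sum_n_term_le (fun k => Cmod (a i k) * rho ^ k) k k); auto.
      intros; apply Rmult_le_pos. apply Cmod_ge_0. apply pow_le; lra. }
    assert (Hex : forall k, ex_series (fun i => Cmod (a i k) * rho ^ k)).
    { intros k. apply ex_series_Rabs_le with B; auto. intros i. rewrite Rabs_pos_eq; auto.
      apply Rmult_le_pos. apply Cmod_ge_0. apply pow_le; lra. }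
    apply Rle_trans with (sum_n (fun k => Series (fun i => Cmod (a i k) * rho ^ k)) N).
    + apply sum_n_le_R. intros k _. assert (Hrk : 0 < rho ^ k) by (apply pow_lt; auto).
      rewrite Series_scal_r. apply Rmult_le_compat_r; [lra|].
      apply Cmod_is_Cseries_le with (1 := Hcol k). intros M. apply sum_n_le_Series. intros; apply Cmod_ge_0.
      apply ex_series_ext with (fun i => / rho ^ k * (Cmod (a i k) * rho ^ k)). intros; as_R_eq; field; lra.
      apply (ex_series_Rmult_l (/ rho ^ k)). auto.
    + rewrite <- (proj1 (Series_sum_n (fun i k => Cmod (a i k) * rho ^ k) N Hex)).
      apply Series_le; auto. intros i. split; [|apply Ha].
      eapply Rle_trans; [|apply (sum_n_term_le (fun k => Cmod (a i k) * rho ^ k) 0 N); [|lia]];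
      intros; apply Rmult_le_pos; (apply Cmod_ge_0 || (apply pow_le; lra)).
  - intros z Hz.
    apply (is_Cseries_swap (fun i k => a i k * z ^ k)%C B (fun i => g i (s0 + z)%C)
       (fun k => Cseries (fun i => a i k) * z ^ k)%C HB (Hbd z Hz)).
    + intros i. now apply Ha.
    + intros k. replace (Cseries (fun i => a i k) * z ^ k)%C with (z ^ k * Cseries (fun i => a i k))%C by ring.
      eapply is_Cseries_ext; [|apply (is_Cseries_scal (z ^ k)%C _ _ (Hcol k))]. intros; simpl; ring.
Qed.

Lemma pow_n_Cpow (z : C) (k : nat) : @pow_n C_Ring z k = (z ^ k)%C.
Proof. induction k as [|k IH]; simpl; auto. Qed.

Lemma is_pseries_is_Cseries (a : nat -> C) (z l : C) :
  @is_pseries C_AbsRing C_NormedModule a z l <-> is_Cseries (fun k => a k * z ^ k)%C l.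
Proof.
  rewrite is_Cseries_is_series. unfold is_pseries.
  assert (E : forall k, @scal C_AbsRing C_NormedModule (@pow_n C_AbsRing z k) (a k) = (a k * z ^ k)%C).
  { intros k. transitivity (@pow_n C_Ring z k * a k)%C; [reflexivity|]. rewrite pow_n_Cpow. apply Cmult_comm. }
  split; intros H; (eapply is_series_ext; [|exact H]); intros k; simpl.
  - apply E.
  - symmetry; apply E.
Qed.

(** * The complex exponential *)

Lemma Re_Cmult (z w : C) : Re (z * w)%C = Re z * Re w - Im z * Im w.
Proof. reflexivity. Qed.

Lemma Im_Cmult (z w : C) : Im (z * w)%C = Re z * Im w + Im z * Re w.
Proof. reflexivity. Qed.

Lemma Re_Cminus (z w : C) : Re (z - w)%C = Re z - Re w.
Proof. reflexivity. Qed.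

Lemma Im_Cminus (z w : C) : Im (z - w)%C = Im z - Im w.
Proof. reflexivity. Qed.

Lemma Re_RtoC (x : R) : Re (RtoC x) = x.
Proof. reflexivity. Qed.

Definition cexp (z : C) : C := (exp (Re z) * cos (Im z), exp (Re z) * sin (Im z)).

Lemma cexp_plus (z w : C) : cexp (z + w)%C = (cexp z * cexp w)%C.
Proof.
  destruct z as [a b], w as [c d]. apply C_eq; unfold cexp; simpl; rewrite exp_plus.
  - rewrite cos_plus. ring.
  - rewrite sin_plus. ring.
Qed.

Lemma Cmod_cexp (z : C) : Cmod (cexp z) = exp (Re z).
Proof.
  unfold Cmod, cexp; simpl fst; simpl snd.
  replace ((exp (Re z) * cos (Im z)) ^ 2 + (exp (Re z) * sin (Im z)) ^ 2)
    with (exp (Re z) ^ 2 * (Rsqr (sin (Im z)) + Rsqr (cos (Im z)))) by (unfold Rsqr; ring).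
  rewrite sin2_cos2, Rmult_1_r. apply sqrt_pow2. apply Rlt_le, exp_pos.
Qed.

Lemma const_of_derive_0 (f : R -> R) (T : R) : 0 <= T ->
  (forall t, 0 <= t <= T -> is_derive f t 0) -> f T = f 0.
Proof.
  intros HT H. destruct (Req_dec T 0) as [->|HT0]; auto.
  destruct (MVT_gen f 0 T (fun _ => 0)) as [c [_ Hc]].
  - intros t Ht. rewrite Rmin_left, Rmax_right in Ht by lra. apply H; lra.
  - intros t Ht. rewrite Rmin_left, Rmax_right in Ht by lra.
    apply continuity_pt_filterlim. apply (@ex_derive_continuous R_AbsRing R_NormedModule). exists 0. apply H; lra.
  - lra.
Qed.

(** The complex equation y' = w y with w = a + i b and y(0) = 1 along the real
    axis: y e^(-wt) is constant. *)
Lemma linear_ode (a b : R) (yr yi : R -> R) (T : R) : 0 <= T ->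
  (forall t, 0 <= t <= T -> is_derive yr t (a * yr t - b * yi t)) ->
  (forall t, 0 <= t <= T -> is_derive yi t (a * yi t + b * yr t)) ->
  yr 0 = 1 -> yi 0 = 0 ->
  yr T = exp (a * T) * cos (b * T) /\ yi T = exp (a * T) * sin (b * T).
Proof.
  intros HT Hr Hi Hr0 Hi0.
  set (P := fun t => exp (- a * t) * (yr t * cos (b * t) + yi t * sin (b * t))).
  set (Q := fun t => exp (- a * t) * (yi t * cos (b * t) - yr t * sin (b * t))).
  assert (HP : P T = P 0).
  { apply const_of_derive_0; auto. intros t Ht. specialize (Hr t Ht). specialize (Hi t Ht).
    unfold P. auto_derive. split; [eexists; exact Hr|]. split; [eexists; exact Hi|auto].
    replace (Derive (fun x => yr x) t) with (a * yr t - b * yi t) by (symmetry; now apply is_derive_unique).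
    replace (Derive (fun x => yi x) t) with (a * yi t + b * yr t) by (symmetry; now apply is_derive_unique).
    ring. }
  assert (HQ : Q T = Q 0).
  { apply const_of_derive_0; auto. intros t Ht. specialize (Hr t Ht). specialize (Hi t Ht).
    unfold Q. auto_derive. split; [eexists; exact Hi|]. split; [eexists; exact Hr|auto].
    replace (Derive (fun x => yr x) t) with (a * yr t - b * yi t) by (symmetry; now apply is_derive_unique).
    replace (Derive (fun x => yi x) t) with (a * yi t + b * yr t) by (symmetry; now apply is_derive_unique).
    ring. }
  unfold P in HP. unfold Q in HQ. rewrite Hr0, Hi0, !Rmult_0_r, exp_0, cos_0, sin_0 in HP, HQ.
  assert (He : exp (a * T) * exp (- a * T) = 1) by (rewrite <- exp_plus, <- exp_0; f_equal; ring).
  assert (Hcs : Rsqr (sin (b * T)) + Rsqr (cos (b * T)) = 1) by apply sin2_cos2. unfold Rsqr in Hcs.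
  set (e := exp (a * T)) in *. set (e' := exp (- a * T)) in *.
  set (c := cos (b * T)) in *. set (s := sin (b * T)) in *.
  assert (P1 : yr T * c + yi T * s = e).
  { transitivity ((e * e') * (yr T * c + yi T * s)). rewrite He; ring. transitivity (e * (e' * (yr T * c + yi T * s))). ring. rewrite HP. ring. }
  assert (Q1 : yi T * c - yr T * s = 0).
  { transitivity ((e * e') * (yi T * c - yr T * s)). rewrite He; ring. transitivity (e * (e' * (yi T * c - yr T * s))). ring. rewrite HQ. ring. }
  split.
  - transitivity (yr T * (s * s + c * c)). rewrite Hcs; ring.
    transitivity ((yr T * c + yi T * s) * c - (yi T * c - yr T * s) * s). ring. rewrite P1, Q1. ring.
  - transitivity (yi T * (s * s + c * c)). rewrite Hcs; ring.
    transitivity ((yr T * c + yi T * s) * s + (yi T * c - yr T * s) * c). ring. rewrite P1, Q1. ring.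
Qed.

Lemma CV_radius_gt (a : nat -> R) (rho x : R) : 0 < rho ->
  ex_series (fun n => Rabs (a n) * rho ^ n) -> Rabs x < rho -> Rbar_lt (Rabs x) (CV_radius a).
Proof.
  intros Hr Hs Hx. apply Rbar_lt_le_trans with rho; [exact Hx|].
  apply Rbar_not_lt_le. intros Hlt. rewrite <- (Rabs_pos_eq rho) in Hlt by lra.
  apply (CV_disk_outside a rho Hlt). apply ex_series_lim_0. apply ex_series_Rabs.
  eapply ex_series_ext; [|exact Hs]. intros n. simpl. rewrite Rabs_mult. f_equal. symmetry. apply Rabs_pos_eq.
  apply pow_le; lra.
Qed.

Lemma ex_series_exp (A : R) : ex_series (fun n => A ^ n / INR (fact n)).
Proof.
  assert (H := is_exp_Reals A). apply is_pseries_R in H.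
  exists (exp A). eapply is_series_ext; [|exact H]. intros n; simpl. unfold Rdiv. apply Rmult_comm.
Qed.

Definition PSeries_Re (c : nat -> C) : R -> R := PSeries (fun n => Re (c n)).
Definition PSeries_Im (c : nat -> C) : R -> R := PSeries (fun n => Im (c n)).

Lemma is_Cseries_PSeries (c : nat -> C) (rho x : R) : 0 < rho ->
  ex_series (fun n => Cmod (c n) * rho ^ n) -> 0 <= x <= rho ->
  is_Cseries (fun n => c n * RtoC x ^ n)%C (PSeries_Re c x, PSeries_Im c x).
Proof.
  intros Hr Hs Hx.
  assert (H : is_Cseries (fun n => c n * RtoC x ^ n)%C (Cseries (fun n => c n * RtoC x ^ n)%C)).
  { apply ex_Cseries_Cmod with (fun n => Cmod (c n) * rho ^ n); auto. intros n.
    rewrite Cmod_mult, Cmod_pow, Cmod_R, Rabs_pos_eq by lra. apply Rmult_le_compat_l. apply Cmod_ge_0. apply pow_incr; lra. }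
  replace (PSeries_Re c x, PSeries_Im c x) with (Cseries (fun n => c n * RtoC x ^ n)%C); auto.
  unfold Cseries, PSeries_Re, PSeries_Im, PSeries. f_equal; apply Series_ext; intros n; rewrite <- RtoC_pow.
  apply re_scal_r. apply im_scal_r.
Qed.

Lemma PSeries_at_0 (a : nat -> R) : PSeries a 0 = a 0%nat.
Proof. apply PSeries_0. Qed.

Lemma ex_series_Re (c : nat -> C) (rho : R) : 0 < rho -> ex_series (fun n => Cmod (c n) * rho ^ n) ->
  ex_series (fun n => Rabs (Re (c n)) * rho ^ n).
Proof.
  intros Hr Hs. apply ex_series_Rabs_le with (2 := Hs). intros n.
  rewrite Rabs_pos_eq. apply Rmult_le_compat_r. apply pow_le; lra. apply re_le_Cmod.
  apply Rmult_le_pos. apply Rabs_pos. apply pow_le; lra.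
Qed.

Lemma ex_series_Im (c : nat -> C) (rho : R) : 0 < rho -> ex_series (fun n => Cmod (c n) * rho ^ n) ->
  ex_series (fun n => Rabs (Im (c n)) * rho ^ n).
Proof.
  intros Hr Hs. apply ex_series_Rabs_le with (2 := Hs). intros n.
  rewrite Rabs_pos_eq. apply Rmult_le_compat_r. apply pow_le; lra. apply Im_le_Cmod.
  apply Rmult_le_pos. apply Rabs_pos. apply pow_le; lra.
Qed.

Lemma PSeries_lin (u v : nat -> R) (a b x : R) :
  Rbar_lt (Rabs x) (CV_radius u) -> Rbar_lt (Rabs x) (CV_radius v) ->
  PSeries (fun n => a * u n + b * v n) x = a * PSeries u x + b * PSeries v x.
Proof.
  intros Hu Hv. assert (Eu := proj1 (ex_pseries_R u x) (CV_radius_inside u x Hu)).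
  assert (Ev := proj1 (ex_pseries_R v x) (CV_radius_inside v x Hv)).
  unfold PSeries. rewrite <- !Series_scal_l.
  rewrite <- Series_plus.
  - apply Series_ext. intros n. ring.
  - apply (ex_series_Rmult_l a). auto.
  - apply (ex_series_Rmult_l b). auto.
Qed.

Definition exp_coef (w : C) (n : nat) : C := (RtoC (/ INR (fact n)) * w ^ n)%C.

Lemma Cmod_exp_coef (w : C) (n : nat) : Cmod (exp_coef w n) = Cmod w ^ n / INR (fact n).
Proof.
  unfold exp_coef. rewrite Cmod_mult, Cmod_pow, Cmod_R, Rabs_pos_eq. unfold Rdiv; apply Rmult_comm.
  apply Rinv_nonneg, INR_fact_lt_0.
Qed.

Lemma exp_coef_S (w : C) (n : nat) : (RtoC (INR (S n)) * exp_coef w (S n))%C = (w * exp_coef w n)%C.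
Proof.
  unfold exp_coef.
  replace (RtoC (/ INR (fact n))) with (RtoC (INR (S n)) * RtoC (/ INR (fact (S n))))%C. simpl; ring.
  rewrite <- RtoC_mult. f_equal. rewrite fact_simpl, mult_INR. field. split. apply INR_fact_neq_0. apply not_0_INR; lia.
Qed.

(** Along the real multiples t w, the sum of the exponential series solves
    y' = w y. *)
Lemma is_Cseries_exp (w : C) : is_Cseries (exp_coef w) (cexp w).
Proof.
  assert (Hs : forall rho, ex_series (fun n => Cmod (exp_coef w n) * rho ^ n)).
  { intros rho. eapply ex_series_ext; [|apply (ex_series_exp (Cmod w * rho))].
    intros n. rewrite Cmod_exp_coef, Rpow_mult_distr. simpl. unfold Rdiv. ring. }
  assert (HR : forall x, Rbar_lt (Rabs x) (CV_radius (fun n => Re (exp_coef w n)))).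
  { intros x. apply CV_radius_gt with (Rabs x + 1). assert (H := Rabs_pos x); lra. 2: lra.
    apply ex_series_Re; auto. assert (H := Rabs_pos x); lra. }
  assert (HI : forall x, Rbar_lt (Rabs x) (CV_radius (fun n => Im (exp_coef w n)))).
  { intros x. apply CV_radius_gt with (Rabs x + 1). assert (H := Rabs_pos x); lra. 2: lra.
    apply ex_series_Im; auto. assert (H := Rabs_pos x); lra. }
  assert (Hode := linear_ode (Re w) (Im w) (PSeries_Re (exp_coef w)) (PSeries_Im (exp_coef w)) 1 Rle_0_1).
  destruct Hode as [E1 E2].
  - intros t _. unfold PSeries_Re.
    replace (Re w * _ - _) with (PSeries (PS_derive (fun n => Re (exp_coef w n))) t). now apply is_derive_PSeries.
    transitivity (PSeries (fun n => Re w * Re (exp_coef w n) + - Im w * Im (exp_coef w n)) t).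
    + apply Series_ext. intros n. f_equal. unfold PS_derive. rewrite <- re_scal_l, exp_coef_S, Re_Cmult. ring.
    + rewrite PSeries_lin by auto. unfold PSeries_Im. ring.
  - intros t _. unfold PSeries_Im.
    replace (Re w * _ + _) with (PSeries (PS_derive (fun n => Im (exp_coef w n))) t). now apply is_derive_PSeries.
    transitivity (PSeries (fun n => Re w * Im (exp_coef w n) + Im w * Re (exp_coef w n)) t).
    + apply Series_ext. intros n. f_equal. unfold PS_derive. rewrite <- im_scal_l, exp_coef_S, Im_Cmult. ring.
    + rewrite PSeries_lin by auto. unfold PSeries_Re. ring.
  - unfold PSeries_Re. rewrite PSeries_at_0. unfold exp_coef; simpl. field.
  - unfold PSeries_Im. rewrite PSeries_at_0. unfold exp_coef; simpl. field.
  - assert (H := is_Cseries_PSeries (exp_coef w) 1 1 Rlt_0_1 (Hs 1) ltac:(lra)).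
    rewrite E1, E2, !Rmult_1_r in H. eapply is_Cseries_ext; [|exact H].
    intros n. simpl. rewrite Cpow_1_l. ring.
Qed.

(** * The terms of the Dirichlet series *)

Lemma nat_Cpow_opp_cexp (n : nat) (s : C) : nat_Cpow_opp n s = cexp (- s * RtoC (ln (INR n)))%C.
Proof.
  unfold nat_Cpow_opp, cexp, Rpower. simpl.
  replace (- fst s * ln (INR n) - - snd s * 0) with (- Re s * ln (INR n)) by (unfold Re; ring).
  replace (- fst s * 0 + - snd s * ln (INR n)) with (- (Im s * ln (INR n))) by (unfold Im; ring).
  rewrite cos_neg, sin_neg. unfold Re, Im. f_equal. ring.
Qed.

Lemma Cmod_nat_Cpow_opp (n : nat) (s : C) : Cmod (nat_Cpow_opp n s) = Rpower (INR n) (- Re s).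
Proof.
  rewrite nat_Cpow_opp_cexp, Cmod_cexp. unfold Rpower. f_equal. simpl. unfold Re. ring.
Qed.

(** The expansion of n^(-s) at s0 is n^(-s0) times an exponential series in
    - z ln n; the weighted norm is the value of n^(-s) at the leftmost point of
    the disc. *)
Lemma majorized_nat_Cpow_opp (n : nat) (s0 : C) (rho : R) : (1 <= n)%nat -> 0 <= rho ->
  majorized (nat_Cpow_opp n) s0 rho (Rpower (INR n) (- (Re s0 - rho))).
Proof.
  intros Hn Hr. set (L := ln (INR n)).
  assert (HL : 0 <= L). { unfold L. rewrite <- ln_1. apply ln_le. lra. change 1 with (INR 1). now apply le_INR. }
  exists (fun k => nat_Cpow_opp n s0 * exp_coef (RtoC (- L)) k)%C. split.
  - intros N.
    rewrite (sum_n_ext_R _ (fun k => Rpower (INR n) (- Re s0) * ((L * rho) ^ k / INR (fact k)))).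
    2:{ intros k _. rewrite Cmod_mult, Cmod_nat_Cpow_opp, Cmod_exp_coef, Cmod_R, Rabs_Ropp, Rabs_pos_eq, Rpow_mult_distr by auto.
        unfold Rdiv; ring. }
    rewrite sum_n_scal_l.
    replace (- (Re s0 - rho)) with (- Re s0 + rho) by ring. rewrite Rpower_plus.
    apply Rmult_le_compat_l. apply Rlt_le, exp_pos.
    replace (Rpower (INR n) rho) with (exp (L * rho)) by (unfold Rpower, L; f_equal; ring).
    assert (HS : Series (fun k => (L * rho) ^ k / INR (fact k)) = exp (L * rho)).
    { apply is_series_unique. assert (H := is_exp_Reals (L * rho)). apply is_pseries_R in H.
      eapply is_series_ext; [|exact H]. intros k; simpl. unfold Rdiv. apply Rmult_comm. }
    rewrite <- HS. apply sum_n_le_Series. 2: apply ex_series_exp.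
    intros k. apply Rmult_le_pos. apply pow_le. now apply Rmult_le_pos. apply Rinv_nonneg, INR_fact_lt_0.
  - intros z Hz. replace (nat_Cpow_opp n (s0 + z)%C) with (nat_Cpow_opp n s0 * cexp (RtoC (- L) * z))%C.
    + eapply is_Cseries_ext; [|apply (is_Cseries_scal (nat_Cpow_opp n s0) _ _ (is_Cseries_exp (RtoC (- L) * z)%C))].
      intros k. unfold exp_coef. simpl. rewrite Cpow_mult_l. ring.
    + rewrite !nat_Cpow_opp_cexp, <- cexp_plus. f_equal. fold L. rewrite RtoC_opp. ring.
Qed.

(** * The binomial series *)

Fixpoint cbinom (w : C) (j : nat) : C :=
  match j with
  | O => 1
  | S j => cbinom w j * ((w - RtoC (INR j)) / RtoC (INR (S j)))
  end%C.

(** The rising factorial A (A+1) ... (A+j-1) divided by j!, a bound for the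
    binomial coefficients binom(w,j) with |w| <= A. *)
Fixpoint rising (A : R) (j : nat) : R :=
  match j with
  | O => 1
  | S j => rising A j * ((A + INR j) / INR (S j))
  end.

Lemma rising_pos (A : R) (j : nat) : 0 < A -> 0 < rising A j.
Proof.
  intros HA. induction j as [|j IH]; cbn [rising]. lra. assert (Hj := pos_INR j).
  apply Rmult_lt_0_compat; auto. apply Rdiv_lt_0_compat. lra. apply lt_0_INR; lia.
Qed.

Lemma Cmod_cbinom_factor (w : C) (A : R) (j : nat) : Cmod w <= A ->
  Cmod ((w - RtoC (INR j)) / RtoC (INR (S j)))%C <= (A + INR j) / INR (S j).
Proof.
  intros HA. assert (Hn := INR_S_pos j).
  unfold Cdiv. rewrite <- RtoC_inv by lra.
  rewrite Cmod_mult, Cmod_R, Rabs_pos_eq by (apply Rinv_nonneg; auto).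
  apply Rmult_le_compat_r. apply Rinv_nonneg; auto.
  unfold Cminus. eapply Rle_trans; [apply Cmod_triangle|]. rewrite Cmod_opp, Cmod_R, Rabs_pos_eq by apply pos_INR. lra.
Qed.

Lemma Cmod_cbinom_le (w : C) (A : R) (j : nat) : 0 < A -> Cmod w <= A -> Cmod (cbinom w j) <= rising A j.
Proof.
  intros HA0 HA. induction j as [|j IH]; cbn [cbinom rising].
  - rewrite Cmod_1. lra.
  - rewrite Cmod_mult. apply Rmult_le_compat; auto using Cmod_ge_0. now apply Cmod_cbinom_factor.
Qed.

(** The ratio of consecutive terms tends to rho. *)
Lemma ex_series_rising (A rho : R) : 0 < A -> 0 < rho < 1 -> ex_series (fun j => rising A j * rho ^ j).
Proof.
  intros HA Hr.
  assert (Hp : forall j, 0 < rising A j * rho ^ j).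
  { intros j. apply Rmult_lt_0_compat. now apply rising_pos. apply pow_lt; lra. }
  apply ex_series_ext with (fun j => Rabs (rising A j * rho ^ j)).
  { intros j. apply Rabs_pos_eq. now apply Rlt_le. }
  apply ex_series_DAlembert with rho. lra.
  - intros j. apply Rgt_not_eq, Hp.
  - apply is_lim_seq_ext with (fun j => rho + (A - 1) * rho * / INR (S j)).
    + intros j. assert (Hj := INR_S_pos j).
      assert (H1 := rising_pos A j HA). assert (H2 : 0 < rho ^ j) by (apply pow_lt; lra). assert (Hj0 := pos_INR j).
      cbn [rising]. rewrite <- tech_pow_Rmult.
      replace (rising A j * ((A + INR j) / INR (S j)) * (rho * rho ^ j) / (rising A j * rho ^ j))
        with ((A + INR j) / INR (S j) * rho) by (field; lra).
      rewrite Rabs_pos_eq. rewrite S_INR in *. field. lra.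
      apply Rmult_le_pos; [|lra]. apply Rlt_le, Rdiv_lt_0_compat; lra.
    + replace (Finite rho) with (Finite (rho + (A - 1) * rho * 0)) by (f_equal; ring).
      apply is_lim_seq_plus'. apply is_lim_seq_const.
      apply (is_lim_seq_scal_l _ ((A - 1) * rho) 0).
      exact is_lim_seq_inv_INR_S.
Qed.

Lemma ex_series_cbinom (w : C) (rho : R) : 0 < rho < 1 -> ex_series (fun j => Cmod (cbinom w j) * rho ^ j).
Proof.
  intros Hr. assert (Hw := Cmod_ge_0 w).
  apply ex_series_Rabs_le with (fun j => rising (Cmod w + 1) j * rho ^ j).
  - intros j. rewrite Rabs_pos_eq. apply Rmult_le_compat_r. apply pow_le; lra. apply Cmod_cbinom_le; lra.
    apply Rmult_le_pos. apply Cmod_ge_0. apply pow_le; lra.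
  - apply ex_series_rising; auto. lra.
Qed.

Lemma cbinom_S (w : C) (j : nat) :
  (RtoC (INR (S j)) * cbinom w (S j))%C = ((w - RtoC (INR j)) * cbinom w j)%C.
Proof.
  cbn [cbinom]. assert (Hn : RtoC (INR (S j)) <> 0). { intros H. apply RtoC_inj in H. revert H. apply not_0_INR; lia. }
  field. auto.
Qed.

Lemma PSeries_derive_shift (u v : nat -> R) (y s : R) :
  Rbar_lt (Rabs y) (CV_radius u) -> 0 < 1 + y -> PSeries v y = s ->
  (forall n, INR (S n) * u (S n) = v n - INR n * u n) -> PSeries (PS_derive u) y = s / (1 + y).
Proof.
  intros Hu Hy <- Huv.
  assert (E : PSeries (PS_derive u) y + y * PSeries (PS_derive u) y = PSeries v y).
  { rewrite <- PSeries_incr_1, <- PSeries_plus.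
    - apply Series_ext. intros n. f_equal. unfold PS_plus, PS_derive, plus; simpl plus.
      rewrite Huv. destruct n; simpl; unfold zero; simpl; ring.
    - apply CV_radius_inside. now rewrite CV_radius_derive.
    - apply CV_radius_inside. now rewrite CV_radius_incr_1, CV_radius_derive. }
  rewrite <- E. field. lra.
Qed.

(** The expansion of (1 + x)^w for complex w, from the differential equation
    (1 + x) y' = w y, put in the linear form of [linear_ode] by x = e^t - 1. *)
Lemma binomial_series (w : C) (x : R) : 0 <= x < 1 ->
  is_Cseries (fun j => cbinom w j * RtoC x ^ j)%C (cexp (w * RtoC (ln (1 + x)))).
Proof.
  intros Hx. set (rho := (x + 1) / 2). assert (Hrho : 0 < rho < 1) by (unfold rho; lra).
  assert (Hxr : x < rho) by (unfold rho; lra).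
  assert (Hs := ex_series_cbinom w rho Hrho).
  set (yr := PSeries_Re (cbinom w)). set (yi := PSeries_Im (cbinom w)).
  assert (HR : forall y, 0 <= y <= x -> Rbar_lt (Rabs y) (CV_radius (fun n => Re (cbinom w n)))).
  { intros y Hy. apply CV_radius_gt with rho; try lra. apply ex_series_Re; auto; lra. rewrite Rabs_pos_eq; lra. }
  assert (HI : forall y, 0 <= y <= x -> Rbar_lt (Rabs y) (CV_radius (fun n => Im (cbinom w n)))).
  { intros y Hy. apply CV_radius_gt with rho; try lra. apply ex_series_Im; auto; lra. rewrite Rabs_pos_eq; lra. }
  assert (HdR : forall y, 0 <= y <= x -> is_derive yr y ((Re w * yr y - Im w * yi y) / (1 + y))).
  { intros y Hy. rewrite <- (PSeries_derive_shift (fun n => Re (cbinom w n)) (fun n => Re w * Re (cbinom w n) + - Im w * Im (cbinom w n))).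
    - now apply is_derive_PSeries, HR.
    - auto.
    - lra.
    - rewrite PSeries_lin by auto. unfold yr, yi, PSeries_Re, PSeries_Im. ring.
    - intros n. rewrite <- re_scal_l, cbinom_S, Re_Cmult, Re_Cminus, Im_Cminus. simpl (Re (RtoC _)). simpl (Im (RtoC _)). ring. }
  assert (HdI : forall y, 0 <= y <= x -> is_derive yi y ((Re w * yi y + Im w * yr y) / (1 + y))).
  { intros y Hy. rewrite <- (PSeries_derive_shift (fun n => Im (cbinom w n)) (fun n => Re w * Im (cbinom w n) + Im w * Re (cbinom w n))).
    - now apply is_derive_PSeries, HI.
    - auto.
    - lra.
    - rewrite PSeries_lin by auto. reflexivity.
    - intros n. rewrite <- im_scal_l, cbinom_S, Im_Cmult, Re_Cminus, Im_Cminus. simpl (Re (RtoC _)). simpl (Im (RtoC _)). ring. }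
  set (T := ln (1 + x)). assert (HT : 0 <= T) by (unfold T; rewrite <- ln_1; apply ln_le; lra).
  assert (Hrange : forall t, 0 <= t <= T -> 0 <= exp t - 1 <= x).
  { intros t Ht. assert (H1 : exp 0 <= exp t). { destruct (proj1 Ht) as [H|<-]; [left; now apply exp_increasing|lra]. }
    assert (H2 : exp t <= exp T). { destruct (proj2 Ht) as [H|<-]; [left; now apply exp_increasing|lra]. }
    unfold T in H2. rewrite exp_ln in H2 by lra. rewrite exp_0 in H1. lra. }
  assert (Hd0 : forall t, is_derive (fun t => exp t - 1) t (exp t)).
  { intros t. auto_derive; auto; ring. }
  destruct (linear_ode (Re w) (Im w) (fun t => yr (exp t - 1)) (fun t => yi (exp t - 1)) T HT) as [E1 E2].
  - intros t Ht.
    replace (Re w * yr (exp t - 1) - Im w * yi (exp t - 1)) with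
      (exp t * ((Re w * yr (exp t - 1) - Im w * yi (exp t - 1)) / (1 + (exp t - 1)))).
    apply (is_derive_comp yr (fun t => exp t - 1)). apply HdR. now apply Hrange. apply Hd0.
    assert (H := exp_pos t). field. lra.
  - intros t Ht.
    replace (Re w * yi (exp t - 1) + Im w * yr (exp t - 1)) with
      (exp t * ((Re w * yi (exp t - 1) + Im w * yr (exp t - 1)) / (1 + (exp t - 1)))).
    apply (is_derive_comp yi (fun t => exp t - 1)). apply HdI. now apply Hrange. apply Hd0.
    assert (H := exp_pos t). field. lra.
  - rewrite exp_0, Rminus_diag. unfold yr, PSeries_Re. now rewrite PSeries_at_0.
  - rewrite exp_0, Rminus_diag. unfold yi, PSeries_Im. now rewrite PSeries_at_0.
  - assert (H := is_Cseries_PSeries (cbinom w) rho x (proj1 Hrho) Hs ltac:(lra)).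
    fold yr yi in H. unfold T in E1, E2. rewrite exp_ln in E1, E2 by lra.
    replace (1 + x - 1) with x in E1, E2 by ring. rewrite E1, E2 in H.
    assert (Ec : cexp (w * RtoC (ln (1 + x)))%C =
      (exp (Re w * ln (1 + x)) * cos (Im w * ln (1 + x)), exp (Re w * ln (1 + x)) * sin (Im w * ln (1 + x)))).
    { unfold cexp. now rewrite re_scal_r, im_scal_r. }
    fold T in Ec, H. rewrite Ec. exact H.
Qed.

(** * Continuation of the numerator of zeta *)

Definition pseries (sigma : R) : R := Series (fun k => Rpower (INR (S (S k))) (- sigma)).

(** A discrete form of the derivative of t^(-a): with d = ln (n+1) - ln n, use
    e^(a d) >= 1 + a d and d >= 1/(n+1). It makes the p-series telescope. *)
Lemma Rpower_telescope (a : R) (n : nat) : 0 < a -> (1 <= n)%nat ->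
  a * Rpower (INR (S n)) (- (a + 1)) <= Rpower (INR n) (- a) - Rpower (INR (S n)) (- a).
Proof.
  intros Ha Hn. assert (H1 : 1 <= INR n) by (change 1 with (INR 1); now apply le_INR).
  rewrite S_INR. set (x := INR n) in *.
  assert (Hl : / (x + 1) <= ln (x + 1) - ln x).
  { assert (ln x - ln (x + 1) <= - / (x + 1)); [|lra].
    rewrite <- ln_div by lra. rewrite <- (ln_exp (- / (x + 1))). apply ln_le. apply Rdiv_lt_0_compat; lra.
    eapply Rle_trans; [|apply exp_ineq1_le]. right. field. lra. }
  replace (Rpower x (- a)) with (Rpower (x + 1) (- a) * exp (a * (ln (x + 1) - ln x))).
  2:{ unfold Rpower. rewrite <- exp_plus. f_equal. ring. }
  replace (Rpower (x + 1) (- (a + 1))) with (Rpower (x + 1) (- a) * / (x + 1)).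
  2:{ replace (- (a + 1)) with (- a + - (1)) by ring. rewrite Rpower_plus, (Rpower_Ropp (x + 1) 1), Rpower_1 by lra. reflexivity. }
  assert (HP : 0 < Rpower (x + 1) (- a)) by apply exp_pos.
  assert (He := exp_ineq1_le (a * (ln (x + 1) - ln x))).
  assert (Hm : a * / (x + 1) <= a * (ln (x + 1) - ln x)) by (apply Rmult_le_compat_l; lra).
  replace (a * (Rpower (x + 1) (- a) * / (x + 1))) with (Rpower (x + 1) (- a) * (a * / (x + 1))) by ring.
  replace (Rpower (x + 1) (- a) * exp (a * (ln (x + 1) - ln x)) - Rpower (x + 1) (- a))
    with (Rpower (x + 1) (- a) * (exp (a * (ln (x + 1) - ln x)) - 1)) by ring.
  apply Rmult_le_compat_l; lra.
Qed.

Lemma ex_series_Rpower (sigma : R) : 1 < sigma -> ex_series (fun k => Rpower (INR (S (S k))) (- sigma)).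
Proof.
  intros Hs. set (a := sigma - 1). assert (Ha : 0 < a) by (unfold a; lra).
  apply (ex_series_bounded _ (/ a)).
  - intros k. apply Rlt_le, exp_pos.
  - assert (H : forall N, sum_n (fun k => Rpower (INR (S (S k))) (- sigma)) N <= / a * (1 - Rpower (INR (S (S N))) (- a))).
    { assert (H0 : forall n, (1 <= n)%nat -> Rpower (INR (S n)) (- sigma) <= / a * (Rpower (INR n) (- a) - Rpower (INR (S n)) (- a))).
      { intros n Hn. assert (H := Rpower_telescope a n Ha Hn). replace (- sigma) with (- (a + 1)) by (unfold a; ring).
        apply Rmult_le_reg_l with a; auto.
        replace (a * (/ a * (Rpower (INR n) (- a) - Rpower (INR (S n)) (- a)))) with (Rpower (INR n) (- a) - Rpower (INR (S n)) (- a)) by (field; lra).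
        exact H. }
      induction N as [|N IH].
      - rewrite sum_O. specialize (H0 1%nat (le_n _)). replace (Rpower (INR 1) (- a)) with 1 in H0. exact H0.
        unfold Rpower. simpl. rewrite ln_1, Rmult_0_r, exp_0. auto.
      - rewrite sum_Sn_R. specialize (H0 (S (S N)) ltac:(lia)). lra. }
    intros N. eapply Rle_trans; [apply H|].
    assert (0 < Rpower (INR (S (S N))) (- a)) by apply exp_pos.
    assert (0 < / a) by (now apply Rinv_0_lt_compat). nra.
Qed.

Lemma pseries_nonneg (sigma : R) : 1 < sigma -> 0 <= pseries sigma.
Proof.
  intros Hs. eapply Rle_trans; [|apply (sum_n_le_Series _ 0)].
  - rewrite sum_O. apply Rlt_le, exp_pos.
  - intros; apply Rlt_le, exp_pos.
  - now apply ex_series_Rpower.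
Qed.

Lemma Rpower_half_pow (sigma : R) (k i : nat) :
  Rpower (INR (S (S k))) (- (sigma + INR i)) <= (1 / 2) ^ i * Rpower (INR (S (S k))) (- sigma).
Proof.
  replace (- (sigma + INR i)) with (- INR i + - sigma) by ring. rewrite Rpower_plus.
  apply Rmult_le_compat_r. apply Rlt_le, exp_pos.
  assert (Hk : 2 <= INR (S (S k))). { rewrite !S_INR. assert (H := pos_INR k). lra. }
  rewrite Rpower_Ropp, Rpower_pow by lra. rewrite <- pow_inv. apply pow_incr. split.
  - apply Rinv_nonneg; lra.
  - replace (1 / 2) with (/ 2) by field. apply Rinv_le_contravar; lra.
Qed.

(** Every base n >= 2 contributes a factor at most 2^(-i); this is the reason
    for starting at n = 2. *)
Lemma pseries_shift (sigma : R) (i : nat) : 1 < sigma -> pseries (sigma + INR i) <= (1 / 2) ^ i * pseries sigma.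
Proof.
  intros Hs. unfold pseries. rewrite <- Series_scal_l. apply Series_le.
  - intros k. split. apply Rlt_le, exp_pos. apply Rpower_half_pow.
  - apply (ex_series_Rmult_l ((1/2)^i)). now apply ex_series_Rpower.
Qed.

Definition zeta_from_2 (s : C) : C := Cseries (fun k => nat_Cpow_opp (S (S k)) s).

Lemma is_Cseries_zeta_from_2 (s : C) : 1 < Re s -> is_Cseries (fun k => nat_Cpow_opp (S (S k)) s) (zeta_from_2 s).
Proof.
  intros Hs. apply ex_Cseries_Cmod with (fun k => Rpower (INR (S (S k))) (- Re s)).
  - intros k. rewrite Cmod_nat_Cpow_opp. apply Rle_refl.
  - now apply ex_series_Rpower.
Qed.

(** The numerator (s - 1) (zeta(s) - 1), as given by the Dirichlet series; it
    is the quantity that extends to an entire function. *)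
Definition numer_dirichlet (s : C) : C := ((s + RtoC (-1)) * zeta_from_2 s)%C.

Lemma majorized_numer_dirichlet (s0 : C) (rho : R) : 0 < rho -> 1 < Re s0 - rho ->
  majorized numer_dirichlet s0 rho ((Cmod (s0 + RtoC (-1)) + rho) * pseries (Re s0 - rho)).
Proof.
  intros Hr Hs. apply majorized_affine. lra.
  apply (majorized_series (fun k => nat_Cpow_opp (S (S k)))); auto.
  - now apply ex_series_Rpower.
  - intros k. apply majorized_nat_Cpow_opp. lia. lra.
Qed.

Lemma nat_Cpow_opp_add_INR (n : nat) (s : C) (i : nat) :
  nat_Cpow_opp (S n) (s + RtoC (INR i))%C = (nat_Cpow_opp (S n) s * RtoC (/ INR (S n)) ^ i)%C.
Proof.
  assert (Hn := INR_S_pos n).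
  rewrite !nat_Cpow_opp_cexp, <- RtoC_pow.
  replace (RtoC ((/ INR (S n)) ^ i)) with (cexp (RtoC (- INR i * ln (INR (S n))))).
  - rewrite <- cexp_plus. f_equal. rewrite RtoC_mult, RtoC_opp. ring.
  - unfold cexp. simpl Re; simpl Im. rewrite cos_0, sin_0, Rmult_1_r, Rmult_0_r.
    change (RtoC (exp (- INR i * ln (INR (S n)))) = RtoC ((/ INR (S n)) ^ i)). f_equal.
    change (Rpower (INR (S n)) (- INR i) = (/ INR (S n)) ^ i).
    rewrite Rpower_Ropp, Rpower_pow by auto. now rewrite pow_inv.
Qed.

(** The binomial series for (n+1)^(1-s) = n^(1-s) (1 + 1/n)^(1-s). *)
Lemma nat_Cpow_opp_succ (n : nat) (s : C) : (2 <= S n)%nat ->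
  is_Cseries (fun j => cbinom (1 - s) j * nat_Cpow_opp (S n) (s + RtoC (-1) + RtoC (INR j)))%C
     (nat_Cpow_opp (S (S n)) (s + RtoC (-1))%C).
Proof.
  intros Hn. assert (H2 : 2 <= INR (S n)) by (change 2 with (INR 2); apply le_INR; lia).
  assert (Hx : 0 <= / INR (S n) < 1).
  { split. apply Rinv_nonneg; lra. rewrite <- Rinv_1. apply Rinv_lt_contravar; lra. }
  assert (H := is_Cseries_scal (nat_Cpow_opp (S n) (s + RtoC (-1))%C) _ _ (binomial_series (1 - s)%C _ Hx)).
  replace (nat_Cpow_opp (S (S n)) (s + RtoC (-1))%C) with
    (nat_Cpow_opp (S n) (s + RtoC (-1)) * cexp ((1 - s) * RtoC (ln (1 + / INR (S n)))))%C.
  - eapply is_Cseries_ext; [|exact H]. intros j. cbv beta. rewrite nat_Cpow_opp_add_INR. ring.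
  - rewrite !nat_Cpow_opp_cexp, <- cexp_plus. f_equal.
    replace (ln (INR (S (S n)))) with (ln (INR (S n)) + ln (1 + / INR (S n))).
    + rewrite RtoC_plus. ring.
    + rewrite <- ln_mult by lra. f_equal. rewrite (S_INR (S n)). field. lra.
Qed.

Lemma Rpower_lim_0 (a : R) : 0 < a -> is_lim_seq (fun n => Rpower (INR (S n)) (- a)) 0.
Proof.
  intros Ha. apply (is_lim_seq_incr_1 (fun n => Rpower (INR n) (- a))).
  assert (H : is_lim (fun y => Rpower y (- a)) p_infty 0).
  { unfold Rpower.
    apply (is_lim_comp exp (fun y => - a * ln y) p_infty 0 m_infty).
    - apply is_lim_exp_m.
    - replace m_infty with (Rbar_mult (- a) p_infty).
      apply is_lim_scal_l. apply is_lim_ln_p.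
      simpl. destruct (Rle_dec 0 (- a)); [exfalso; lra|]. reflexivity.
    - exists 0. intros; discriminate. }
  apply (is_lim_comp_seq _ _ p_infty 0 H). exists 0%nat; intros; discriminate. apply is_lim_seq_INR.
Qed.

Lemma is_Cseries_telescope (s : C) : 1 < Re s ->
  is_Cseries (fun k => nat_Cpow_opp (S (S k)) (s + RtoC (-1)) - nat_Cpow_opp (S (S (S k))) (s + RtoC (-1)))%C
    (nat_Cpow_opp 2 (s + RtoC (-1))%C).
Proof.
  intros Hs. set (g := fun n => nat_Cpow_opp n (s + RtoC (-1))%C).
  assert (Hlim : is_lim_seq (fun n => Cmod (g (S (S (S n))))) 0).
  { apply is_lim_seq_ext with (fun n => Rpower (INR (S (S (S n)))) (- (Re s - 1))).
    intros n. unfold g. rewrite Cmod_nat_Cpow_opp, re_plus. change (Re (RtoC (-1))) with (-1). f_equal.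
    apply (is_lim_seq_incr_1 (fun n => Rpower (INR (S (S n))) (- (Re s - 1)))).
    apply (is_lim_seq_incr_1 (fun n => Rpower (INR (S n)) (- (Re s - 1)))).
    apply Rpower_lim_0. lra. }
  assert (Hc : forall proj : C -> R, (forall z, Rabs (proj z) <= Cmod z) -> (forall z w, proj (z - w)%C = proj z - proj w) ->
     is_series (fun k => proj (g (S (S k)) - g (S (S (S k))))%C) (proj (g 2%nat))).
  { intros proj Hp Hm.
    assert (E : forall N, sum_n (fun k => proj (g (S (S k)) - g (S (S (S k))))%C) N = proj (g 2%nat) - proj (g (S (S (S N))))).
    { induction N as [|N IH]. rewrite sum_O, Hm; reflexivity. rewrite sum_Sn_R, IH, Hm. as_R_eq. ring. }
    change (is_lim_seq (sum_n (fun k => proj (g (S (S k)) - g (S (S (S k))))%C)) (proj (g 2%nat))).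
    apply is_lim_seq_ext with (fun N => proj (g 2%nat) - proj (g (S (S (S N))))). intros; now rewrite E.
    replace (Finite (proj (g 2%nat))) with (Finite (proj (g 2%nat) - 0)) by (f_equal; ring).
    apply is_lim_seq_minus'. apply is_lim_seq_const. apply is_lim_seq_abs_0.
    apply is_lim_seq_le_le with (fun _ => 0) (fun n => Cmod (g (S (S (S n))))); auto.
    intros n. split; auto using Rabs_pos. apply is_lim_seq_const. }
  split; apply Hc; auto using re_le_Cmod, Im_le_Cmod.
Qed.

Lemma RtoC_INR_S_neq_0 (i : nat) : RtoC (INR (S i)) <> 0.
Proof. intros H. apply RtoC_inj in H. revert H. apply not_0_INR; lia. Qed.

(** Expand n^(1-s) - (n+1)^(1-s) in powers of 1/n and sum over n >= 2: the left
    side telescopes, and in the double series the sum over n of the terms in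
    n^(-s-i) is a value of the Dirichlet series. The factor 1 - s - i of
    binom(1-s, i+1) turns it into a value of the numerator. *)
Lemma numer_dirichlet_functional (s : C) : 1 < Re s ->
  is_Cseries (fun i => cbinom (1 - s) i / RtoC (INR (S i)) * numer_dirichlet (s + RtoC (INR i)))%C
    (nat_Cpow_opp 2 (s + RtoC (-1))%C).
Proof.
  intros Hs.
  rewrite <- (is_Cseries_unique _ _ (is_Cseries_telescope s Hs)).
  set (u := fun k i => (- cbinom (1 - s) (S i) * nat_Cpow_opp (S (S k)) (s + RtoC (INR i)))%C).
  assert (Hrow : forall k, is_Cseries (u k)
     (nat_Cpow_opp (S (S k)) (s + RtoC (-1)) - nat_Cpow_opp (S (S (S k))) (s + RtoC (-1)))%C).
  { intros k. assert (H := is_Cseries_decr_1 _ _ (nat_Cpow_opp_succ (S k) s ltac:(lia))).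
    apply (is_Cseries_scal (RtoC (-1))) in H.
    match goal with |- is_Cseries _ ?l => match type of H with is_Cseries _ ?l' => replace l with l' end end.
    - eapply is_Cseries_ext; [|exact H]. intros j. unfold u. cbv beta.
      replace (s + RtoC (-1) + RtoC (INR (S j)))%C with (s + RtoC (INR j))%C. ring.
      rewrite S_INR, RtoC_plus. ring.
    - cbn [cbinom]. simpl (INR 0). replace (s + RtoC (-1) + RtoC 0)%C with (s + RtoC (-1))%C by ring.
      ring. }
  set (K := Series (fun i => Cmod (cbinom (1 - s) (S i)) * (1 / 2) ^ i)).
  assert (HexK : ex_series (fun i => Cmod (cbinom (1 - s) (S i)) * (1 / 2) ^ i)).
  { assert (H := ex_series_cbinom (1 - s)%C (1 / 2) ltac:(lra)).
    apply (ex_series_incr_1 (fun j => Cmod (cbinom (1 - s) j) * (1 / 2) ^ j)) in H.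
    apply (ex_series_Rmult_l 2) in H.
    eapply ex_series_ext; [|exact H]. intros i. unfold scal; simpl. unfold mult; simpl. field. }
  apply (is_Cseries_swap u (fun k => Rpower (INR (S (S k))) (- Re s) * K)).
  - apply ex_series_ext with (fun k => K * Rpower (INR (S (S k))) (- Re s)). intros; simpl; ring.
    apply (ex_series_Rmult_l K). now apply ex_series_Rpower.
  - intros k N. apply Rle_trans with (sum_n (fun i => Rpower (INR (S (S k))) (- Re s) * (Cmod (cbinom (1 - s) (S i)) * (1 / 2) ^ i)) N).
    + apply sum_n_le_R. intros i _. unfold u. rewrite Cmod_mult, Cmod_opp, Cmod_nat_Cpow_opp, re_plus.
      assert (H := Rpower_half_pow (Re s) k i). assert (Hc := Cmod_ge_0 (cbinom (1 - s) (S i))).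
      rewrite Re_RtoC. nra.
    + rewrite sum_n_scal_l. apply Rmult_le_compat_l. apply Rlt_le, exp_pos. apply sum_n_le_Series; auto.
      intros i. apply Rmult_le_pos. apply Cmod_ge_0. apply pow_le; lra.
  - exact Hrow.
  - intros i. unfold u.
    replace (cbinom (1 - s) i / RtoC (INR (S i)) * numer_dirichlet (s + RtoC (INR i)))%C
      with (- cbinom (1 - s) (S i) * zeta_from_2 (s + RtoC (INR i)))%C.
    + apply is_Cseries_scal, is_Cseries_zeta_from_2. rewrite re_plus. rewrite Re_RtoC. assert (H := pos_INR i). lra.
    + unfold numer_dirichlet. cbn [cbinom]. field. apply RtoC_INR_S_neq_0.
Qed.

(** The functional equation of the numerator solved for its term i = 0; the
    right side only uses h on the half-planes Re > Re s + 1. *)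
Definition continuation_step (h : C -> C) (s : C) : C :=
  (nat_Cpow_opp 2 (s + RtoC (-1)) -
   Cseries (fun i => cbinom (1 - s) (S i) / RtoC (INR (S (S i))) * h (s + RtoC (INR (S i)))))%C.

(** The p-th extension is the right one for Re s > 1 - p. *)
Fixpoint numer_continued (p : nat) : C -> C :=
  match p with
  | O => numer_dirichlet
  | S p => continuation_step (numer_continued p)
  end.

(** One step does not change the Dirichlet series, by its functional
    equation; for further steps both sides are the same expression in functions
    that agree on the half-plane where they are used. *)
Lemma numer_continued_consistent (p : nat) : forall s, 1 - INR p < Re s -> numer_continued (S p) s = numer_continued p s.
Proof.
  induction p as [|p IH]; intros s Hs.
  - simpl in Hs. cbn [numer_continued]. unfold continuation_step.
    assert (H := is_Cseries_decr_1 _ _ (numer_dirichlet_functional s ltac:(lra))).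
    rewrite (is_Cseries_unique _ _ H). cbn [cbinom]. simpl (INR 0). simpl (INR 1).
    replace (s + RtoC 0)%C with s by ring. field.
  - change (continuation_step (numer_continued (S p)) s = continuation_step (numer_continued p) s).
    unfold continuation_step. apply (f_equal2 Cminus eq_refl). apply Cseries_ext. intros i. f_equal. apply IH.
    rewrite re_plus. rewrite Re_RtoC. rewrite S_INR in Hs. rewrite S_INR. assert (H := pos_INR i). lra.
Qed.

Lemma numer_continued_consistent_le (p p' : nat) (s : C) : (p <= p')%nat -> 1 - INR p < Re s -> numer_continued p' s = numer_continued p s.
Proof.
  intros H Hs. induction H as [|p' H IH]; auto. rewrite numer_continued_consistent; auto.
  apply le_INR in H. lra.
Qed.

Lemma majorized_nonneg (g : C -> C) (s0 : C) (rho B : R) : majorized g s0 rho B -> 0 <= B.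
Proof.
  intros [a [Ha _]]. specialize (Ha 0%nat). rewrite sum_O in Ha. simpl in Ha.
  assert (H := Cmod_ge_0 (a 0%nat)). lra.
Qed.

Lemma majorized_le (g : C -> C) (s0 : C) (rho B B' : R) : B <= B' -> majorized g s0 rho B -> majorized g s0 rho B'.
Proof.
  intros H [a [Ha1 Ha2]]. exists a. split; auto. intros N. eapply Rle_trans; [apply Ha1|auto].
Qed.

(** binom(1-s, j) is a product of j affine factors in s; they are multiplied in
    one at a time. *)
Lemma majorized_cbinom (g : C -> C) (s0 : C) (rho B A : R) (j : nat) : 0 <= rho -> 0 < A -> Cmod (s0 + RtoC (-1)) + rho <= A ->
  majorized g s0 rho B -> majorized (fun s => cbinom (1 - s) j * g s)%C s0 rho (rising A j * B).
Proof.
  intros Hr HA0 HA Hg. assert (HB := majorized_nonneg _ _ _ _ Hg).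
  induction j as [|j IH]; cbn [rising].
  - rewrite Rmult_1_l. revert Hg. apply majorized_ext. intros z _. cbn [cbinom]. ring.
  - assert (Hj := INR_S_pos j). assert (Hr1 := rising_pos A j HA0).
    assert (Hi : 0 < / INR (S j)) by (now apply Rinv_0_lt_compat).
    assert (H := majorized_scal (RtoC (- / INR (S j))) _ _ _ _ (majorized_affine (RtoC (INR j - 1)) _ s0 rho _ Hr IH)).
    cbv beta in H.
    apply (majorized_le _ _ _ _ (rising A j * ((A + INR j) / INR (S j)) * B)) in H.
    + revert H. apply majorized_ext. intros z _. cbn [cbinom].
      rewrite RtoC_opp, RtoC_inv, RtoC_minus by lra. field. apply RtoC_INR_S_neq_0.
    + rewrite Cmod_R, Rabs_Ropp, Rabs_pos_eq by lra.
      replace (rising A j * ((A + INR j) / INR (S j)) * B) with (/ INR (S j) * ((A + INR j) * (rising A j * B))) by (unfold Rdiv; ring).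
      apply Rmult_le_compat_l; [lra|]. apply Rmult_le_compat_r. apply Rmult_le_pos; lra.
      replace (s0 + RtoC (INR j - 1))%C with ((s0 + RtoC (-1)) + RtoC (INR j))%C by (rewrite RtoC_minus; ring).
      eapply Rle_trans; [apply Rplus_le_compat_r, Cmod_triangle|]. rewrite Cmod_R, Rabs_pos_eq by apply pos_INR. lra.
Qed.

(** By induction on p, the terms of the continuation step are majorized. For
    large i they involve the Dirichlet series far to the right, of size 2^(-i),
    against binomial coefficients that grow polynomially; so the bounds are
    summable. *)
Lemma majorized_numer_continued (p : nat) : forall s0 rho, 0 < rho -> 1 - INR p < Re s0 - rho -> exists B, majorized (numer_continued p) s0 rho B.
Proof.
  induction p as [|p IH]; intros s0 rho Hr Hs.
  - simpl in Hs. eexists. apply majorized_numer_dirichlet; lra.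
  - set (A := Cmod (s0 + RtoC (-1)) + rho). assert (HA : 0 < A) by (unfold A; assert (H := Cmod_ge_0 (s0 + RtoC (-1))); lra).
    set (N0 := S p).
    (* From the index N0 on, the arguments s + i + 1 stay in the half-plane of the Dirichlet series. *)
    assert (Htau : 1 < Re s0 + INR (S N0) - rho) by (unfold N0; rewrite !S_INR in *; lra).
    set (Z := pseries (Re s0 + INR (S N0) - rho)).
    assert (HZ : 0 <= Z) by (now apply pseries_nonneg).
    assert (Hterm : forall i, exists B, majorized (fun s => numer_continued p (s + RtoC (INR (S i))))%C s0 rho B /\
      ((N0 <= i)%nat -> B <= (A + 2) * INR (S (S i)) * ((1 / 2) ^ (i - N0) * Z))).
    { intros i. destruct (Compare_dec.le_lt_dec N0 i) as [Hi|Hi].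
      - exists ((Cmod (s0 + RtoC (INR (S i)) + RtoC (-1)) + rho) * pseries (Re s0 + INR (S i) - rho)). split.
        + apply majorized_translate.
          assert (Hi' : INR (S N0) <= INR (S i)) by (apply le_INR; lia).
          assert (Hm := majorized_numer_dirichlet (s0 + RtoC (INR (S i)))%C rho Hr).
          rewrite re_plus in Hm. rewrite Re_RtoC in Hm. specialize (Hm ltac:(lra)). revert Hm.
          apply majorized_ext. intros z Hz. symmetry. apply (numer_continued_consistent_le 0 p). lia. simpl (INR 0).
          rewrite !re_plus. rewrite Re_RtoC. assert (Hzr := re_le_Cmod z). assert (- Rabs (Re z) <= Re z) by (assert (H := Rle_abs (- Re z)); rewrite Rabs_Ropp in H; lra). lra.
        + intros _. apply Rmult_le_compat.
          * assert (H := Cmod_ge_0 (s0 + RtoC (INR (S i)) + RtoC (-1))). lra.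
          * apply pseries_nonneg. assert (Hi' : INR (S N0) <= INR (S i)) by (apply le_INR; lia). lra.
          * replace (s0 + RtoC (INR (S i)) + RtoC (-1))%C with ((s0 + RtoC (-1)) + RtoC (INR (S i)))%C by ring.
            apply Rle_trans with (A + INR (S i)).
            unfold A. assert (H := Cmod_triangle (s0 + RtoC (-1)) (RtoC (INR (S i)))).
            rewrite (Cmod_R (INR _)), Rabs_pos_eq in H by apply pos_INR. lra.
            rewrite !S_INR. assert (H := pos_INR i). nra.
          * replace (Re s0 + INR (S i) - rho) with (Re s0 + INR (S N0) - rho + INR (i - N0)).
            now apply pseries_shift. rewrite minus_INR, !S_INR by auto. ring.
      - destruct (IH (s0 + RtoC (INR (S i)))%C rho Hr) as [B HB].
        + rewrite re_plus. rewrite Re_RtoC. rewrite S_INR in Hs. rewrite S_INR. assert (H := pos_INR i). lra.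
        + exists B. split. now apply majorized_translate. intros; lia. }
    set (B := fun i => proj1_sig (constructive_indefinite_description _ (Hterm i))).
    assert (HB : forall i, majorized (fun s => numer_continued p (s + RtoC (INR (S i))))%C s0 rho (B i) /\
      ((N0 <= i)%nat -> B i <= (A + 2) * INR (S (S i)) * ((1 / 2) ^ (i - N0) * Z))).
    { intros i. unfold B. destruct constructive_indefinite_description as [b Hb]. exact Hb. }
    set (D := fun i => / INR (S (S i)) * (rising A (S i) * B i)).
    assert (Hm : forall i, majorized (fun s => cbinom (1 - s) (S i) / RtoC (INR (S (S i))) * numer_continued p (s + RtoC (INR (S i))))%C s0 rho (D i)).
    { intros i. assert (H := majorized_cbinom _ s0 rho (B i) A (S i) (Rlt_le _ _ Hr) HA (Rle_refl _) (proj1 (HB i))).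
      apply (majorized_scal (RtoC (/ INR (S (S i))))) in H.
      assert (Hi := INR_S_pos (S i)).
      rewrite Cmod_R, Rabs_pos_eq in H by (apply Rinv_nonneg; auto).
      revert H. apply majorized_ext. intros z _. rewrite RtoC_inv by lra. field. apply RtoC_INR_S_neq_0. }
    assert (HD : ex_series D).
    { apply (ex_series_incr_n D N0).
      apply ex_series_Rabs_le with (fun k => ((A + 2) * Z * 2 ^ S N0) * (rising A (S (N0 + k)) * (1 / 2) ^ (S (N0 + k)))).
      - intros k. assert (HD0 := majorized_nonneg _ _ _ _ (Hm (N0 + k)%nat)). rewrite Rabs_pos_eq by auto.
        unfold D. destruct (HB (N0 + k)%nat) as [_ Hb]. specialize (Hb ltac:(lia)).
        replace (N0 + k - N0)%nat with k in Hb by lia.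
        set (i := (N0 + k)%nat) in *. assert (Hi := INR_S_pos (S i)).
        assert (Hr1 := rising_pos A (S i) HA).
        apply Rle_trans with (/ INR (S (S i)) * (rising A (S i) * ((A + 2) * INR (S (S i)) * ((1 / 2) ^ k * Z)))).
        + apply Rmult_le_compat_l. apply Rinv_nonneg; auto. apply Rmult_le_compat_l; lra.
        + right. assert (E : (1 / 2) ^ S i = (1 / 2) ^ S N0 * (1 / 2) ^ k) by (rewrite <- pow_add; f_equal; unfold i; lia).
          assert (H2 : 2 ^ S N0 * (1 / 2) ^ S N0 = 1). { rewrite <- Rpow_mult_distr. replace (2 * (1 / 2)) with 1 by field. apply pow1. }
          rewrite E. revert H2 Hi.
          generalize ((1 / 2) ^ S N0) ((1 / 2) ^ k) (2 ^ S N0) (INR (S (S i))) (rising A (S i)). intros x1 x2 x3 x4 x5 H2 Hi.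
          transitivity ((x5 * ((A + 2) * (x2 * Z))) * (x3 * x1)). rewrite H2. field. lra. ring.
      - apply (ex_series_Rmult_l ((A + 2) * Z * 2 ^ S N0)).
        assert (H := ex_series_rising A (1 / 2) HA ltac:(lra)).
        apply (ex_series_incr_n (fun j => rising A j * (1 / 2) ^ j) (S N0)) in H. exact H. }
    assert (HT := majorized_series _ s0 rho D Hr HD Hm).
    apply (majorized_scal (RtoC (-1))) in HT.
    assert (HP := majorized_translate _ (RtoC (-1)) s0 rho _ (majorized_nat_Cpow_opp 2 (s0 + RtoC (-1))%C rho ltac:(lia) (Rlt_le _ _ Hr))).
    assert (HF := majorized_plus _ _ s0 rho _ _ (Rlt_le _ _ Hr) HP HT).
    match type of HF with majorized _ _ _ ?b => exists b end. revert HF. apply majorized_ext. intros z _.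
    change (numer_continued N0 (s0 + z)%C) with (continuation_step (numer_continued p) (s0 + z)%C). unfold continuation_step. ring.
Qed.

Lemma half_plane_index (s : C) : exists p, 1 - INR p < Re s.
Proof. destruct (INR_unbounded (1 - Re s)) as [p Hp]. exists p. lra. Qed.

(** The choice of the half-plane is immaterial, as the extensions agree. *)
Definition numer (s : C) : C := numer_continued (proj1_sig (constructive_indefinite_description _ (half_plane_index s))) s.

Lemma numer_eq (p : nat) (s : C) : 1 - INR p < Re s -> numer s = numer_continued p s.
Proof.
  intros Hp. unfold numer. destruct constructive_indefinite_description as [p' Hp']; simpl.
  destruct (Nat.le_ge_cases p p').
  - now apply numer_continued_consistent_le.
  - symmetry. now apply numer_continued_consistent_le.
Qed.

Lemma numer_step (s : C) : numer s = continuation_step numer s.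
Proof.
  destruct (half_plane_index s) as [p Hp].
  rewrite (numer_eq (S p)) by (rewrite S_INR; lra). cbn [numer_continued].
  unfold continuation_step. apply (f_equal2 Cminus eq_refl). apply Cseries_ext. intros i. f_equal.
  symmetry. apply numer_eq. rewrite re_plus, Re_RtoC. assert (H := pos_INR (S i)). lra.
Qed.

(** * Analytic continuation of zeta *)

Lemma is_Cseries_geom_bound (a : nat -> C) (M r : R) (w : C) : 0 < r -> 0 <= M -> Cmod w < r ->
  (forall k, Cmod (a k) * r ^ k <= M) ->
  is_Cseries (fun k => a k * w ^ k)%C (Cseries (fun k => a k * w ^ k)%C).
Proof.
  intros Hr HM Hw Ha. assert (Hw0 := Cmod_ge_0 w).
  apply ex_Cseries_Cmod with (fun k => M * (Cmod w / r) ^ k).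
  - intros k. assert (Hrk : 0 < r ^ k) by (apply pow_lt; auto).
    rewrite Cmod_mult, Cmod_pow. unfold Rdiv. rewrite Rpow_mult_distr, pow_inv.
    replace (Cmod (a k) * Cmod w ^ k) with (Cmod (a k) * r ^ k * (Cmod w ^ k * / r ^ k)) by (field; lra).
    apply Rmult_le_compat_r; auto. apply Rmult_le_pos. now apply pow_le. apply Rinv_nonneg; auto.
  - apply (ex_series_Rmult_l M). apply ex_series_geom.
    rewrite Rabs_pos_eq. apply Rmult_lt_reg_r with r; auto. unfold Rdiv. rewrite Rmult_assoc, Rinv_l; lra.
    apply Rdiv_le_0_compat; auto.
Qed.

(** Coefficients of the quotient of a power series by c + z. *)
Fixpoint div_coef (b : nat -> C) (c : C) (k : nat) : C :=
  match k with
  | O => b 0%nat / c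
  | S k => (b (S k) - div_coef b c k) / c
  end%C.

(** If r <= |c|/2, the recursion contracts: each step adds at most B/|c| and
    halves the previous bound. *)
Lemma div_coef_bound (b : nat -> C) (c : C) (r B : R) (k : nat) : c <> RtoC 0 -> 0 < r <= Cmod c / 2 ->
  (forall k, Cmod (b k) * r ^ k <= B) -> Cmod (div_coef b c k) * r ^ k <= 2 * B / Cmod c.
Proof.
  intros Hc Hr Hb. assert (Hc0 : 0 < Cmod c) by (now apply Cmod_gt_0).
  assert (HB : 0 <= B). { specialize (Hb 0%nat). simpl in Hb. assert (H := Cmod_ge_0 (b 0%nat)). lra. }
  induction k as [|k IH]; cbn [div_coef].
  - rewrite Cmod_div by auto. specialize (Hb 0%nat). simpl in *.
    replace (Cmod (b 0%nat) / Cmod c * 1) with (Cmod (b 0%nat) * 1 * / Cmod c) by (field; lra).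
    apply Rmult_le_compat_r. apply Rinv_nonneg; auto. lra.
  - rewrite Cmod_div by auto. specialize (Hb (S k)).
    assert (Hrk : 0 < r ^ S k) by (apply pow_lt; lra).
    apply Rle_trans with ((Cmod (b (S k)) * r ^ S k + r * (Cmod (div_coef b c k) * r ^ k)) / Cmod c).
    + rewrite <- tech_pow_Rmult in *.
      replace ((Cmod (b (S k)) * (r * r ^ k) + r * (Cmod (div_coef b c k) * r ^ k)) / Cmod c)
        with ((Cmod (b (S k)) + Cmod (div_coef b c k)) / Cmod c * (r * r ^ k)) by (field; lra).
      apply Rmult_le_compat_r; [lra|]. apply Rmult_le_compat_r. apply Rinv_nonneg; auto.
      unfold Cminus. eapply Rle_trans; [apply Cmod_triangle|]. rewrite Cmod_opp. lra.
    + apply Rmult_le_compat_r. apply Rinv_nonneg; auto.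
      assert (H : r * (Cmod (div_coef b c k) * r ^ k) <= Cmod c / 2 * (2 * B / Cmod c)).
      { apply Rmult_le_compat; try lra. apply Rmult_le_pos. apply Cmod_ge_0. apply pow_le; lra. }
      replace (Cmod c / 2 * (2 * B / Cmod c)) with B in H by (field; lra). lra.
Qed.

(** The quotient by s - 1 = c + z has the coefficients given by long division;
    as c is not 0 they again satisfy a geometric bound. *)
Lemma majorized_div_analytic (g : C -> C) (s0 : C) (rho B : R) : 0 < rho -> s0 <> RtoC 1 ->
  majorized g s0 rho B -> C_analytic_at (fun s => 1 + g s / (s - 1))%C s0.
Proof.
  intros Hr Hs [b [Hb1 Hb2]]. set (c := (s0 - 1)%C).
  assert (Hc : c <> RtoC 0). { intros H. apply Hs. replace s0 with (c + 1)%C by (unfold c; ring). rewrite H. ring. }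
  assert (Hc0 : 0 < Cmod c) by (now apply Cmod_gt_0).
  set (r := Rmin rho (Cmod c / 2)).
  assert (Hr0 : 0 < r) by (apply Rmin_pos; lra).
  assert (Hr1 : r <= rho) by apply Rmin_l. assert (Hr2 : r <= Cmod c / 2) by apply Rmin_r.
  assert (Hb : forall k, Cmod (b k) * r ^ k <= B).
  { intros k. eapply Rle_trans; [|apply (Hb1 k)].
    eapply Rle_trans; [|apply (sum_n_term_le (fun k => Cmod (b k) * rho ^ k) k k); auto].
    - apply Rmult_le_compat_l. apply Cmod_ge_0. apply pow_incr; lra.
    - intros; apply Rmult_le_pos. apply Cmod_ge_0. apply pow_le; lra. }
  assert (HB0 : 0 <= B). { specialize (Hb 0%nat). simpl in Hb. assert (H := Cmod_ge_0 (b 0%nat)). lra. }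
  set (a := div_coef b c).
  assert (Ha : forall k, Cmod (a k) * r ^ k <= 2 * B / Cmod c) by (intros; now apply div_coef_bound).
  exists (fun k => a k + match k with O => 1 | _ => 0 end)%C, r. split; auto. intros z Hz.
  apply is_pseries_is_Cseries. set (w := (z - s0)%C) in *.
  assert (HG := is_Cseries_geom_bound a (2 * B / Cmod c) r w Hr0
    ltac:(apply Rmult_le_pos; [lra|apply Rinv_nonneg; auto]) Hz Ha).
  set (G := Cseries (fun k => a k * w ^ k)%C) in *.
  assert (Hg : is_Cseries (fun k => b k * w ^ k)%C (c * G + w * G)%C).
  { assert (H1 := is_Cseries_scal c _ _ HG).
    assert (H2 : is_Cseries (fun k => match k with O => 0 | S k => a k end * w ^ k)%C (w * G)%C).
    { replace (w * G)%C with (0 * w ^ 0 + w * G)%C by ring.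
      apply (is_Cseries_incr_1 (fun k => match k with O => 0 | S k => a k end * w ^ k)%C).
      eapply is_Cseries_ext; [|apply (is_Cseries_scal w _ _ HG)]. intros n; simpl. ring. }
    eapply is_Cseries_ext; [|apply (is_Cseries_plus _ _ _ _ H1 H2)].
    intros [|k]; unfold a; cbn [div_coef]; [|rewrite Cpow_S]; field; auto. }
  assert (Eg : g z = (c * G + w * G)%C).
  { rewrite <- (is_Cseries_unique _ _ Hg). symmetry. apply is_Cseries_unique.
    replace z with (s0 + w)%C by (unfold w; ring). apply Hb2. lra. }
  assert (Hz1 : (z - 1)%C = (c + w)%C) by (unfold c, w; ring).
  assert (Hnz : (c + w)%C <> RtoC 0).
  { intros H. assert (Hcw : c = (- w)%C) by (replace c with ((c + w) - w)%C by ring; rewrite H; ring).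
    assert (Cmod c = Cmod w) by (rewrite Hcw; apply Cmod_opp). lra. }
  replace (1 + g z / (z - 1))%C with (G + 1)%C.
  2:{ rewrite Eg, Hz1. field. auto. }
  assert (H1 : is_Cseries (fun k => match k with O => 1 | _ => 0 end * w ^ k)%C (1 * w ^ 0 + 0)%C).
  { apply (is_Cseries_incr_1 (fun k => match k with O => 1 | _ => 0 end * w ^ k)%C).
    eapply is_Cseries_ext with (fun k => 0 * (a k * w ^ k))%C. intros; simpl; ring.
    assert (H0 := is_Cseries_scal 0 _ _ HG). replace (0 * G)%C with (RtoC 0) in H0 by ring. exact H0. }
  assert (E1 : (1 * w ^ 0 + 0)%C = RtoC 1) by (simpl; ring). rewrite E1 in H1.
  eapply is_Cseries_ext; [|apply (is_Cseries_plus _ _ _ _ HG H1)]. intros k; simpl. ring.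
Qed.

Definition zeta_continuation (s : C) : C := (1 + numer s / (s - 1))%C.

Lemma zeta_continuation_analytic (s : C) : s <> RtoC 1 -> C_analytic_at zeta_continuation s.
Proof.
  intros Hs. destruct (half_plane_index (s - RtoC 1)%C) as [p Hp]. rewrite Re_Cminus, Re_RtoC in Hp.
  destruct (majorized_numer_continued p s 1 Rlt_0_1 Hp) as [B HB].
  apply (majorized_div_analytic numer s 1 B Rlt_0_1 Hs).
  revert HB. apply majorized_ext. intros z Hz. symmetry. apply numer_eq. rewrite re_plus.
  assert (H := re_le_Cmod z). assert (H2 := Rle_abs (- Re z)). rewrite Rabs_Ropp in H2. lra.
Qed.

Lemma zeta_continuation_is_Riemann_zeta : is_Riemann_zeta zeta_continuation.
Proof.
  split.
  - exact zeta_continuation_analytic.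
  - intros s Hs. apply is_Cseries_is_series.
    unfold zeta_continuation. rewrite (numer_eq 0) by (simpl; lra). cbn [numer_continued]. unfold numer_dirichlet.
    replace (1 + (s + RtoC (-1)) * zeta_from_2 s / (s - 1))%C with (nat_Cpow_opp 1 s + zeta_from_2 s)%C.
    + apply (is_Cseries_incr_1 (fun n => nat_Cpow_opp (S n) s)). now apply is_Cseries_zeta_from_2.
    + replace (nat_Cpow_opp 1 s) with (RtoC 1).
      * field. intros H. apply (f_equal Re) in H. rewrite Re_Cminus, !Re_RtoC in H. lra.
      * unfold nat_Cpow_opp. simpl INR. unfold Rpower. rewrite ln_1, !Rmult_0_r, exp_0, cos_0, sin_0.
        unfold RtoC. f_equal; ring.
Qed.

(** * The identity theorem *)

(** Power series with geometrically bounded coefficients that vanish at points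
    arbitrarily close to 0. The property passes to the tail after division by the
    variable, which gives all coefficients from the first one. *)
Definition vanishing_series (d : nat -> C) : Prop :=
  exists r M, 0 < r /\ 0 <= M /\ (forall k, Cmod (d k) * r ^ k <= M) /\
    forall delta, 0 < delta -> exists w, w <> RtoC 0 /\ Cmod w < delta /\ is_Cseries (fun k => d k * w ^ k)%C 0.

(** At a zero w the constant term equals minus the rest of the series, which
    is O(|w|). *)
Lemma vanishing_series_head (d : nat -> C) : vanishing_series d -> d 0%nat = RtoC 0.
Proof.
  intros [r [M [Hr [HM [Hb Hz]]]]].
  destruct (Ceq_dec (d 0%nat) 0) as [|Hd]; auto. exfalso.
  assert (Hd0 : 0 < Cmod (d 0%nat)) by (now apply Cmod_gt_0).
  set (delta := Rmin (r / 2) (Cmod (d 0%nat) * r / (2 * M + 1))).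
  assert (Hdel : 0 < delta). { apply Rmin_pos. lra. apply Rdiv_lt_0_compat. now apply Rmult_lt_0_compat. lra. }
  destruct (Hz delta Hdel) as [w [Hw0 [Hw Hs]]].
  assert (Hw1 : Cmod w < r / 2) by (eapply Rlt_le_trans; [exact Hw|apply Rmin_l]).
  assert (Hw2 : Cmod w < Cmod (d 0%nat) * r / (2 * M + 1)) by (eapply Rlt_le_trans; [exact Hw|apply Rmin_r]).
  assert (Hwp := Cmod_ge_0 w).
  set (q := Cmod w / r). assert (Hq : 0 <= q <= 1 / 2).
  { unfold q. split. apply Rdiv_le_0_compat; auto.
    apply Rmult_le_reg_r with r; auto. unfold Rdiv. rewrite Rmult_assoc, Rinv_l; lra. }
  assert (Ht := is_Cseries_decr_1 _ _ Hs).
  assert (Hbd : Cmod (0 - d 0%nat * w ^ 0)%C <= 2 * M * q).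
  { apply (Cmod_is_Cseries_le _ _ _ Ht). intros N.
    apply Rle_trans with (sum_n (fun k => M * q * q ^ k) N).
    - apply sum_n_le_R. intros k _. rewrite Cmod_mult, Cmod_pow.
      replace (M * q * q ^ k) with (M * q ^ S k) by (simpl; ring).
      replace (Cmod w) with (q * r) by (unfold q; field; lra). rewrite Rpow_mult_distr.
      replace (Cmod (d (S k)) * (q ^ S k * r ^ S k)) with (Cmod (d (S k)) * r ^ S k * q ^ S k) by ring.
      apply Rmult_le_compat_r; auto. apply pow_le; lra.
    - rewrite sum_n_scal_l. rewrite Rmult_comm.
      assert (HG : sum_n (fun k => q ^ k) N <= 2).
      { apply Rle_trans with (Series (fun k => q ^ k)).
        apply sum_n_le_Series. intros; apply pow_le; lra. apply ex_series_geom. rewrite Rabs_pos_eq; lra.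
        rewrite Series_geom by (rewrite Rabs_pos_eq; lra).
        replace 2 with (/ (1 / 2)) by field. apply Rinv_le_contravar; lra. }
      replace (2 * M * q) with (2 * (M * q)) by ring. apply Rmult_le_compat_r; auto. apply Rmult_le_pos; lra. }
  replace (0 - d 0%nat * w ^ 0)%C with (- d 0%nat)%C in Hbd by (simpl; ring). rewrite Cmod_opp in Hbd.
  assert (Hf : Cmod w * (2 * M + 1) < Cmod (d 0%nat) * r).
  { apply Rmult_lt_reg_r with (/ (2 * M + 1)). apply Rinv_0_lt_compat; lra.
    rewrite Rmult_assoc, Rinv_r, Rmult_1_r by lra. exact Hw2. }
  assert (Hqr : Cmod w = q * r) by (unfold q; field; lra).
  rewrite Hqr in Hf. nra.
Qed.

Lemma vanishing_series_tail (d : nat -> C) : vanishing_series d -> vanishing_series (fun k => d (S k)).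
Proof.
  intros H. assert (Hd0 := vanishing_series_head d H).
  destruct H as [r [M [Hr [HM [Hb Hz]]]]].
  exists r, (M / r). split; [auto|split; [|split]].
  - apply Rdiv_le_0_compat; auto.
  - intros k. specialize (Hb (S k)). apply Rmult_le_reg_r with r; auto.
    unfold Rdiv. rewrite (Rmult_assoc M), Rinv_l, Rmult_1_r by lra. simpl in Hb. lra.
  - intros delta Hdel. destruct (Hz delta Hdel) as [w [Hw0 [Hw Hs]]]. exists w. split; [auto|split; [auto|]].
    assert (Ht := is_Cseries_scal (/ w)%C _ _ (is_Cseries_decr_1 _ _ Hs)). cbv beta in Ht. rewrite Hd0 in Ht.
    replace (/ w * (0 - 0 * w ^ 0))%C with (RtoC 0) in Ht by ring.
    eapply is_Cseries_ext; [|exact Ht]. intros k; cbv beta. rewrite Cpow_S. field. auto.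
Qed.

Lemma vanishing_series_eq_0 (d : nat -> C) (k : nat) : vanishing_series d -> d k = RtoC 0.
Proof.
  revert d. induction k as [|k IH]; intros d H.
  - now apply vanishing_series_head.
  - apply (IH (fun k => d (S k))). now apply vanishing_series_tail.
Qed.

Lemma is_series_terms_bounded (a : nat -> R) (l : R) : is_series a l -> exists M, forall n, Rabs (a n) <= M.
Proof.
  intros H. assert (H0 := ex_series_lim_0 a (ex_intro _ l H)).
  destruct (filterlim_bounded (K := R_AbsRing) (V := R_NormedModule) a) as [M HM].
  - exists 0. exact H0.
  - exists M. exact HM.
Qed.

Lemma is_Cseries_terms_bounded (a : nat -> C) (l : C) : is_Cseries a l -> exists M, 0 <= M /\ forall n, Cmod (a n) <= M.
Proof.
  intros [H1 H2]. destruct (is_series_terms_bounded _ _ H1) as [M1 HM1].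
  destruct (is_series_terms_bounded _ _ H2) as [M2 HM2]. exists (M1 + M2).
  assert (H : forall n, Cmod (a n) <= M1 + M2).
  { intros n. eapply Rle_trans; [apply Cmod_le_Re_Im|]. apply Rplus_le_compat; auto. }
  split; auto. eapply Rle_trans; [apply Cmod_ge_0|apply (H 0%nat)].
Qed.

Lemma analytic_local_identity (f g : C -> C) (z0 : C) :
  C_analytic_at f z0 -> C_analytic_at g z0 ->
  (forall delta, 0 < delta -> exists z, z <> z0 /\ Cmod (z - z0)%C < delta /\ f z = g z) ->
  exists rho, 0 < rho /\ forall z, Cmod (z - z0)%C < rho -> f z = g z.
Proof.
  intros [a [ra [Hra Ha]]] [b [rb [Hrb Hb]]] Hz.
  set (r := Rmin ra rb). assert (Hr : 0 < r) by (now apply Rmin_pos).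
  assert (Ha' : forall z, Cmod (z - z0)%C < r -> is_Cseries (fun k => a k * (z - z0) ^ k)%C (f z)).
  { intros z H. apply is_pseries_is_Cseries, Ha. eapply Rlt_le_trans; [exact H|apply Rmin_l]. }
  assert (Hb' : forall z, Cmod (z - z0)%C < r -> is_Cseries (fun k => b k * (z - z0) ^ k)%C (g z)).
  { intros z H. apply is_pseries_is_Cseries, Hb. eapply Rlt_le_trans; [exact H|apply Rmin_r]. }
  assert (Hd : forall z, Cmod (z - z0)%C < r -> is_Cseries (fun k => (a k - b k) * (z - z0) ^ k)%C (f z - g z)%C).
  { intros z H. assert (H1 := is_Cseries_plus _ _ _ _ (Ha' z H) (is_Cseries_scal (RtoC (-1)) _ _ (Hb' z H))).
    replace (f z - g z)%C with (f z + RtoC (-1) * g z)%C by ring.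
    eapply is_Cseries_ext; [|exact H1]. intros; cbv beta; ring. }
  assert (Hv : vanishing_series (fun k => a k - b k)%C).
  { assert (H2 : Cmod (z0 + RtoC (r / 2) - z0)%C = r / 2).
    { replace (z0 + RtoC (r / 2) - z0)%C with (RtoC (r / 2)) by ring. rewrite Cmod_R, Rabs_pos_eq; lra. }
    assert (Hs := Hd (z0 + RtoC (r / 2))%C ltac:(lra)).
    destruct (is_Cseries_terms_bounded _ _ Hs) as [M [HM HMb]].
    exists (r / 2), M. split; [lra|split; [auto|split]].
    - intros k. specialize (HMb k). rewrite Cmod_mult, Cmod_pow, H2 in HMb. exact HMb.
    - intros delta Hdel. destruct (Hz (Rmin delta r)) as [z [Hz0 [Hz1 Hz2]]]. now apply Rmin_pos.
      exists (z - z0)%C. split; [|split].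
      + intros H. apply Hz0. replace z with ((z - z0) + z0)%C by ring. rewrite H. ring.
      + eapply Rlt_le_trans; [exact Hz1|apply Rmin_l].
      + replace (RtoC 0) with (f z - g z)%C by (rewrite Hz2; ring). apply Hd.
        eapply Rlt_le_trans; [exact Hz1|apply Rmin_r]. }
  exists r. split; auto. intros z H.
  rewrite <- (is_Cseries_unique _ _ (Ha' z H)), <- (is_Cseries_unique _ _ (Hb' z H)).
  apply Cseries_ext. intros k. f_equal.
  replace (a k) with ((a k - b k) + b k)%C by ring. rewrite (vanishing_series_eq_0 _ k Hv). ring.
Qed.

(** The set of t such that f and g agree at the points of parameter at most t
    has a supremum; the local identity theorem at that point pushes it to 1. *)
Lemma analytic_identity_segment (f g : C -> C) (P Q : C) (rho : R) : P <> Q ->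
  (forall t, 0 <= t <= 1 -> C_analytic_at f (P + RtoC t * (Q - P))%C /\ C_analytic_at g (P + RtoC t * (Q - P))%C) ->
  0 < rho -> (forall z, Cmod (z - P)%C < rho -> f z = g z) -> f Q = g Q.
Proof.
  intros HPQ Han Hrho Hnear.
  set (gam := fun t => (P + RtoC t * (Q - P))%C).
  set (L := Cmod (Q - P)%C).
  assert (HL : 0 < L). { apply Cmod_gt_0. intros H. apply HPQ. replace Q with ((Q - P) + P)%C by ring. rewrite H. ring. }
  assert (Hscale : forall u d, u < d / L -> u * L < d) by (intros u d; now apply Rlt_div_r).
  assert (Hdist : forall t t', Cmod (gam t - gam t')%C = Rabs (t - t') * L).
  { intros t t'. unfold gam, L. rewrite <- Cmod_R, <- Cmod_mult. f_equal. rewrite RtoC_minus. ring. }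
  set (E := fun t => 0 <= t <= 1 /\ forall t', 0 <= t' <= t -> f (gam t') = g (gam t')).
  destruct (completeness E) as [T [HT1 HT2]].
  - exists 1. intros t [Ht _]. lra.
  - exists 0. split. lra. intros t' Ht'. replace t' with 0 by lra. apply Hnear.
    replace (gam 0 - P)%C with (RtoC 0) by (unfold gam; ring). now rewrite Cmod_0.
  - (* The coincidence set extends past each of its points, hence past its supremum. *)
    assert (Hsmall : forall u, 0 < u -> u < rho / L -> u <= 1 -> E u).
    { intros u Hu1 Hu2 Hu3. split. lra. intros t' Ht'. apply Hnear.
      replace (gam t' - P)%C with (gam t' - gam 0)%C by (unfold gam; ring). rewrite Hdist, Rminus_0_r, Rabs_pos_eq by lra.
      apply Hscale; lra. }
    assert (HT0 : 0 < T).
    { assert (Hq : 0 < rho / L) by (now apply Rdiv_lt_0_compat).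
      set (u := Rmin (rho / L / 2) 1). assert (0 < u) by (apply Rmin_pos; lra).
      assert (u <= rho / L / 2) by apply Rmin_l. assert (u <= 1) by apply Rmin_r.
      apply Rlt_le_trans with u; auto. apply HT1, Hsmall; lra. }
    assert (HT3 : T <= 1). { apply HT2. intros t [Ht _]. lra. }
    assert (Hbelow : forall t, 0 <= t < T -> f (gam t) = g (gam t)).
    { intros t Ht.
      assert (Hn : ~ is_upper_bound E t). { intros H. specialize (HT2 _ H). lra. }
      assert (Hex : exists u, E u /\ t < u).
      { apply Classical_Prop.NNPP. intros Hno. apply Hn. intros u Hu. destruct (Rle_lt_dec u t); auto. exfalso. apply Hno. exists u; auto. }
      destruct Hex as [u [[_ Hu] Hlt]]. apply Hu. lra. }
    destruct (Han T ltac:(lra)) as [HfT HgT].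
    destruct (analytic_local_identity f g (gam T) HfT HgT) as [rT [HrT HeqT]].
    { intros delta Hdel. set (e := Rmin (T / 2) (delta / L / 2)).
      assert (Hdl : 0 < delta / L) by (now apply Rdiv_lt_0_compat).
      assert (He : 0 < e) by (apply Rmin_pos; lra).
      assert (He1 : e <= T / 2) by apply Rmin_l. assert (He2 : e <= delta / L / 2) by apply Rmin_r.
      exists (gam (T - e)%R).
      assert (Hd : Cmod (gam (T - e)%R - gam T)%C = e * L).
      { rewrite Hdist. replace (T - e - T) with (- e) by ring. rewrite Rabs_Ropp, Rabs_pos_eq; lra. }
      split; [|split].
      - intros H. rewrite H in Hd. replace (gam T - gam T)%C with (RtoC 0) in Hd by ring. rewrite Cmod_0 in Hd. nra.
      - rewrite Hd. apply Hscale; lra.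
      - apply Hbelow. lra. }
    destruct (Rle_lt_or_eq_dec T 1 HT3) as [HTlt|HTeq].
    + exfalso. set (e := Rmin (1 - T) (rT / L / 2)).
      assert (Hdl : 0 < rT / L) by (now apply Rdiv_lt_0_compat).
      assert (He : 0 < e) by (apply Rmin_pos; lra).
      assert (He1 : e <= 1 - T) by apply Rmin_l. assert (He2 : e <= rT / L / 2) by apply Rmin_r.
      assert (HE : E (T + e)).
      { split. lra. intros t' Ht'. destruct (Rlt_le_dec t' T) as [Hlt|Hge].
        - apply Hbelow; lra.
        - apply HeqT. rewrite Hdist, Rabs_pos_eq by lra.
          apply Hscale; lra. }
      specialize (HT1 _ HE). lra.
    + replace Q with (gam T) by (rewrite HTeq; unfold gam; ring). apply HeqT.
      replace (gam T - gam T)%C with (RtoC 0) by ring. now rewrite Cmod_0.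
Qed.

(** Two continuations agree for Re s > 1 because they are the sum of the same
    Dirichlet series. *)
Lemma is_Riemann_zeta_unique_real (f g : C -> C) (x : R) : x < 1 ->
  is_Riemann_zeta f -> is_Riemann_zeta g -> f (RtoC x) = g (RtoC x).
Proof.
  intros Hx [Hf1 Hf2] [Hg1 Hg2].
  (* The segment from 2 + i to x avoids the pole. *)
  apply (analytic_identity_segment f g (2, 1) (RtoC x) 1).
  - intros H. apply (f_equal Im) in H. simpl in H. lra.
  - intros t Ht. set (z := ((2, 1) + RtoC t * (RtoC x - (2, 1)))%C).
    assert (Hz : z <> RtoC 1).
    { intros H. assert (H1 := f_equal Re H). assert (H2 := f_equal Im H). unfold z in H1, H2. simpl in H1, H2. nra. }
    split; auto.
  - lra.
  - intros z Hz. assert (Hr := re_le_Cmod (z - (2, 1))%C). rewrite Re_Cminus in Hr. simpl (Re (2, 1)) in Hr.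
    assert (H1 : 1 < Re z). { assert (H := Rle_abs (- (Re z - 2))). rewrite Rabs_Ropp in H. lra. }
    rewrite <- (is_Cseries_unique _ _ (proj2 (is_Cseries_is_series _ _) (Hf2 z H1))).
    apply is_Cseries_unique, is_Cseries_is_series, Hg2, H1.
Qed.

(** * Values of zeta at the non-positive integers *)

Lemma cbinom_nat (n j : nat) : (j <= n)%nat ->
  cbinom (RtoC (INR n)) j = RtoC (INR (fact n) / (INR (fact j) * INR (fact (n - j)))).
Proof.
  induction j as [|j IH]; intros Hj.
  - cbn [cbinom]. f_equal. rewrite Nat.sub_0_r. simpl (INR (fact 0)). field. apply INR_fact_neq_0.
  - cbn [cbinom]. rewrite IH by lia.
    unfold Cdiv. rewrite <- RtoC_inv, <- RtoC_minus, <- !RtoC_mult by (apply not_0_INR; lia). f_equal.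
    rewrite <- minus_INR by lia. replace (n - j)%nat with (S (n - S j)) by lia.
    rewrite !fact_simpl, !mult_INR. field. repeat split; try apply INR_fact_neq_0; apply not_0_INR; lia.
Qed.

Lemma cbinom_nat_0 (n j : nat) : (n < j)%nat -> cbinom (RtoC (INR n)) j = RtoC 0.
Proof.
  induction j as [|j IH]; intros Hj. lia. cbn [cbinom].
  destruct (Nat.eq_dec j n) as [->|H].
  - replace (RtoC (INR n) - RtoC (INR n))%C with (RtoC 0) by ring. unfold Cdiv. ring.
  - rewrite IH by lia. ring.
Qed.

Lemma sum_n_rev (f : nat -> R) (n : nat) : sum_n f n = sum_n (fun i => f (n - i)%nat) n.
Proof.
  induction n as [|n IH]. now rewrite !sum_O.
  rewrite (sum_Sn_R f), (sum_n_incr_1 (fun i => f (S n - i)%nat)), IH. apply Rplus_comm.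
Qed.

Lemma Cseries_RtoC (t : nat -> R) : Cseries (fun i => RtoC (t i)) = RtoC (Series t).
Proof.
  apply C_eq; simpl; auto. transitivity (Series (fun n => 0 * t n)). apply Series_ext; intros; ring.
  rewrite Series_scal_l. ring.
Qed.

Lemma Series_finite (t : nat -> R) (n : nat) : (forall i, (n < i)%nat -> t i = 0) -> Series t = sum_n t n.
Proof.
  intros H. apply is_series_unique.
  change (is_lim_seq (sum_n t) (sum_n t n)). apply is_lim_seq_ext_loc with (fun _ => sum_n t n).
  - exists n. intros N HN. induction HN as [|N HN IH]; auto. rewrite sum_Sn_R, <- IH, H by lia. symmetry. apply Rplus_0_r.
  - apply is_lim_seq_const.
Qed.

Lemma nat_Cpow_opp_2_neg (n : nat) : nat_Cpow_opp 2 (RtoC (1 - INR n) + RtoC (-1))%C = RtoC (2 ^ n).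
Proof.
  unfold nat_Cpow_opp. rewrite re_plus, !Re_RtoC.
  replace (Im (RtoC (1 - INR n) + RtoC (-1))%C) with 0 by (simpl; ring).
  rewrite Rmult_0_l, cos_0, sin_0, Rmult_0_r, Rmult_1_r, Ropp_0.
  unfold RtoC. f_equal. replace (- (1 - INR n + -1)) with (INR n) by ring.
  simpl (INR 2). replace (1 + 1) with 2 by ring. apply Rpower_pow. lra.
Qed.

(** At s = 1 - n the binomial coefficients binom(n, i) vanish for i > n, and the
    functional equation becomes the recurrence of the numbers B_n(2). *)
Lemma numer_nonpos (n : nat) : numer (RtoC (1 - INR n)) = RtoC (bernoulli n 2).
Proof.
  induction n as [n IH] using (well_founded_induction Wf_nat.lt_wf).
  rewrite numer_step. unfold continuation_step. rewrite nat_Cpow_opp_2_neg.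
  replace (1 - RtoC (1 - INR n))%C with (RtoC (INR n)) by (rewrite RtoC_minus; ring).
  destruct n as [|n].
  - rewrite (Cseries_ext _ (fun _ => RtoC 0)).
    2:{ intros i. rewrite cbinom_nat_0 by lia. unfold Cdiv. ring. }
    rewrite Cseries_RtoC, <- RtoC_minus. f_equal. rewrite (Series_finite _ 0) by auto. rewrite sum_O.
    unfold bernoulli, bernoulli_gen. simpl. destruct Req_EM_T; lra.
  - set (t := fun i => if Nat.leb i n then INR (fact (S n)) * (bernoulli (n - i) 2 / INR (fact (n - i)) * / INR (fact (S (S n) - (n - i)))) else 0).
    rewrite (Cseries_ext _ (fun i => RtoC (t i))).
    + rewrite Cseries_RtoC, <- RtoC_minus. f_equal.
      rewrite (Series_finite t n).
      2:{ intros i Hi. unfold t. replace (Nat.leb i n) with false by (symmetry; apply Nat.leb_gt; lia). auto. }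
      rewrite (sum_n_ext_R t (fun i => INR (fact (S n)) * (fun k => bernoulli k 2 / INR (fact k) * / INR (fact (S (S n) - k))) (n - i)%nat)).
      2:{ intros i Hi. unfold t. replace (Nat.leb i n) with true by (symmetry; apply Nat.leb_le; lia). auto. }
      rewrite sum_n_scal_l, <- (sum_n_rev (fun k => bernoulli k 2 / INR (fact k) * / INR (fact (S (S n) - k)))).
      assert (H := bernoulli_recurrence 2 (S n)). rewrite sum_Sn_R in H.
      replace (S (S n) - S n)%nat with 1%nat in H by lia. change (INR (fact 1)) with 1 in H.
      set (S1 := sum_n (fun k => bernoulli k 2 / INR (fact k) * / INR (fact (S (S n) - k))) n : R) in *.
      assert (Hf := INR_fact_neq_0 (S n)).
      replace S1 with (2 ^ S n / INR (fact (S n)) - bernoulli (S n) 2 / INR (fact (S n)) * / 1) by (rewrite <- H; ring).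
      field. auto.
    + intros i. unfold t. destruct (Nat.leb i n) eqn:Ei.
      * apply Nat.leb_le in Ei. rewrite cbinom_nat by lia.
        replace (RtoC (1 - INR (S n)) + RtoC (INR (S i)))%C with (RtoC (1 - INR (n - i))).
        2:{ rewrite <- RtoC_plus. f_equal. rewrite minus_INR, !S_INR by auto. ring. }
        rewrite IH by lia. unfold Cdiv. rewrite <- RtoC_inv, <- !RtoC_mult by (apply not_0_INR; lia). f_equal.
        replace (S (S n) - (n - i))%nat with (S (S i)) by lia. replace (S n - S i)%nat with (n - i)%nat by lia.
        rewrite (fact_simpl (S i)), mult_INR. field. repeat split; try apply INR_fact_neq_0; apply not_0_INR; lia.
      * apply Nat.leb_gt in Ei. rewrite cbinom_nat_0 by lia. unfold Cdiv. ring.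
Qed.

(** The value does not depend on which continuation the description of zeta
    selects. *)
Lemma zeta_nonpos (n : nat) : (1 <= n)%nat -> zeta (1 - INR n) = 1 - bernoulli n 2 / INR n.
Proof.
  intros Hn. assert (Hn1 : 1 <= INR n) by (change 1 with (INR 1); now apply le_INR).
  assert (HZ : is_Riemann_zeta Riemann_zeta).
  { unfold Riemann_zeta. apply epsilon_spec. exists zeta_continuation. apply zeta_continuation_is_Riemann_zeta. }
  unfold zeta. rewrite (is_Riemann_zeta_unique_real _ _ (1 - INR n) ltac:(lra) HZ zeta_continuation_is_Riemann_zeta).
  unfold zeta_continuation. rewrite numer_nonpos.
  rewrite <- RtoC_minus, <- RtoC_div, <- RtoC_plus by lra. rewrite Re_RtoC. field. lra.
Qed.

(** * The asymptotic expansion *)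

(** The m-th derivatives of 1/u in the two series cancel, leaving the regular
    part. *)
Lemma q_polygamma_minus_polygamma (m : nat) (q x : R) : 0 < q < 1 -> 0 < x ->
  q_polygamma (S m) q x - polygamma (S m) x =
  (- ln q) ^ S m * Series (fun n => - ln q * Derive_n (Derive_n bose_reg m) 1 (- ln q * (INR n + x))).
Proof.
  intros Hq Hx.
  assert (He := opp_ln_pos q Hq).
  rewrite q_polygamma_series, polygamma_series by auto. set (e := - ln q) in *.
  rewrite <- Series_scal_l, <- Series_minus.
  - apply Series_ext. intros n. assert (Hn := pos_INR n).
    assert (Heu : 0 < e * (INR n + x)) by (apply Rmult_lt_0_compat; lra).
    change (Derive_n (Derive_n bose_reg m) 1) with (Derive_n bose_reg (S m)).
    rewrite Derive_n_bose_reg_pos by auto. unfold inv_square_tower.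
    rewrite Rpow_mult_distr, <- (tech_pow_Rmult e (S m)), <- (tech_pow_Rmult (-1) m).
    assert (H1 : e ^ S m <> 0) by (apply pow_nonzero; lra).
    assert (H2 : (INR n + x) ^ S (S m) <> 0) by (apply pow_nonzero; lra).
    field. repeat split; auto; lra.
  - assert (Hs := tower_ex_series _ (S (S m)) x (q_tower_summable e He) Hx). exact Hs.
  - apply (tower_ex_series _ m x inv_square_tower_summable Hx).
Qed.

Lemma Derive_n_bose_reg_0_zeta (n : nat) : Derive_n bose_reg n 0 = (-1) ^ S n * zeta (1 - INR (S n)).
Proof.
  rewrite zeta_nonpos by lia. assert (H := Derive_n_bose_reg_0 n).
  assert (Hn := INR_S_pos n).
  apply Rmult_eq_reg_l with (INR (S n)); [|lra]. rewrite H. field. lra.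
Qed.

Theorem theorem6p1 (m : nat) (hm : (1 <= m)%nat) (x : R) (hx : 0 < x) :
  forall N : nat,
    is_bigO (at_left 1)
      (fun q : R =>
         q_polygamma m q x -
         (polygamma m x -
          sum_n (fun k : nat =>
                   zeta (1 - INR m - INR k) / INR (fact k) *
                   bernoulli k x * ln q ^ (m + k)) N))
      (fun q : R => Rabs (ln q) ^ (m + N + 1)).
Proof.
  intros N. destruct m as [|m]; [lia|]. clear hm.
  set (F := Derive_n bose_reg m).
  assert (EF : forall k, Derive_n F k = Derive_n bose_reg (k + m)).
  { intros k. apply functional_extensionality; intros u. apply Derive_n_comp. }
  assert (HFs : smooth F) by (apply smooth_Derive_n, smooth_bose_reg).
  assert (HF0 : forall k, exists C, 0 <= C /\ forall u, 0 <= u -> Rabs (Derive_n F k u) <= C / (1 + u) ^ 1).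
  { intros k. rewrite EF. apply Derive_n_bose_reg_bound; lia. }
  assert (HF1 : forall k, exists C, 0 <= C /\ forall u, 0 <= u -> Rabs (Derive_n F (S k) u) <= C / (1 + u) ^ 2).
  { intros k. rewrite EF. apply Derive_n_bose_reg_bound; lia. }
  destruct (euler_maclaurin F HFs HF0 HF1 x hx N) as [D HD].
  set (c := bern_coef x (S N) * Derive_n F (S N) 0).
  (* The term k = N + 1 of the expansion has the order of the error. *)
  exists (D + Rabs c).
  (* For q > 1/e the step - ln q is at most 1. *)
  assert (Hq1 : exp (-1) < 1) by (rewrite <- exp_0; apply exp_increasing; lra).
  exists (mkposreal (1 - exp (-1)) ltac:(lra)). intros q Hq Hq'.
  apply ball_R, Rabs_def2 in Hq. simpl in Hq. assert (Hqe : exp (-1) < q) by lra.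
  assert (Hq0 : 0 < q) by (assert (H := exp_pos (-1)); lra).
  assert (He : 0 < - ln q <= 1).
  { assert (H := ln_increasing q 1 Hq0 Hq'). rewrite ln_1 in H.
    assert (H2 := ln_increasing _ _ (exp_pos (-1)) Hqe). rewrite ln_exp in H2. lra. }
  specialize (HD (- ln q) He).
  assert (HS := q_polygamma_minus_polygamma m q x (conj Hq0 Hq') hx).
  set (e := - ln q) in *.
  assert (Hln : ln q = - e) by (unfold e; ring).
  replace (q_polygamma (S m) q x - _) with
    (e ^ S m * (Series (fun n => e * Derive_n F 1 (e * (INR n + x)))
        + sum_n (fun k => bern_coef x k * e ^ k * Derive_n F k 0) N)).
  2:{ rewrite Rmult_plus_distr_l. fold F in HS. rewrite <- HS, <- sum_n_scal_l.
      rewrite (sum_n_ext_R _ (fun k => zeta (1 - INR (S m) - INR k) / INR (fact k) * bernoulli k x * ln q ^ (S m + k))).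
      ring. intros k _. rewrite EF, Derive_n_bose_reg_0_zeta. unfold bern_coef.
      replace (1 - INR (S m) - INR k) with (1 - INR (S (k + m))) by (rewrite !S_INR, plus_INR; ring).
      rewrite Hln. replace (S m + k)%nat with (S (k + m)) by lia.
      replace (- e) with (-1 * e) by ring. rewrite Rpow_mult_distr.
      replace (e ^ S (k + m)) with (e ^ S m * e ^ k) by (rewrite <- pow_add; f_equal; lia).
      unfold Rdiv. ring. }
  rewrite sum_Sn_R in HD.
  set (S1 := Series (fun n => e * Derive_n F 1 (e * (INR n + x)))) in *.
  set (S2 := sum_n (fun k => bern_coef x k * e ^ k * Derive_n F k 0) N : R) in *.
  replace (bern_coef x (S N) * e ^ S N * Derive_n F (S N) 0) with (c * e ^ S N) in HD by (unfold c; ring).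
  rewrite Hln, Rabs_Ropp, (Rabs_pos_eq e) by lra.
  replace (S m + N + 1)%nat with (S m + S N)%nat by lia.
  assert (Hm : 0 < e ^ S m) by (apply pow_lt; lra). assert (HN : 0 < e ^ S N) by (apply pow_lt; lra).
  rewrite pow_add, Rabs_mult, (Rabs_pos_eq (e ^ S m * e ^ S N)), (Rabs_pos_eq (e ^ S m)) by nra.
  replace ((D + Rabs c) * (e ^ S m * e ^ S N)) with (e ^ S m * ((D + Rabs c) * e ^ S N)) by ring.
  apply Rmult_le_compat_l; [lra|].
  replace (S1 + S2) with ((S1 + (S2 + c * e ^ S N)) + - (c * e ^ S N)) by ring.
  eapply Rle_trans; [apply Rabs_triang|]. rewrite Rabs_Ropp, Rabs_mult, (Rabs_pos_eq (e ^ S N)) by lra. lra.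
Qed.
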